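(* Up to isomorphism there is exactly one connected symmetric configuration $22_3$ having no blocking set, namely the configuration on the 22 points $\{0,1,\dots,9,a,b,\dots,l\}$ with blocks 012, 034, 056, 135, 146, 236, 24l, 58f, 79c, 7ak, 7bl, 89a, 8ck, 9bk, abc, deh, dfj, dgi, egj, eil, fgh, hij (each triple of symbols denoting a block).
   Context: A symmetric configuration $v_3$ consists of a set of $v$ points and a collection of $v$ blocks, each block being a 3-element subset of the points, such that every point lies in exactly 3 blocks and any two distinct points lie in at most one common block; it is connected if it is not the union of two configurations on disjoint nonempty point sets. A blocking set is a subset $Q$ of the points such that every block contains at least one point of $Q$ and at least one point not in $Q$. *)

(* Defs.v *)
From mathcomp Require Import all_boot.
Set Implicit Arguments. Unset Strict Implicit. Unset Printing Implicit Defensive.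

Definition is_sym_config3 (T : finType) (B : {set {set T}}) : Prop :=
  [/\ #|B| = #|T|,
      (forall b, b \in B -> #|b| = 3),
      (forall x : T, #|[set b in B | x \in b]| = 3) &
      (forall x y : T, x != y -> #|[set b in B | (x \in b) && (y \in b)]| <= 1)].

Definition config_connected (T : finType) (B : {set {set T}}) : Prop :=
  forall P : {set T}, P != set0 -> P != setT ->
    exists2 b, b \in B & ~~ (b \subset P) && ~~ (b \subset ~: P).

Definition blocking_set (T : finType) (B : {set {set T}}) (Q : {set T}) : Prop :=
  forall b, b \in B -> (b :&: Q != set0) /\ (b :\: Q != set0).

Definition has_no_blocking_set (T : finType) (B : {set {set T}}) : Prop :=
  forall Q : {set T}, ~ blocking_set B Q.

Definition config_iso (T T' : finType) (B : {set {set T}}) (B' : {set {set T'}}) : Prop :=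
  exists f : T -> T', bijective f /\ [set f @: (b : {set T}) | b : {set T} in B] = B'.

(* The configuration C22 on points 0..9,a..l, encoded as 0..21 with
   a=10, b=11, c=12, d=13, e=14, f=15, g=16, h=17, i=18, j=19, k=20, l=21. *)
Definition triple22 (x y z : nat) : {set 'I_22} :=
  [set (inord x : 'I_22); inord y; inord z].

Definition C22_blocks : seq (nat * nat * nat) :=
  [:: (0,1,2); (0,3,4); (0,5,6); (1,3,5); (1,4,6); (2,3,6); (2,4,21);
      (5,8,15); (7,9,12); (7,10,20); (7,11,21); (8,9,10); (8,12,20);
      (9,11,20); (10,11,12); (13,14,17); (13,15,19); (13,16,18);
      (14,16,19); (14,18,21); (15,16,17); (17,18,19)].

Definition C22 : {set {set 'I_22}} :=
  [set b | b \in [seq triple22 t.1.1 t.1.2 t.2 | t <- C22_blocks]].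

(* Main.v *)
(* A blocking set is a 2-colouring of the points in which no block is monochromatic. In the
   cubic bipartite incidence graph, an 8-cycle whose complement has a perfect matching yields
   one: colour the cycle alternately and propagate along the matching. So in a graph without
   blocking sets the complement of every 8-cycle [C] violates Hall's condition, and splits
   into two lobes with at most one edge between them.

   Take a smallest set [Y] with a cut of at most three edges and contract its complement to a
   vertex. In the resulting graph an uncrossing argument shrinks a lobe to three vertices,
   and the 8-cycles through these force the graph to be the Heawood graph. Contracting [Y]
   instead preserves the absence of blocking sets and replaces a configuration [n_3] by an
   [(n-6)_3], possibly with multiple edges. Doing this twice to 22 points leaves 10 points; a
   third Heawood kernel would leave too little room, so multiple edges appear at both
   contracted vertices, and the original graph contains two disjoint copies of the Heawood
   graph minus an edge. An exhaustive search for the remaining blocks finds only [C22].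

   Exhaustive search also shows that the small configurations with boundary met on the way
   contain 8-cycles, and that a [22_3] without 8-cycles has a blocking set. *)
Require Import Defs.
From mathcomp Require Import all_boot zify.
Set Implicit Arguments. Unset Strict Implicit. Unset Printing Implicit Defensive.

(** * Exhaustive search over partial configurations *)

(** Much of the counting rests on a congruence: all degrees being 3, the numbers of cut edges
    leaving a vertex set from its points and from its blocks agree modulo 3. So a cut of three edges
    leaves from one side only, which keeps contractions bipartite, and a Hall violator sends three
    more edges out of one side than out of the other, while only four fit on an 8-cycle. The
    obstacle is the vertex created by a contraction: cycles through it mean nothing in the original
    graph, so the 8-cycles and lobes used must avoid it. That they exist is a matter of size. A
    minimal set has at most 31 vertices, so its contraction has at most 16 on a side; deleting the
    contracted vertex leaves a configuration on at most 16 points, which the search shows to contain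
    a quadrilateral. A lobe avoiding that vertex has at most 23 vertices, hence at most 13 points
    with one outer end included. These are the bounds of the two boundary searches. Colourings,
    embeddings and isomorphisms come from untrusted finders; only the test of their output is
    verified. *)

Definition triple := (nat * nat * nat)%type.

Definition tmem (i : nat) (t : triple) : bool :=
  let: (a, b, c) := t in [|| i == a, i == b | i == c].

Definition partners (p : nat) (bs : seq triple) : seq (nat * nat) :=
  foldr (fun t r => let: (a, b, c) := t in
    if eqn p a then (b, c) :: r else
    if eqn p b then (a, c) :: r else
    if eqn p c then (a, b) :: r else r) [::] bs.

Definition avoid (p : nat) (l : seq (nat * nat)) : seq (nat * nat) :=
  [seq z <- l | if eqn p z.1 then false else ~~ eqn p z.2].

Definition ends (v w : nat) (tab : seq (seq (nat * nat))) : seq nat :=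
  flatten [seq [:: x.1; x.2] | x <- avoid v (nth [::] tab w)].

Definition ends2 (p v : nat) (tab : seq (seq (nat * nat))) : seq nat :=
  flatten [seq ends v z.1 tab ++ ends v z.2 tab | z <- avoid p (nth [::] tab v)].

(* The labels which a new block through [p] cannot contain: those collinear with
   [p] and, when quadrilaterals are forbidden, the ends of paths of three blocks. *)
Definition barred (noq : bool) (tab : seq (seq (nat * nat))) (p : nat) : seq nat :=
  flatten [seq y.1 :: y.2 :: (if noq then ends2 p y.1 tab ++ ends2 p y.2 tab
                              else [::]) | y <- nth [::] tab p].

Definition mask_of (l : seq nat) : seq bool :=
  foldr (fun i m => set_nth false m i true) [::] l.

Definition table (n : nat) (bs : seq triple) : seq (seq (nat * nat)) :=
  [seq partners p bs | p <- iota 0 n].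

Section Search.
Variables (N : nat) (caps : seq nat) (noq : bool).
Variables (leaf : nat -> seq triple -> bool).
Variables (stop : nat -> seq triple -> seq (seq (nat * nat)) -> bool).

Definition cap (i : nat) : nat := nth 3 caps i.

(** Twins have equal capacity and lie in the same listed blocks, namely in none at all or in a
    single one that contains both, so exchanging them is a symmetry of the partial configuration. *)
Definition twin (tab : seq (seq (nat * nat))) (k y : nat) : bool :=
  match nth [::] tab k, nth [::] tab y with
  | [::], [::] => eqn (cap k) (cap y)
  | [:: (u, w)], [:: _] => if (if eqn y u then true else eqn y w)
                           then eqn (cap k) (cap y) else false
  | _, _ => false
  end.

(** Symmetry breaking: of several twins only the smallest one not already in the new block is tried.
    Here [o] is the label placed just before [y], or [p] when there is none. *)
Definition fresh_ok tab (op : seq nat) (p o y : nat) : bool :=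
  all (fun k => if k < y then
                  if eqn k p then true else if eqn k o then true
                  else ~~ twin tab k y
                else true) op.

Definition children (n : nat) (bs : seq triple) tab (op : seq nat)
    (masks : seq (seq bool)) (p : nat) : seq (nat * seq triple) :=
  let mp := nth [::] masks p in
  let cand := [seq x <- op | if nth false mp x then false else ~~ eqn x p] in
  (if n.+1 < N then [:: (n.+2, (p, n, n.+1) :: bs)] else [::]) ++
  flatten [seq
    if fresh_ok tab op p p x then
      let mx := nth [::] masks x in
      (if n < N then [:: (n.+1, (p, x, n) :: bs)] else [::]) ++
      [seq (n, (p, x, y) :: bs) | y <- cand &
         if x < y then if nth false mx y then false else fresh_ok tab op p x y
         else false]
    else [::] | x <- cand].

(* Any choice of an open label is sound; this one has the fewest candidates. *)
Definition pick_label (op : seq nat) (masks : seq (seq bool)) : nat :=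
  (foldr (fun p best =>
     let m := nth [::] masks p in
     let c := count (fun x => ~~ nth false m x) op in
     if c <= best.2 then (p, c) else best) (head 0 op, 100) op).1.

Definition open_masks (n : nat) (tab : seq (seq (nat * nat))) : seq (seq bool) :=
  [seq if size (nth [::] tab x) < cap x then mask_of (barred noq tab x) else [::]
  | x <- iota 0 n].

(** Running out of fuel counts as failure, and membership of the chosen label is tested at run time,
    so neither termination nor [pick_label] needs a proof. *)
Fixpoint search (fuel n : nat) (bs : seq triple) : bool :=
  if fuel is f.+1 then
    let tab := table n bs in
    if stop n bs tab then true else
    let op := [seq x <- iota 0 n | size (nth [::] tab x) < cap x] in
    if op is [::] then leaf n bs else
    let masks := open_masks n tab in
    let p := pick_label op masks in
    if p \in op then all (fun c => search f c.1 c.2) (children n bs tab op masks p)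
    else false
  else false.

End Search.

Lemma partnersP p u w bs : (u, w) \in partners p bs ->
  exists2 t, t \in bs & t \in [:: (p, u, w); (u, p, w); (u, w, p)].
Proof.
elim: bs => //= -[[a b] c] l IH.
have IH' : (u, w) \in partners p l ->
    exists2 t, t \in (a, b, c) :: l & t \in [:: (p, u, w); (u, p, w); (u, w, p)].
  by move=> /IH[t tl tE]; exists t; rewrite // in_cons tl orbT.
case: eqnP => [e|_]; [|case: eqnP => [e|_]; [|case: eqnP => [e|_ //]]];
  rewrite in_cons => /orP[/eqP[eu ew]|/IH' //];
  by exists (a, b, c); rewrite ?mem_head // !inE e eu ew eqxx ?orbT.
Qed.

Lemma children_cons N caps n bs tab op masks p c :
  c \in children N caps n bs tab op masks p -> exists t, c.2 = t :: bs.
Proof.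
rewrite mem_cat => /orP[|/flattenP[_ /mapP[x _ ->]]].
  by case: ifP => // _; rewrite inE => /eqP->; eexists.
case: ifP => // _; rewrite mem_cat => /orP[|/mapP[y _ ->]]; last by eexists.
by case: ifP => // _; rewrite inE => /eqP->; eexists.
Qed.

(** * Soundness of the search for actual configurations *)

Section Soundness.
Variables (V : finType) (pts : {set V}) (BL : {set {set V}}).
Hypothesis BL3 : forall b, b \in BL -> #|b| = 3.
Hypothesis BLsub : forall b, b \in BL -> b \subset pts.
Hypothesis BLlin : forall b b' x y, b \in BL -> b' \in BL -> x != y ->
  x \in b -> y \in b -> x \in b' -> y \in b' -> b = b'.
Hypothesis BLconn : forall S : {set V}, S \subset pts -> S != set0 ->
  (forall b x, b \in BL -> x \in b -> x \in S -> b \subset S) -> S = pts.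

(** A quadrilateral is an 8-cycle of the incidence graph. *)
Definition quad_free := forall b1 b2 b3 b4 x1 x2 x3 x4,
  b1 \in BL -> b2 \in BL -> b3 \in BL -> b4 \in BL ->
  uniq [:: b1; b2; b3; b4] -> uniq [:: x1; x2; x3; x4] ->
  x1 \in b1 -> x2 \in b1 -> x2 \in b2 -> x3 \in b2 ->
  x3 \in b3 -> x4 \in b3 -> x4 \in b4 -> x1 \in b4 -> False.

Definition bset (phi : nat -> V) (t : triple) : {set V} :=
  let: (a, b, c) := t in [set phi a; phi b; phi c].

Definition labels_below (n : nat) (bs : seq triple) : bool :=
  all (fun t : triple => [&& t.1.1 < n, t.1.2 < n & t.2 < n]) bs.

Definition bdeg (x : V) : nat := #|[set b in BL | x \in b]|.

Variables (caps : seq nat).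

(** The labels name distinct points and the listed triples distinct blocks; further points and
    blocks may exist. Points without a label have degree 3, the default of [cap], which is why every
    index of [caps] must already be a label. *)
Record realizes (n : nat) (bs : seq triple) (phi : nat -> V) : Prop := Realizes {
  r_pts : forall i, i < n -> phi i \in pts;
  r_inj : forall i j, i < n -> j < n -> phi i = phi j -> i = j;
  r_lab : labels_below n bs;
  r_bl : forall t, t \in bs -> bset phi t \in BL;
  r_uniq : uniq [seq bset phi t | t <- bs];
  r_cap : forall i, i < n -> bdeg (phi i) = cap caps i;
  r_rest : forall x, x \in pts -> (forall i, i < n -> phi i != x) -> bdeg x = 3;
  r_size : size caps <= n }.

Section Realization.
Variables (n : nat) (bs : seq triple) (phi : nat -> V).
Hypothesis R : realizes n bs phi.

Lemma mem_bset i t : t \in bs -> i < n -> (phi i \in bset phi t) = tmem i t.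
Proof.
case: t => [[a b] c] tb ltin; rewrite /bset /tmem !inE -!orbA.
have /allP /(_ _ tb)/= /and3P[an bn cn] := r_lab R.
by do 2?congr orb; apply/eqP/eqP => [/(r_inj R)|->] // ->.
Qed.

Lemma triple_neq t i j k : t \in bs -> t \in [:: (i, j, k); (j, i, k); (j, k, i)] ->
  [/\ i < n, j < n & k < n] /\ [/\ i != j, i != k & j != k].
Proof.
move=> tb tE; have /allP /(_ _ tb)/= lt := r_lab R.
have [il jl kl] : [/\ i < n, j < n & k < n].
  by move: tE lt; rewrite !inE => /or3P[] /eqP-> /= /and3P[].
split=> //; have := BL3 (r_bl R tb).
have -> : bset phi t = [set phi i; phi j; phi k].
  apply/setP => x; move: tE; rewrite !inE => /or3P[] /eqP-> /=; rewrite !inE //.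
    by congr orb; rewrite orbC.
  by rewrite orbC orbA.
move=> c3; have c2 a b : #|[set a; b] : {set V}| <= 2 by rewrite cards2; case: eqP.
split; apply/eqP => ij; subst.
- by move: c3 (c2 (phi j) (phi k)); rewrite setUid => ->.
- by move: c3 (c2 (phi k) (phi j)); rewrite setUC setUA setUid => ->.
- by move: c3 (c2 (phi i) (phi k)); rewrite -setUA setUid => ->.
Qed.

Lemma partners_mem p u w : (u, w) \in partners p bs ->
  [/\ p < n, u < n & w < n] /\
  exists t, [/\ t \in bs, forall i, tmem i t = [|| i == p, i == u | i == w],
              p != u, p != w & u != w].
Proof.
move=> /partnersP[t tb tE].
have [lt [pu pw uw]] := triple_neq tb tE; split=> //; exists t; split=> // i.
by move: tE; rewrite !inE => /or3P[] /eqP->; rewrite /tmem //; do 3!case: (i == _).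
Qed.

Lemma size_partners p : size (partners p bs) = count (tmem p) bs.
Proof.
elim: (bs) => //= -[[a b] c] l <-; rewrite !eqnE /tmem.
by case: (p == a) => //=; case: (p == b) => //=; case: (p == c).
Qed.

Lemma count_listed p : p < n ->
  count (tmem p) bs = #|[set b in BL | (phi p \in b) && (b \in [seq bset phi t | t <- bs])]|.
Proof.
move=> pn; transitivity (count (fun b : {set V} => phi p \in b) [seq bset phi t | t <- bs]).
  by rewrite count_map; apply: eq_in_count => t tb /=; rewrite mem_bset.
rewrite -size_filter -(card_uniqP (filter_uniq _ (r_uniq R))).
apply: eq_card => b; rewrite !inE mem_filter.
case: (boolP (b \in map _ _)) => [/mapP[t tb ->]|]; last by rewrite !andbF.
by rewrite (r_bl R tb) andbT.
Qed.

Lemma unlisted_block p : p < n -> count (tmem p) bs < cap caps p ->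
  exists b, [/\ b \in BL, phi p \in b & b \notin [seq bset phi t | t <- bs]].
Proof.
move=> pn; rewrite count_listed // -(r_cap R pn) => lt.
case: (boolP [exists b in BL, (phi p \in b) && (b \notin [seq bset phi t | t <- bs])]).
  by case/exists_inP => b bB /andP[pb nb]; exists b.
rewrite negb_exists_in => /forall_inP h; case/negP: (ltn_geF lt); apply: subset_leq_card.
apply/subsetP => b; rewrite !inE => /andP[bB pb]; rewrite bB pb /=.
by have := h b bB; rewrite pb /= negbK.
Qed.

Lemma open_of_unlisted p b : p < n -> b \in BL -> phi p \in b ->
  b \notin [seq bset phi t | t <- bs] -> count (tmem p) bs < cap caps p.
Proof.
move=> pn bB pb nb; rewrite count_listed // -(r_cap R pn); apply: proper_card.
apply/properP; split; first by apply/subsetP => c; rewrite !inE => /and3P[-> ->].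
by exists b; rewrite !inE ?bB ?pb // (negPf nb).
Qed.

Lemma nth_table x : x < n -> nth [::] (table n bs) x = partners x bs.
Proof. by move=> xn; rewrite (nth_map 0) ?size_iota // nth_iota. Qed.

Lemma nth_table_mem z x : z \in nth [::] (table n bs) x -> x < n /\ z \in partners x bs.
Proof.
case: (ltnP x n) => xn; first by rewrite nth_table.
by rewrite nth_default // size_map size_iota.
Qed.

Lemma nth_mask l x : nth false (mask_of l) x -> x \in l.
Proof.
elim: l => [|i l IH] /=; first by rewrite nth_nil.
by rewrite nth_set_nth /= in_cons; case: eqP => //= _ /IH.
Qed.

Lemma ends_mem v w x : x \in ends v w (table n bs) ->
  exists t, [/\ t \in bs, tmem w t, tmem x t, x != w & v != w -> ~~ tmem v t].
Proof.
case/flattenP => _ /mapP[[u u'] uin ->].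
move: uin; rewrite mem_filter /= !eqnE => /andP[h].
case/nth_table_mem=> wn /partners_mem[_ [t [tb tE wu wu' _]]] xin.
exists t; split => //; try by rewrite tE eqxx.
- by rewrite tE; move: xin; rewrite !inE => /orP[] /eqP-> ; rewrite eqxx ?orbT.
- by move: xin; rewrite !inE => /orP[] /eqP->; rewrite eq_sym.
- move=> /negPf vw; rewrite tE vw /=; move: h.
  by case: (v == u).
Qed.

(** An unlisted block through [p] and a barred label would share two points with a listed block, or
    close a path of three listed blocks to a quadrilateral. *)
Lemma barred_sound (noq : bool) p x b : (noq -> quad_free) -> p < n -> x < n -> p != x ->
  b \in BL -> phi p \in b -> phi x \in b -> b \notin [seq bset phi t | t <- bs] ->
  x \notin barred noq (table n bs) p.
Proof.
move=> qf pn xn px bB pb xb nb; apply/negP => /flattenP[_ /mapP[[y y'] yin ->]].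
have phineq i j : i < n -> j < n -> i != j -> phi i != phi j.
  by move=> ilt jlt; apply: contraNneq => /(r_inj R)->.
have inb i t : t \in bs -> i < n -> tmem i t -> phi i \in bset phi t by move=> *; rewrite mem_bset.
have coll t : t \in bs -> tmem p t -> tmem x t -> False.
  move=> tb tp tx; case/negP: nb; apply/mapP; exists t => //.
  by apply: (@BLlin _ _ (phi p) (phi x)) => //; rewrite ?inb ?phineq // (r_bl R).
have lin2 t t' i j : t \in bs -> t' \in bs -> i < n -> j < n -> i != j ->
    tmem i t -> tmem j t -> tmem i t' -> tmem j t' -> bset phi t = bset phi t'.
  by move=> *; apply: (@BLlin _ _ (phi i) (phi j)); rewrite ?inb ?phineq // (r_bl R).
have nlist t : t \in bs -> bset phi t != b.
  by move=> tb; apply: contraNneq nb => <-; apply: map_f.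
have bneq t t' i : t \in bs -> t' \in bs -> i < n -> tmem i t -> ~~ tmem i t' ->
    bset phi t != bset phi t'.
  by move=> tb tb' il ti; apply: contraNneq => e; rewrite -mem_bset // -e inb.
case/nth_table_mem: yin => _ /partners_mem[[_ yn yn'] [t1 [tb1 tE1 py py' _]]].
have tp1 : tmem p t1 by rewrite tE1 eqxx.
have yt1 : tmem y t1 by rewrite tE1 eqxx orbT.
have yt1' : tmem y' t1 by rewrite tE1 eqxx !orbT.
suff main v : v < n -> p != v -> tmem v t1 -> noq -> x \in ends2 p v (table n bs) -> False.
  rewrite !in_cons => /or3P[/eqP xy|/eqP xy|].
  - by apply: (coll t1); rewrite ?xy.
  - by apply: (coll t1); rewrite ?xy.
  by case: (boolP noq) => // hq; rewrite mem_cat => /orP[] /main; apply.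
move=> vn pv vt1 /qf {}qf /flattenP[_ /mapP[[z z'] zin ->]].
move: zin; rewrite mem_filter /= !eqnE => /andP[pz].
case/nth_table_mem=> _ /partners_mem[[_ zn zn'] [t2 [tb2 tE2 vz vz' _]]].
have pt2 : ~~ tmem p t2.
  by rewrite tE2 (negPf pv) /=; move: pz; case: (p == z).
have tv2 : tmem v t2 by rewrite tE2 eqxx.
suff main w : w < n -> v != w -> tmem w t2 -> x \in ends v w (table n bs) -> False.
  by rewrite mem_cat => /orP[] /main; apply; rewrite // tE2 eqxx ?orbT.
move=> wn vw wt2 /ends_mem[t3 [tb3 tw3 tx3 xw /(_ vw) vt3]].
have n12 : bset phi t1 != bset phi t2 by apply: (bneq _ _ p).
have n23 : bset phi t2 != bset phi t3 by apply: (bneq _ _ v).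
have n13 : bset phi t1 != bset phi t3 by apply: (bneq _ _ v).
have pw : p != w by apply: contraNneq pt2 => ->.
have xv : x != v by apply: contraNneq vt3 => <-.
apply: (qf _ _ _ _ (phi p) (phi v) (phi w) (phi x) (r_bl R tb1) (r_bl R tb2) (r_bl R tb3) bB) => //;
  rewrite ?inb //=.
  by rewrite !inE !negb_or n12 n13 n23 !nlist.
by rewrite !inE !negb_or !phineq // eq_sym.
Qed.

Lemma bsetP u t (f : nat -> V) : reflect (exists2 i, tmem i t & u = f i) (u \in bset f t).
Proof.
case: t => [[a b] c]; rewrite !inE; apply: (iffP idP) => [|[i]] /=.
  by case/orP => [/orP[]|] /eqP->; [exists a|exists b|exists c]; rewrite //= eqxx ?orbT.
by case/or3P => /eqP-> ->; rewrite eqxx ?orbT.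
Qed.

Lemma count1_mem (P : pred triple) (l : seq triple) t t' : count P l = 1 ->
  t \in l -> P t -> t' \in l -> P t' -> t = t'.
Proof.
rewrite -size_filter => c tl Pt tl' Pt'.
have : t \in filter P l by rewrite mem_filter Pt.
have : t' \in filter P l by rewrite mem_filter Pt'.
by case: (filter P l) c => [|x [|]] //= _; rewrite !inE => /eqP-> /eqP->.
Qed.

Lemma twinP k y : k < n -> y < n -> twin caps (table n bs) k y ->
  cap caps k = cap caps y /\ forall t, t \in bs -> tmem k t = tmem y t.
Proof.
move=> kn yn; rewrite /twin !nth_table //.
have := size_partners k; have := size_partners y.
case Ek: (partners k bs) => [|[u w] [|]] //; case Ey: (partners y bs) => [|? [|]] //= cy ck.
  rewrite eqnE => /eqP ->; split=> // t tb.
  have zero p : 0 = count (tmem p) bs -> tmem p t = false.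
    move/esym/eqP; rewrite eqn0Ngt -has_count => /hasPn/(_ _ tb); exact: negbTE.
  by rewrite !zero.
case yu: (if eqn y u then true else eqn y w) => //; rewrite eqnE => /eqP->; split=> // t tb.
have [|_ [t0 [tb0 tE0 _ _ _]]] := @partners_mem k u w; first by rewrite Ek mem_head.
have k0 : tmem k t0 by rewrite tE0 eqxx.
have y0 : tmem y t0 by rewrite tE0; move: yu; rewrite !eqnE; case: (y == u) => /=; [rewrite orbT | move=> ->; rewrite !orbT].
apply/idP/idP => h.
  by rewrite (count1_mem (esym ck) tb h tb0 k0).
by rewrite (count1_mem (esym cy) tb h tb0 y0).
Qed.

Definition swap_labels (k y i : nat) : nat :=
  if i == k then y else if i == y then k else i.

Lemma swap_labelsK k y : involutive (swap_labels k y).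
Proof.
move=> i; rewrite /swap_labels.
case: (eqVneq i k) => [->|ik]; first by rewrite eqxx; case: eqP.
case: (eqVneq i y) => [->|iy]; first by rewrite eqxx.
by rewrite (negPf ik) (negPf iy).
Qed.

Lemma swap_labels_lt k y i : k < n -> y < n -> i < n -> swap_labels k y i < n.
Proof. by rewrite /swap_labels; do 2?case: ifP. Qed.

Lemma bset_swap k y t : tmem k t = tmem y t ->
  bset (phi \o swap_labels k y) t = bset phi t.
Proof.
move=> kyt; have sw i : tmem (swap_labels k y i) t = tmem i t.
  by rewrite /swap_labels; case: eqP => [->//|_]; case: eqP => [->//|].
apply/setP => u; apply/bsetP/bsetP => -[i it ->].
  by exists (swap_labels k y i); rewrite ?sw.
by exists (swap_labels k y i); rewrite ?sw //= swap_labelsK.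
Qed.

Lemma realizes_swap k y : k < n -> y < n -> cap caps k = cap caps y ->
  (forall t, t \in bs -> tmem k t = tmem y t) ->
  realizes n bs (phi \o swap_labels k y).
Proof.
move=> kn yn ck tw; have swl := swap_labels_lt kn yn.
have bE t : t \in bs -> bset (phi \o swap_labels k y) t = bset phi t.
  by move=> tb; apply: bset_swap; apply: tw.
split; try exact: (r_lab R); try exact: (r_size R).
- by move=> i il; apply: (r_pts R); apply: swl.
- move=> i j il jl /(r_inj R) e; apply: (can_inj (swap_labelsK k y)).
  by apply: e; apply: swl.
- by move=> t tb; rewrite bE //; apply: (r_bl R).
- by have /eq_in_map -> := bE; apply: (r_uniq R).
- move=> i il; rewrite (r_cap R) ?swl // /swap_labels.
  by case: eqP => [->//|_]; case: eqP => [->|].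
- move=> x xp h; apply: (r_rest R xp) => i il.
  by have := h _ (swl _ il); rewrite /= swap_labelsK.
Qed.

End Realization.

Section Step.
Variables (N : nat) (noq : bool).
Hypothesis qf : noq -> quad_free.
Hypothesis ptsN : #|pts| <= N.

(** The sum of the labels that lie in [b] is minimized. Exchanging a twin [k] outside [b] with a
    larger [y] inside would lower it, so the test of [fresh_ok] never rejects the block that is
    needed. *)
Lemma minimal_realization n bs phi b p : realizes n bs phi -> p < n ->
  b \in BL -> phi p \in b -> b \notin [seq bset phi t | t <- bs] ->
  exists2 psi, realizes n bs psi &
  [/\ psi p \in b, b \notin [seq bset psi t | t <- bs] &
   forall k y, k < y -> y < n -> y != p -> psi y \in b -> psi k \notin b ->
     ~~ twin caps (table n bs) k y].
Proof.
move=> R pn bB; have [m] := ubnP (\sum_(i < n | phi i \in b) i).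
elim: m => // m IH in phi R * => lem pb nb.
case: (boolP [exists k : 'I_n, exists y : 'I_n,
  [&& k < y, y != p :> nat, phi y \in b, phi k \notin b & twin caps (table n bs) k y]]).
  case/existsP => k /existsP[y /and5P[ky yp yb kb tw]].
  have [ck tE] := twinP R (ltn_ord k) (ltn_ord y) tw.
  have R' := realizes_swap R (ltn_ord k) (ltn_ord y) ck tE.
  have kp : (p == k :> nat) = false.
    by apply/negP => /eqP e; case/negP: kb; rewrite -e.
  apply: (IH _ R').
  - have kyn : (k == y) = false by apply/negP => /eqP e; rewrite e ltnn in ky.
    rewrite -ltnS; apply: leq_trans lem; rewrite ltnS.
    rewrite big_mkcond [X in _ < X]big_mkcond /=.
    rewrite (bigD1 k) //= (bigD1 y) /=; last by rewrite eq_sym kyn.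
    rewrite [X in _ < X](bigD1 k) //= [X in _ < _ + X](bigD1 y) /=; last by rewrite eq_sym kyn.
    rewrite /swap_labels /= !eqxx [(_ == k :> nat)](_ : _ = false); last by rewrite eq_sym; exact: kyn.
    rewrite yb (negPf kb) !addnA add0n addn0 (eq_bigr (fun i : 'I_n => if phi i \in b then i : nat else 0)).
      by rewrite ltn_add2r.
    move=> i /andP[ik iy].
    by rewrite [(i == k :> nat)](negPf ik) [(i == y :> nat)](negPf iy).
  - by rewrite /= /swap_labels kp eq_sym (negPf yp).
  - rewrite (_ : [seq _ | t <- bs] = [seq bset phi t | t <- bs]) //.
    by apply/eq_in_map => t tb; apply: bset_swap; apply: tE.
move=> hn; exists phi => //; split=> // k y ky yn yp yb kb.
apply/negP => tw; case/negP: hn; apply/existsP.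
exists (Ordinal (ltn_trans ky yn)); apply/existsP; exists (Ordinal yn).
by rewrite /= ky yp yb kb tw.
Qed.

Lemma labelled_dec n (phi : nat -> V) u :
  (exists2 i, i < n & phi i = u) \/ (forall i, i < n -> phi i != u).
Proof.
case: (boolP [exists i : 'I_n, phi i == u]) => [/existsP[i /eqP e]|].
  by left; exists i.
rewrite negb_exists => /forallP h; right => i il; exact: (h (Ordinal il)).
Qed.

Lemma realizes_room n bs phi (l : seq V) : realizes n bs phi -> uniq l ->
  (forall u, u \in l -> u \in pts /\ forall i, i < n -> phi i != u) -> n + size l <= N.
Proof.
move=> R ul hl; apply: leq_trans ptsN.
have ui : uniq ([seq phi i | i <- iota 0 n] ++ l).
  rewrite cat_uniq ul andbT; apply/andP; split.
    rewrite map_inj_in_uniq ?iota_uniq // => i j; rewrite !mem_iota => /= il jl.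
    exact: (r_inj R).
  apply/hasPn => u /hl[_ hu]; apply/mapP => -[i]; rewrite mem_iota /= => il e.
  by have := hu i il; rewrite e eqxx.
rewrite -{1}(size_iota 0 n) -(size_map phi) -size_cat -(card_uniqP ui).
apply: subset_leq_card; apply/subsetP => u; rewrite mem_cat => /orP[/mapP[i]|/hl[]//].
by rewrite mem_iota /= => il ->; apply: (r_pts R).
Qed.

Definition extend_label (phi : nat -> V) (n : nat) (u : V) (i : nat) : V :=
  if i == n then u else phi i.

Lemma realizes_extend n bs phi u : realizes n bs phi -> u \in pts ->
  (forall i, i < n -> phi i != u) -> realizes n.+1 bs (extend_label phi n u).
Proof.
move=> R up un; have eE i : i < n -> extend_label phi n u i = phi i.
  by rewrite /extend_label; case: eqP => // ->; rewrite ltnn.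
have eN : extend_label phi n u n = u by rewrite /extend_label eqxx.
have bE t : t \in bs -> bset (extend_label phi n u) t = bset phi t.
  move=> tb; have /allP/(_ _ tb) := r_lab R.
  by case: t {tb} => [[a b] c] /= /and3P[la lb lc]; rewrite !eE.
split.
- by move=> i; rewrite ltnS leq_eqVlt => /orP[/eqP->|il]; rewrite ?eN ?eE //; apply: (r_pts R).
- move=> i j; rewrite !ltnS (leq_eqVlt i) (leq_eqVlt j) => /orP[/eqP->|il] /orP[/eqP->|jl] //; rewrite ?eN ?eE //.
  + by move=> e; have := un _ jl; rewrite e eqxx.
  + by move=> e; have := un _ il; rewrite e eqxx.
  + exact: (r_inj R).
- apply/allP => t tb; have /allP/(_ _ tb) := r_lab R.
  by case/and3P => *; apply/and3P; split; apply: leqW.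
- by move=> t tb; rewrite bE //; apply: (r_bl R).
- by have /eq_in_map -> := bE; apply: (r_uniq R).
- move=> i; rewrite ltnS leq_eqVlt => /orP[/eqP->|il]; last by rewrite eE // (r_cap R).
  by rewrite eN (r_rest R) // /cap nth_default // (r_size R).
- move=> x xp h; apply: (r_rest R) => // i il; have := h i (leqW il); by rewrite eE.
- exact: leqW (r_size R).
Qed.

Lemma realizes_cons n bs phi t b : realizes n bs phi -> b \in BL ->
  b \notin [seq bset phi t | t <- bs] -> bset phi t = b ->
  labels_below n [:: t] -> realizes n (t :: bs) phi.
Proof.
move=> R bB nb tE lt; split; try by case: R.
- by move: lt; rewrite /labels_below /= andbT => ->; apply: (r_lab R).
- by move=> t'; rewrite in_cons => /orP[/eqP->|/(r_bl R)//]; rewrite tE.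
- by rewrite /= tE nb; apply: (r_uniq R).
Qed.

(** The child follows an actual block through [p] that is not yet listed, after the labels have been
    rearranged so that the symmetry tests accept it. The cases are how many of its other two points
    carry labels. *)
Lemma children_sound n bs phi op p : realizes n bs phi ->
  op = [seq x <- iota 0 n | size (nth [::] (table n bs) x) < cap caps x] -> p \in op ->
  exists2 c, c \in children N caps n bs (table n bs) op
      (open_masks caps noq n (table n bs)) p &
    exists psi, realizes c.1 c.2 psi.
Proof.
move=> R opE pop.
have opP x : (x \in op) = (x < n) && (count (tmem x) bs < cap caps x).
  rewrite opE mem_filter mem_iota /= add0n andbC; case: ltnP => //= xn.
  by rewrite nth_table // size_partners.
move: pop; rewrite opP => /andP[pn pop].
have [b0 [b0B pb0 nb0]] := unlisted_block R pn pop.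
have [psi {}R [pb nb tw]] := minimal_realization R pn b0B pb0 nb0.
move: b0 {pb0 nb0} b0B pb nb tw => b bB pb nb tw {phi}.
have maskP x y : x < n -> y < n -> x != y -> psi x \in b -> psi y \in b ->
    nth false (nth [::] (open_masks caps noq n (table n bs)) x) y = false.
  move=> xn yn xy xb yb; rewrite (nth_map 0) ?size_iota // nth_iota // add0n.
  case: ifP => _; last exact: nth_nil.
  by apply: contraNF (barred_sound R qf xn yn xy bB xb yb nb) => /nth_mask.
have inop x : x < n -> psi x \in b -> x \in op.
  by move=> xn xb; rewrite opP xn; apply: (open_of_unlisted R xn bB xb nb).
set masks := open_masks _ _ _ _ in maskP *.
have incand x : x < n -> psi x \in b -> x != p ->
    x \in [seq x <- op | if nth false (nth [::] masks p) x then false else ~~ eqn x p].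
  by move=> xn xb xp; rewrite mem_filter inop // andbT maskP // eq_sym.
have fok o y : y < n -> y != p -> psi y \in b ->
    (forall k, k < y -> psi k \in b -> k = p \/ k = o) ->
    fresh_ok caps (table n bs) op p o y.
  move=> yn yp yb hk; apply/allP => k _; case: ltnP => // ky; rewrite !eqnE.
  case: eqP => // kp; case: eqP => // ko; apply: tw => //.
  by apply/negP => /(hk _ ky)[].
have [u [w [bE pu pw uw]]] : exists u w, [/\ b = [set psi p; u; w], psi p != u, psi p != w & u != w].
  have := BL3 bB; rewrite (cardsD1 (psi p)) pb add1n => -[] /eqP /cards2P[u [w [uw e]]].
  have : u \in b :\ psi p by rewrite e !inE eqxx.
  have : w \in b :\ psi p by rewrite e !inE eqxx orbT.
  rewrite !inE => /andP[wp _] /andP[up _]; exists u, w; split=> //; try by rewrite eq_sym.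
  by rewrite -setUA -e setD1K.
have ub : u \in b by rewrite bE !inE eqxx orbT.
have wb : w \in b by rewrite bE !inE eqxx orbT.
have bsub x : x \in b -> x \in pts by apply: (subsetP (BLsub bB)).
have only k : k < n -> psi k \in b -> k = p \/ psi k = u \/ psi k = w.
  move=> kn; rewrite bE !inE => /orP[/orP[]|] /eqP; [move/(r_inj R)|..]; by auto.
suff IH : forall u w, b = [set psi p; u; w] -> psi p != u -> psi p != w -> u != w ->
    u \in b -> w \in b -> (forall k, k < n -> psi k \in b -> k = p \/ psi k = u \/ psi k = w) ->
    (exists2 x, x < n & psi x = u) -> exists2 c, c \in children N caps n bs (table n bs) op masks p &
    exists psi, realizes c.1 c.2 psi.
  case: (labelled_dec n psi u) => [h|un]; first exact: (IH u w).
  case: (labelled_dec n psi w) => [h|wn].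
    apply: (IH w u) => //; first by rewrite bE setUAC.
      by rewrite eq_sym.
    by move=> k kn /(only k kn) [|[]]; auto.
  have room : n + 2 <= N.
    apply: (realizes_room (l := [:: u; w]) R); first by rewrite /= inE uw.
    by move=> x; rewrite !inE => /orP[] /eqP->; split; rewrite ?bsub.
  exists (n.+2, (p, n, n.+1) :: bs).
    by rewrite /children mem_cat -addn2 room mem_head.
  have R1 := realizes_extend R (bsub _ ub) un.
  have wn1 i : i < n.+1 -> extend_label psi n u i != w.
    rewrite ltnS leq_eqVlt /extend_label => /orP[/eqP->|il]; first by rewrite eqxx.
    by rewrite (ltn_eqF il); apply: wn.
  have R2 := realizes_extend R1 (bsub _ wb) wn1.
  exists (extend_label (extend_label psi n u) n.+1 w) => /=.
  apply: (realizes_cons R2 bB).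
  - rewrite (_ : [seq _ | t <- bs] = [seq bset psi t | t <- bs]) //.
    apply/eq_in_map => t tb; have /allP/(_ _ tb) := r_lab R.
    case: t {tb} => [[x y] z] /= /and3P[lx ly lz].
    by rewrite /extend_label !ltn_eqF // ltnW.
  - by rewrite /= /extend_label eqxx (gtn_eqF (ltnSn n)) ?eqxx !ltn_eqF // 1?ltnW // bE.
  - by rewrite /labels_below /= !ltnS (leqW (ltnW pn)) leqnn leqnSn.
move=> {u w bE pu pw uw ub wb only} u w bE pu pw uw ub wb only [x xn xu]; subst u.
have xp : x != p by apply: contraNneq pu => ->.
case: (labelled_dec n psi w) => [[y yn yw]|wn]; last first.
  have room : n + 1 <= N.
    apply: (realizes_room (l := [:: w]) R) => // v; rewrite inE => /eqP->; split=> //.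
    exact: bsub.
  exists (n.+1, (p, x, n) :: bs).
    rewrite /children mem_cat; apply/orP; right; apply/flattenP; eexists.
      by apply/mapP; exists x; [apply: incand|reflexivity].
    rewrite fok //; first by rewrite mem_cat -(addn1 n) room mem_head.
    move=> k kx kb; left; have kn := ltn_trans kx xn.
    case: (only k kn kb) => [//|[/(r_inj R kn xn) e|e]]; first by rewrite e ltnn in kx.
    by have := wn k kn; rewrite e eqxx.
  have R1 := realizes_extend R (bsub _ wb) wn.
  exists (extend_label psi n w) => /=.
  apply: (realizes_cons R1 bB).
  - rewrite (_ : [seq _ | t <- bs] = [seq bset psi t | t <- bs]) //.
    apply/eq_in_map => t tb; have /allP/(_ _ tb) := r_lab R.
    case: t {tb} => [[i j] k] /= /and3P[lx ly lz].
    by rewrite /extend_label !ltn_eqF.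
  - by rewrite /= /extend_label eqxx !ltn_eqF // bE.
  - by rewrite /labels_below /= !ltnS (ltnW pn) (ltnW xn) leqnn.
subst w.
have yp : y != p by apply: contraNneq pw => ->.
have pair i j : i < n -> j < n -> i != p -> j != p -> i < j -> b = [set psi p; psi i; psi j] ->
    exists2 c, c \in children N caps n bs (table n bs) op masks p & exists psi, realizes c.1 c.2 psi.
  move=> il jl ip jp ij bE'.
  have ib : psi i \in b by rewrite bE' !inE eqxx orbT.
  have jb : psi j \in b by rewrite bE' !inE eqxx orbT.
  have only' k : k < n -> psi k \in b -> [\/ k = p, k = i | k = j].
    by move=> kn; rewrite bE' !inE => /orP[/orP[]|] /eqP /(r_inj R) -> //; constructor.
  exists (n, (p, i, j) :: bs).
    rewrite /children mem_cat; apply/orP; right; apply/flattenP; eexists.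
      by apply/mapP; exists i; [apply: incand|reflexivity].
    rewrite fok //.
      rewrite mem_cat; apply/orP; right; apply/mapP; exists j => //.
      rewrite mem_filter incand // ij maskP //; last by rewrite neq_ltn ij.
      rewrite fok // => k kj kb; case: (only' k (ltn_trans kj jl) kb); auto.
      by move=> e; rewrite e ltnn in kj.
    move=> k ki kb; left; case: (only' k (ltn_trans ki il) kb) => // e.
      by rewrite e ltnn in ki.
    by rewrite e ltnNge (ltnW ij) in ki.
  exists psi; apply: (realizes_cons R bB nb); first by rewrite bE'.
  by rewrite /labels_below /= pn il jl.
have : x != y by apply: contraNneq uw => ->.
rewrite neq_ltn => /orP[xy|yx]; first exact: (pair x y).
by apply: (pair y x); rewrite // bE setUAC.
Qed.

Variables (leaf : nat -> seq triple -> bool).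
Variables (stop : nat -> seq triple -> seq (seq (nat * nat)) -> bool) (Q : Prop).
Hypothesis stopP : forall n bs tab phi, realizes n bs phi -> stop n bs tab -> Q.
Hypothesis leafP : forall n bs phi, realizes n bs phi ->
  pts = [set phi (val i) | i : 'I_n] -> BL = [set b in [seq bset phi t | t <- bs]] ->
  leaf n bs -> Q.

(** The configuration selects one branch of the search, down to a stop or a leaf. At a leaf no label
    is open, so every block through a labelled point is listed, and connectedness leaves no other
    point. *)
Lemma search_sound fuel n bs phi : 0 < n -> realizes n bs phi ->
  search N caps noq leaf stop fuel n bs -> Q.
Proof.
elim: fuel n bs phi => // f IH n bs phi n0 R /=.
case: ifP => [st _|_]; first exact: (stopP R st).
set op := filter _ _; case opE: op => [|o0 ops]; last first.
  rewrite -opE; case: ifP => // pop /allP all_c.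
  have [c cin [psi Rc]] := children_sound R (erefl op) pop.
  apply: (IH _ _ _ _ Rc (all_c _ cin)).
  by have := r_lab Rc; case/children_cons: cin => t ->; case/andP => /and3P[]; case: (c.1).
have listed b i : b \in BL -> i < n -> phi i \in b -> b \in [seq bset phi t | t <- bs].
  move=> bB il ib; apply/negPn/negP => /(open_of_unlisted R il bB ib) h.
  have : i \in op by rewrite mem_filter mem_iota nth_table // size_partners h.
  by rewrite opE.
have ptsE : [set phi (val i) | i : 'I_n] = pts.
  apply: BLconn.
  - by apply/subsetP => _ /imsetP[i _ ->]; apply: (r_pts R); apply: ltn_ord.
  - by apply/set0Pn; exists (phi 0); apply/imsetP; exists (Ordinal n0).
  - move=> b x bB xb /imsetP[i _ xE]; have := listed b i bB (ltn_ord i); rewrite -xE => /(_ xb).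
    case/mapP => t tb bE; rewrite bE; apply/subsetP => y /bsetP[j jt yE]; rewrite yE.
    have jn : j < n.
      have /allP/(_ _ tb) := r_lab R; case: (t) jt => [[a c] d] /= jt /and3P[la lc ld].
      by case/or3P: jt => /eqP->.
    by apply/imsetP; exists (Ordinal jn).
apply: (leafP R); first by rewrite ptsE.
apply/setP => b; rewrite inE; apply/idP/idP => [bB|/mapP[t tb ->]]; last exact: (r_bl R).
have /card_gt0P[x xb] : 0 < #|b| by rewrite BL3.
have := subsetP (BLsub bB) x xb; rewrite -ptsE => /imsetP[i _ xE].
by apply: (listed b i); rewrite -?xE.
Qed.

End Step.
End Soundness.

(** * Colourings, seeds and the computed searches *)

Definition bichromatic (col : seq bool) (t : triple) : bool :=
  let: (a, b, c) := t in
  let x := nth false col a in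
  if eqb x (nth false col b) then ~~ eqb x (nth false col c) else true.

Fixpoint find_colouring (groups : seq (seq triple)) (col : seq bool) : option (seq bool) :=
  if groups is g :: gs then
    let try_true := fun _ : unit =>
      let c := rcons col true in
      if all (bichromatic c) g then find_colouring gs c else None in
    let c := rcons col false in
    if all (bichromatic c) g then
      if find_colouring gs c is Some r then Some r else try_true tt
    else try_true tt
  else Some col.

(** Labels are coloured in increasing order, and a triple is tested as soon as its largest label has
    a colour. The result is tested once more as a whole, so the backtracking is never reasoned
    about. *)
Definition colourable (n : nat) (bs : seq triple) : bool :=
  let groups := [seq [seq t <- bs | eqn (maxn t.1.1 (maxn t.1.2 t.2)) i] | i <- iota 0 n] in
  if find_colouring groups [::] is Some col then all (bichromatic col) bs else false.

Definition third (p : nat) (l : seq (nat * nat)) : option nat :=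
  foldr (fun z r => if eqn p z.1 then Some z.2 else if eqn p z.2 then Some z.1 else r) None l.

Definition first_some (A B : Type) (f : A -> option B) (l : seq A) : option B :=
  foldr (fun x r => match r with Some _ => r | None => f x end) None l.

(** A block and a point off it that is collinear with its three points: in the incidence graph, two
    vertices joined by three paths of length 3. *)
Definition theta_seed : seq triple := [:: (0, 1, 4); (0, 2, 5); (0, 3, 6); (1, 2, 3)].

(* Only the blocks meeting the newest one are tried as [(1, 2, 3)]: the parent
   state has been examined before. *)
Definition near_blocks (bs : seq triple) (tab : seq (seq (nat * nat))) : seq triple :=
  if bs is (a, b, c) :: _ then
    (a, b, c) :: flatten [seq [seq (x, z.1, z.2) | z <- behead (nth [::] tab x)]
                         | x <- [:: a; b; c]]
  else [::].

Definition find_theta (bs : seq triple) (tab : seq (seq (nat * nat))) : option (seq nat) :=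
  first_some (fun t => let: (a, b, c) := t in
    let lb := avoid a (nth [::] tab b) in
    let lc := avoid a (nth [::] tab c) in
    first_some (fun z =>
      let try p ya :=
        if third p lb is Some yb then
          if third p lc is Some yc then Some [:: p; a; b; c; ya; yb; yc] else None
        else None in
      if try z.1 z.2 is Some r then Some r else try z.2 z.1)
      (avoid b (nth [::] tab a))) (near_blocks bs tab).

(** Three blocks through the point 0 and three blocks joining them in pairs, so that the six
    neighbours of 0 form a hexagon whose sides lie alternately on the two kinds of blocks. *)
Definition hex_seed : seq triple :=
  [:: (0, 1, 2); (0, 3, 4); (0, 5, 6); (1, 3, 7); (2, 5, 8); (4, 6, 9)].

Definition orders (z : nat * nat) : seq (nat * nat) := [:: z; (z.2, z.1)].

Definition find_hex (n : nat) (tab : seq (seq (nat * nat))) : option (seq nat) :=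
  first_some (fun p =>
    if nth [::] tab p is [:: z1; z2; z3] then
      first_some (fun y1 => let: (x1, x2) := y1 in
        let l1 := nth [::] tab x1 in
        let l2 := nth [::] tab x2 in
      first_some (fun y2 => let: (x3, x4) := y2 in
        if third x3 l1 is Some x7 then
        let l4 := nth [::] tab x4 in
        first_some (fun y3 => let: (x5, x6) := y3 in
          if third x5 l2 is Some x8 then
            if third x6 l4 is Some x9 then
              Some [:: p; x1; x2; x3; x4; x5; x6; x7; x8; x9]
            else None
          else None) (orders z3)
        else None) (orders z2)) (orders z1)
    else None) (iota 0 n).

(** Tests the map returned by [find_theta] or [find_hex], so that nothing has to be proved about
    these finders. *)
Definition embeds (seed : seq triple) (n : nat) (bs : seq triple) (m : seq nat) : bool :=
  [&& uniq m, all (gtn n) m &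
    all (fun t => let: (a, b, c) := t in
      has (fun u => [&& tmem (nth 0 m a) u, tmem (nth 0 m b) u & tmem (nth 0 m c) u]) bs) seed].

Definition leaf22 (n : nat) (bs : seq triple) : bool :=
  if n == 22 then colourable n bs else true.

Definition no_stop (n : nat) (bs : seq triple) (tab : seq (seq (nat * nat))) : bool := false.

(** A state that contains one of the two seeds is settled by the separate search starting from that
    seed. *)
Definition stop_seeds (n : nat) (bs : seq triple) (tab : seq (seq (nat * nat))) : bool :=
  if (if find_theta bs tab is Some m then
        if size m == 7 then embeds theta_seed n bs m else false else false) then true
  else if find_hex n tab is Some m then
        if size m == 10 then embeds hex_seed n bs m else false else false.

Definition leaf_size (m n : nat) (bs : seq triple) : bool := n == m.

(** The fuel 30 exceeds the 22 blocks that can be placed. *)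
Lemma search_theta : search 22 [::] true leaf22 no_stop 30 7 theta_seed.
Proof. by vm_compute. Qed.

Lemma search_hex : search 22 [::] true leaf22 no_stop 30 10 hex_seed.
Proof. by vm_compute. Qed.

Lemma search_root : search 22 [::] true leaf22 stop_seeds 30 1 [::].
Proof. by vm_compute. Qed.

(** No state has zero labels, so every leaf fails. Success means that no connected
    quadrilateral-free configuration on at most 16 points has three points of degree 2 and all
    others of degree 3. *)
Lemma search_pole3 : search 16 [:: 2; 2; 2] true (leaf_size 0) no_stop 30 3 [::].
Proof. by vm_compute. Qed.

(** The degrees on the boundary of a lobe: 1 at the outer end of its single edge, 2 at a foot, and 1
    where two feet coincide. Only a configuration on three points, that is a single block, may
    survive. *)
Lemma search_pole5 : [&& search 13 [:: 1; 2; 2; 2; 2] true (leaf_size 3) no_stop 30 5 [::],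
  search 13 [:: 1; 1; 2; 2] true (leaf_size 3) no_stop 30 4 [::] &
  search 13 [:: 1; 1; 1] true (leaf_size 3) no_stop 30 3 [::]].
Proof. by vm_compute. Qed.

(** The lines [i + j mod 7 in {0, 1, 3}] of the Fano plane for [j] from 1 to 6, shifted by [k]. The
    line for [j = 0] has lost its point 0 and enters [two_piece_seed] with an unknown third
    point. *)
Definition piece_blocks (k : nat) : seq triple :=
  [seq (t.1.1 + k, t.1.2 + k, t.2 + k) |
    t <- [:: (6, 0, 2); (5, 6, 1); (4, 5, 0); (3, 4, 6); (2, 3, 5); (1, 2, 4)]].

Definition two_piece_seed (u1 u2 : nat) : seq triple :=
  (1, 3, u1) :: (8, 10, u2) :: piece_blocks 0 ++ piece_blocks 7.

Definition block_image (m : seq nat) (t : triple) : triple :=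
  (nth 0 m t.1.1, nth 0 m t.1.2, nth 0 m t.2).

Definition same_labels (t c : triple) : bool :=
  [&& tmem t.1.1 c, tmem t.1.2 c & tmem t.2 c].

Fixpoint find_iso (groups : seq (seq triple)) (vals m : seq nat) : option (seq nat) :=
  if groups is g :: gs then
    first_some (fun v =>
      let m' := rcons m v in
      if all (fun t => has (same_labels (block_image m' t)) C22_blocks) g
      then find_iso gs (rem v vals) m' else None) vals
  else Some m.

Definition iso_check (bs : seq triple) (m : seq nat) : bool :=
  [&& size m == 22, uniq m, all (gtn 22) m,
    all (fun t => has (same_labels (block_image m t)) C22_blocks) bs &
    all (fun c => has (fun t => same_labels (block_image m t) c) bs) C22_blocks].

(** The prescribed images send the first piece to the points 0 to 6, the second one to 7 to 12 and
    20, and the label 14 to 21; only the images of 15 to 21 are searched, among 13 to 19. The test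
    can succeed only when 14 is the extra point of both pieces. *)
Definition iso_C22 (bs : seq triple) : bool :=
  let groups := [seq [seq t <- bs | eqn (maxn t.1.1 (maxn t.1.2 t.2)) i] | i <- iota 15 7] in
  if find_iso groups (iota 13 7) [:: 5; 2; 0; 4; 1; 3; 6; 8; 7; 9; 11; 12; 20; 10; 21] is Some m
  then iso_check bs m else false.

Definition leaf_iso (n : nat) (bs : seq triple) : bool :=
  if n == 22 then if colourable n bs then true else iso_C22 bs else true.

(** Each entry gives the number of labels of the seed and the extra points of the two pieces. An
    extra point inside the other piece must be its label 7 or 0, which still lacks a block;
    otherwise it is new, and two new ones may be equal or different. *)
Lemma search_two_pieces : all (fun s : nat * (nat * nat) =>
    search 22 [::] false leaf_iso no_stop 30 s.1 (two_piece_seed s.2.1 s.2.2))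
  [:: (14, (7, 0)); (15, (7, 14)); (15, (14, 0)); (15, (14, 14)); (16, (15, 14))].
Proof. by vm_compute. Qed.

(** * Configurations covered by the searches *)

Record linear_space (V : finType) (pts : {set V}) (BL : {set {set V}}) : Prop := LinearSpace {
  ls_card : forall b, b \in BL -> #|b| = 3;
  ls_sub : forall b, b \in BL -> b \subset pts;
  ls_lin : forall b b' x y, b \in BL -> b' \in BL -> x != y ->
    x \in b -> y \in b -> x \in b' -> y \in b' -> b = b';
  ls_conn : forall S : {set V}, S \subset pts -> S != set0 ->
    (forall b x, b \in BL -> x \in b -> x \in S -> b \subset S) -> S = pts }.

Local Opaque search.

Section Models.
Variables (V : finType) (pts : {set V}) (BL : {set {set V}}).
Hypothesis LS : linear_space pts BL.

Lemma realizes_caps caps phi :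
  (forall i, i < size caps -> phi i \in pts) ->
  (forall i j, i < size caps -> j < size caps -> phi i = phi j -> i = j) ->
  (forall i, i < size caps -> bdeg BL (phi i) = nth 3 caps i) ->
  (forall x, x \in pts -> (forall i, i < size caps -> phi i != x) -> bdeg BL x = 3) ->
  realizes pts BL caps (size caps) [::] phi.
Proof. by move=> *; split. Qed.

Lemma three_pole_not_quad_free phi : #|pts| <= 16 ->
  (forall i, i < 3 -> phi i \in pts) ->
  (forall i j, i < 3 -> j < 3 -> phi i = phi j -> i = j) ->
  (forall i, i < 3 -> bdeg BL (phi i) = 2) ->
  (forall x, x \in pts -> (forall i, i < 3 -> phi i != x) -> bdeg BL x = 3) ->
  ~ quad_free BL.
Proof.
move=> ptsN h1 h2 h3 h4 qf.
have R : realizes pts BL [:: 2; 2; 2] 3 [::] phi.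
  by apply: (@realizes_caps [:: 2; 2; 2]) => // -[|[|[|]]] // ?; rewrite h3.
apply: (search_sound (ls_card LS) (ls_sub LS) (ls_lin LS) (ls_conn LS) (noq := true)
  (fun _ => qf) ptsN _ _ _ R search_pole3) => //.
by move=> n bs psi _ ptsE _ /eqP n0; have := h1 0 isT; rewrite ptsE => /imsetP[[i]]; rewrite n0.
Qed.

Lemma five_pole_not_quad_free caps phi : #|pts| <= 13 -> #|pts| != 3 ->
  caps \in [:: [:: 1; 2; 2; 2; 2]; [:: 1; 1; 2; 2]; [:: 1; 1; 1]] ->
  realizes pts BL caps (size caps) [::] phi ->
  ~ quad_free BL.
Proof.
move=> ptsN pts3 capsE R qf.
have /(search_sound (ls_card LS) (ls_sub LS) (ls_lin LS) (ls_conn LS) (noq := true)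
  (fun _ => qf) ptsN) H : realizes pts BL caps (size caps) [::] phi by [].
have {}H : search 13 caps true (leaf_size 3) no_stop 30 (size caps) [::] -> False.
  apply: H => //; last by move: capsE; rewrite !inE => /or3P[] /eqP->.
  move=> n bs psi R' ptsE _ /eqP n3; case/negP: pts3; apply/eqP.
  rewrite ptsE card_imset ?card_ord // => i j /(r_inj R' (ltn_ord i) (ltn_ord j)); exact: val_inj.
have /and3P[s1 s2 s3] := search_pole5.
move: capsE H; rewrite !inE => /or3P[] /eqP-> /= H; [exact: H s1|exact: H s2|exact: H s3].
Qed.

Lemma colourable_blocking caps n bs phi : realizes pts BL caps n bs phi ->
  BL = [set b in [seq bset phi t | t <- bs]] -> colourable n bs ->
  exists S, blocking_set BL S.
Proof.
rewrite /colourable; case: find_colouring => // col R BLE /allP ok.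
exists [set phi (val i) | i : 'I_n & nth false col i] => b.
have memS i : i < n -> (phi i \in [set phi (val i) | i : 'I_n & nth false col i]) = nth false col i.
  move=> il; apply/imsetP/idP => [[j]|ci]; last by exists (Ordinal il); rewrite ?inE.
  by rewrite inE => cj /(r_inj R il (ltn_ord j)) ->.
rewrite {1}BLE inE => /mapP[[[x y] z] tb ->].
have /allP/(_ _ tb)/= /and3P[xn yn zn] := r_lab R.
have /= := ok _ tb; set S := imset _ _ in memS *.
have inB i : i \in [:: x; y; z] -> phi i \in [set phi x; phi y; phi z].
  by rewrite !inE => /or3P[] /eqP->; rewrite eqxx ?orbT.
suff : (exists2 i, i \in [:: x; y; z] & nth false col i) /\
    (exists2 i, i \in [:: x; y; z] & ~~ nth false col i) -> 
    ([set phi x; phi y; phi z] :&: S != set0) /\ ([set phi x; phi y; phi z] :\: S != set0).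
  move=> /[swap] nm; apply; move: nm; rewrite !eqbE.
  case cx: (nth false col x); case cy: (nth false col y); case cz: (nth false col z) => //= _; split;
  do [by exists x; rewrite ?inE ?eqxx ?cx | by exists y; rewrite ?inE ?eqxx ?orbT ?cy | by exists z; rewrite ?inE ?eqxx ?orbT ?cz].
have lt i : i \in [:: x; y; z] -> i < n by rewrite !inE => /or3P[] /eqP->.
case=> [[i il ci] [j jl cj]]; split; apply/set0Pn.
  by exists (phi i); rewrite inE memS ?lt // ci inB.
by exists (phi j); rewrite inE memS ?lt // cj inB.
Qed.

(** Triples are compared by the labels they contain, since different orderings of one triple name
    the same block. *)
Definition distinct_blocks (n : nat) (bs : seq triple) : bool :=
  pairwise (fun t t' => has (fun i => tmem i t != tmem i t') (iota 0 n)) bs.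

Section InjectiveLabels.
Variables (U : finType) (n : nat) (bs : seq triple) (phi : nat -> U).
Hypothesis phi_inj : forall i j, i < n -> j < n -> phi i = phi j -> i = j.
Hypothesis lab : labels_below n bs.

Lemma mem_bset_inj i t : i < n -> t \in bs -> (phi i \in bset phi t) = tmem i t.
Proof.
move=> il tb; have /allP/(_ _ tb) := lab.
case: t {tb} => [[a b] c] /= /and3P[la lb lc]; rewrite !inE -orbA.
by do 2?congr orb; apply/eqP/eqP => [/phi_inj|->] // ->.
Qed.

Lemma uniq_bset : distinct_blocks n bs -> uniq [seq bset phi t | t <- bs].
Proof.
rewrite uniq_pairwise pairwise_map.
apply: (@sub_in_pairwise _ (mem bs)); last by apply/allP.
move=> t t' tb tb' /=.
case/hasP => i; rewrite mem_iota /= => il; apply: contraNneq => e.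
by rewrite -!mem_bset_inj // e.
Qed.

Lemma card_bset t : t \in bs -> uniq [:: t.1.1; t.1.2; t.2] -> #|bset phi t| = 3.
Proof.
move=> tb; have /allP/(_ _ tb) := lab; case: t {tb} => [[x y] z] /= /and3P[xn yn zn].
have neq i j : i < n -> j < n -> i != j -> phi i != phi j.
  by move=> il jl; apply: contraNneq => /phi_inj->.
rewrite !inE negb_or andbT => /andP[/andP[xy xz] yz].
by rewrite setUC cardsU1 cards2 !inE negb_or !(eq_sym (phi z)) !neq.
Qed.

End InjectiveLabels.

Lemma realizes_seed n seed phi :
  (forall x, x \in pts -> bdeg BL x = 3) ->
  (forall i, i < n -> phi i \in pts) ->
  (forall i j, i < n -> j < n -> phi i = phi j -> i = j) ->
  labels_below n seed -> distinct_blocks n seed ->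
  (forall t, t \in seed -> bset phi t \in BL) ->
  realizes pts BL [::] n seed phi.
Proof.
move=> d3 h1 h2 lab dist hB; split=> //; [exact: uniq_bset lab dist |
  by move=> i il; rewrite d3 ?h1 // /cap nth_nil | by move=> x xp _; apply: d3].
Qed.

Hypothesis deg3 : forall x, x \in pts -> bdeg BL x = 3.
Hypothesis pts22 : #|pts| = 22.

Lemma leaf22_blocking n bs phi : realizes pts BL [::] n bs phi ->
  pts = [set phi (val i) | i : 'I_n] -> BL = [set b in [seq bset phi t | t <- bs]] ->
  leaf22 n bs -> exists S, blocking_set BL S.
Proof.
move=> R ptsE BLE; rewrite /leaf22.
have n22 : n = 22.
  rewrite -pts22 ptsE card_imset ?card_ord // => i j /(r_inj R (ltn_ord i) (ltn_ord j)).
  exact: val_inj.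
rewrite n22 eqxx -n22; exact: colourable_blocking R BLE.
Qed.

Lemma embeds_realizes n bs phi seed m : realizes pts BL [::] n bs phi ->
  embeds seed n bs m -> labels_below (size m) seed -> distinct_blocks (size m) seed ->
  all (fun t : triple => uniq [:: t.1.1; t.1.2; t.2]) seed ->
  realizes pts BL [::] (size m) seed (fun i => phi (nth 0 m i)).
Proof.
move=> R /and3P[um /all_nthP mn /allP hm] lab dist tri.
have mlt i : i < size m -> nth 0 m i < n by move=> il; apply: (mn 0).
apply: realizes_seed => //.
- by move=> i /mlt; apply: (r_pts R).
- by move=> i j il jl /(r_inj R (mlt _ il) (mlt _ jl)) /eqP; rewrite nth_uniq // => /eqP.
move=> t ts; have := hm _ ts; have /allP/(_ _ ts) := lab; have /allP/(_ _ ts) := tri.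
case: t {ts} => [[a b] c] /= abc /and3P[la lb lc] /hasP[u ub /and3P[ua uB uc]].
have <- : bset phi u = [set phi (nth 0 m a); phi (nth 0 m b); phi (nth 0 m c)]; last exact: (r_bl R).
apply/esym/eqP; rewrite eqEcard (ls_card LS (r_bl R ub)); apply/andP; split.
  apply/subsetP => x; rewrite !inE => /orP[/orP[]|] /eqP->; apply/bsetP;
    by [exists (nth 0 m a) | exists (nth 0 m b) | exists (nth 0 m c)].
have inj i j : i < size m -> j < size m -> i != j -> phi (nth 0 m i) != phi (nth 0 m j).
  move=> il jl ij; apply/eqP => /(r_inj R (mlt _ il) (mlt _ jl)) /eqP.
  by rewrite nth_uniq // (negPf ij).
move: abc; rewrite !inE !negb_or andbT => /andP[/andP[ab ac] bc].
by rewrite setUC cardsU1 cards2 !inE negb_or !(eq_sym (phi (nth 0 m c))) !inj.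
Qed.

(** A state stopped by [stop_seeds] contains a relabelled copy of a seed. The search from that seed
    may be applied to the copy because it assumes nothing beyond the blocks of the seed. *)
Lemma quad_free_blocking : quad_free BL -> exists S, blocking_set BL S.
Proof.
move=> qf.
have run (stop : nat -> seq triple -> seq (seq (nat * nat)) -> bool) fuel n bs phi : (forall n bs tab phi, realizes pts BL [::] n bs phi ->
      stop n bs tab -> exists S, blocking_set BL S) -> 0 < n ->
    realizes pts BL [::] n bs phi -> search 22 [::] true leaf22 stop fuel n bs ->
    exists S, blocking_set BL S.
  move=> stopP; exact: (search_sound (ls_card LS) (ls_sub LS) (ls_lin LS) (ls_conn LS)
    (fun _ => qf) (eq_leq pts22) stopP leaf22_blocking).
have theta phi : realizes pts BL [::] 7 theta_seed phi -> exists S, blocking_set BL S.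
  by move=> R; apply: (run _ _ _ _ _ _ _ R search_theta).
have hex phi : realizes pts BL [::] 10 hex_seed phi -> exists S, blocking_set BL S.
  by move=> R; apply: (run _ _ _ _ _ _ _ R search_hex).
have /card_gt0P[x0 x0p] : 0 < #|pts| by rewrite pts22.
have R0 : realizes pts BL [::] 1 [::] (fun=> x0).
  apply: realizes_seed => // -[|i] [|j] //.
apply: (run _ _ _ _ _ _ _ R0 search_root) => // n bs tab phi R.
rewrite /stop_seeds; case: ifP => [|_].
  case: find_theta => // m; case: ifP => // /eqP sm em _; apply: (theta (fun i => phi (nth 0 m i))).
  by have := embeds_realizes R em; rewrite sm; apply.
case: find_hex => // m; case: ifP => // /eqP sm em; apply: (hex (fun i => phi (nth 0 m i))).
by have := embeds_realizes R em; rewrite sm; apply.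
Qed.

End Models.

(** * Configurations with two disjoint Heawood pieces *)

Section TwoPieces.
Variables (T : finType) (B : {set {set T}}).
Hypothesis LS : linear_space setT B.
Hypothesis deg3 : forall x, bdeg B x = 3.
Hypothesis T22 : #|T| = 22.

Lemma bset_same_labels (U : finType) (psi : nat -> U) n t c :
  (forall i j, i < n -> j < n -> psi i = psi j -> i = j) ->
  labels_below n [:: t] -> uniq [:: t.1.1; t.1.2; t.2] -> same_labels t c ->
  bset psi t = bset psi c.
Proof.
case: t => [[x y] z] inj lab xyz /and3P[/= xc yc zc].
apply/eqP; rewrite eqEcard; apply/andP; split.
  apply/subsetP => u; rewrite !inE => /orP[/orP[]|] /eqP->; apply/bsetP;
    by [exists x | exists y | exists z].
rewrite (card_bset inj lab (t := (x, y, z))) ?mem_head //.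
case: c {xc yc zc} => [[a b] c] /=; rewrite setUC cardsU1 cards2.
by case: (_ \notin _); case: (_ != _).
Qed.

Lemma iso_check_config_iso n bs phi m : realizes setT B [::] n bs phi ->
  setT = [set phi (val i) | i : 'I_n] -> B = [set b in [seq bset phi t | t <- bs]] ->
  iso_check bs m -> config_iso B C22.
Proof.
move=> R ptsE BE /and5P[/eqP sm um /allP m22 /allP c1 /allP c2].
have n22 : n = 22.
  rewrite -T22 -cardsT ptsE card_imset ?card_ord // => i j /(r_inj R (ltn_ord i) (ltn_ord j)).
  exact: val_inj.
subst n.
pose f x : 'I_22 := inord (nth 0 m (index x [seq phi i | i <- iota 0 22])).
have uphi : uniq [seq phi i | i <- iota 0 22].
  rewrite map_inj_in_uniq ?iota_uniq // => i j; rewrite !mem_iota => il jl; exact: (r_inj R).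
have fE i : i < 22 -> f (phi i) = inord (nth 0 m i).
  move=> il; rewrite /f -[phi i](_ : nth (phi 0) [seq phi i | i <- iota 0 22] i = _).
    by rewrite index_uniq // size_map size_iota.
  by rewrite (nth_map 0) ?size_iota // nth_iota.
have mlt i : i < 22 -> nth 0 m i < 22 by move=> il; apply: m22; rewrite mem_nth ?sm.
have inj i j : i < 22 -> j < 22 -> (inord i : 'I_22) = inord j -> i = j.
  by move=> il jl /(congr1 val); rewrite /= !inordK.
have fE2 i j : i < 22 -> j < 22 -> (inord (nth 0 m i) : 'I_22) = inord (nth 0 m j) -> i = j.
  by move=> il jl /(inj _ _ (mlt _ il) (mlt _ jl)) /eqP; rewrite nth_uniq ?sm // => /eqP.
have phiE x : exists2 i, i < 22 & x = phi i.
  by have := in_setT x; rewrite ptsE => /imsetP[i _ ->]; exists (val i); rewrite ?ltn_ord.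
have finj : injective f.
  move=> x y; have [i il ->] := phiE x; have [j jl ->] := phiE y.
  by rewrite !fE // => /fE2->.
exists f; split; first by apply: inj_card_bij => //; rewrite card_ord T22.
have fb t : t \in bs -> f @: bset phi t = bset inord (block_image m t).
  move=> tb; have /allP/(_ _ tb) := r_lab R; case: t {tb} => [[x y] z] /= /and3P[xn yn zn].
  by rewrite !imsetU !imset_set1 !fE.
have fbc t c : t \in bs -> same_labels (block_image m t) c -> f @: bset phi t = bset inord c.
  move=> tb sl; rewrite fb //; apply: (bset_same_labels inj) sl.
    have /allP/(_ _ tb) := r_lab R; case: t {tb} => [[x y] z] /= /and3P[xn yn zn].
    by rewrite /labels_below /= !mlt.
  case: t tb => [[x y] z] tb.
  have [[xn yn zn] [xy xz yz]] := triple_neq (ls_card LS) R tb (mem_head (x, y, z) _).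
  by rewrite /= !inE negb_or andbT !nth_uniq ?sm // xy xz.
apply/setP => c; rewrite inE; apply/imsetP/mapP => [[b]|[c0 cin ->]].
  rewrite {1}BE inE => /mapP[t tb ->] ->.
  have /hasP[c0 cin sl] := c1 _ tb; exists c0 => //.
  by rewrite (fbc _ _ tb sl); case: (c0) => [[]].
have /hasP[t tb sl] := c2 _ cin; exists (bset phi t); first by rewrite BE inE map_f.
by rewrite (fbc _ _ tb sl); case: (c0) => [[]].
Qed.

Lemma leaf_isoP n bs phi : realizes setT B [::] n bs phi ->
  setT = [set phi (val i) | i : 'I_n] -> B = [set b in [seq bset phi t | t <- bs]] ->
  leaf_iso n bs -> (exists S, blocking_set B S) \/ config_iso B C22.
Proof.
move=> R ptsE BE; rewrite /leaf_iso.
have n22 : n = 22.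
  rewrite -T22 -cardsT ptsE card_imset ?card_ord // => i j /(r_inj R (ltn_ord i) (ltn_ord j)).
  exact: val_inj.
move: R ptsE BE; rewrite n22 eqxx => R ptsE BE; case: ifP => [col _|_]; first by left; apply: colourable_blocking R BE col.
rewrite /iso_C22; case: find_iso => // m /(iso_check_config_iso R ptsE BE); by right.
Qed.

Lemma two_piece_search n u1 u2 phi :
  (n, (u1, u2)) \in [:: (14, (7, 0)); (15, (7, 14)); (15, (14, 0)); (15, (14, 14)); (16, (15, 14))] ->
  realizes setT B [::] n (two_piece_seed u1 u2) phi ->
  (exists S, blocking_set B S) \/ config_iso B C22.
Proof.
move=> inl R; have /allP/(_ _ inl)/= := search_two_pieces.
have T22' : #|[set: T]| <= 22 by rewrite cardsT T22.
apply: (search_sound (ls_card LS) (ls_sub LS) (ls_lin LS) (ls_conn LS) _ T22' _ leaf_isoP _ R) => //.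
by move: inl; rewrite !inE => /or4P[/eqP[-> _ _]|/eqP[-> _ _]|/eqP[-> _ _]|/orP[] /eqP[-> _ _]].
Qed.

Lemma unlisted_pair n bs phi i j u : realizes setT B [::] n bs phi -> i < n -> j < n ->
  ~~ has (fun t => tmem i t && tmem j t) bs ->
  [set phi i; phi j; u] \notin [seq bset phi t | t <- bs].
Proof.
move=> R il jl /hasPn h; apply/mapP => -[t tb e]; have /negP := h _ tb; apply.
by rewrite -!(mem_bset R) // -e !inE !eqxx ?orbT.
Qed.

(** An extra point that carries a label must be one whose blocks are not all listed. Deciding for
    [u2], then for [u1], whether it is labelled leads to the five cases of the computation. *)
Theorem two_pieces phi u1 u2 :
  (forall i j, i < 14 -> j < 14 -> phi i = phi j -> i = j) ->
  (forall t, t \in piece_blocks 0 ++ piece_blocks 7 -> bset phi t \in B) ->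
  [set phi 1; phi 3; u1] \in B -> (forall i, i < 7 -> phi i != u1) ->
  [set phi 8; phi 10; u2] \in B -> (forall i, i < 7 -> phi (7 + i) != u2) ->
  (exists S, blocking_set B S) \/ config_iso B C22.
Proof.
move=> inj hB b1B hu1 b2B hu2.
set pieces := piece_blocks 0 ++ piece_blocks 7 in hB.
have R0 : realizes setT B [::] 14 pieces phi by apply: realizes_seed.
have inb1 v : v \in [:: phi 1; phi 3; u1] -> v \in [set phi 1; phi 3; u1].
  by rewrite !inE -orbA.
have inb2 v : v \in [:: phi 8; phi 10; u2] -> v \in [set phi 8; phi 10; u2].
  by rewrite !inE -orbA.
have op n bs psi i b : realizes setT B [::] n bs psi -> i < n -> b \in B ->
    b \notin [seq bset psi t | t <- bs] -> psi i \in b -> count (tmem i) bs < 3.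
  move=> R il bB nb ib; have := open_of_unlisted R il bB ib nb.
  by rewrite /cap nth_nil.
have ub2 : [set phi 8; phi 10; u2] \notin [seq bset phi t | t <- pieces].
  exact: (unlisted_pair _ R0).
have phi1 : phi 1 \in [set phi 1; phi 3; u1] by rewrite !inE eqxx.
have phi3 : phi 3 \in [set phi 1; phi 3; u1] by rewrite !inE eqxx orbT.
have u1b : u1 \in [set phi 1; phi 3; u1] by rewrite !inE eqxx orbT.
have u2b : u2 \in [set phi 8; phi 10; u2] by rewrite !inE eqxx orbT.
have fin n v1 v2 psi : (n, (v1, v2)) \in [:: (14, (7, 0)); (15, (7, 14)); (15, (14, 0));
    (15, (14, 14)); (16, (15, 14))] -> realizes setT B [::] n ((8, 10, v2) :: pieces) psi ->
    (forall i, i < 14 -> psi i = phi i) -> v1 < n -> psi v1 = u1 ->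
    (exists S, blocking_set B S) \/ config_iso B C22.
  move=> inl R psiE v1n v1E; apply: (@two_piece_search n v1 v2 psi inl).
  have n14 : 13 < n by move: inl; rewrite !inE => /or4P[/eqP[-> _ _]|/eqP[-> _ _]|/eqP[-> _ _]|/orP[] /eqP[-> _ _]].
  apply: (realizes_cons R b1B) => /=; last 1 first.
  - by rewrite /labels_below /= v1n !(leq_trans _ n14).
  - rewrite -[phi 1]psiE // -[phi 3]psiE //; apply: (unlisted_pair _ R); rewrite ?(leq_trans _ n14) //.
    move: inl; rewrite !inE => /or4P[/eqP[_ _ ->]|/eqP[_ _ ->]|/eqP[_ _ ->]|/orP[] /eqP[_ _ ->]] //.
  - by rewrite v1E !psiE.
case: (labelled_dec 14 phi u2) => [[k kl ku]|u2n].
  have k7 : k < 7.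
    rewrite ltnNge; apply/negP => k7; have h : k - 7 < 7 by rewrite ltn_subLR.
    by have := hu2 (k - 7) h; rewrite subnKC // ku eqxx.
  have ok := op _ _ _ k _ R0 kl b2B ub2; rewrite ku in ok; have {}ok := ok u2b.
  have R1 : realizes setT B [::] 14 ((8, 10, k) :: pieces) phi.
    by apply: (realizes_cons R0 b2B) => //=; rewrite ?ku // /labels_below /= kl.
  have ub1 : [set phi 1; phi 3; u1] \notin [seq bset phi t | t <- (8, 10, k) :: pieces].
    apply: (unlisted_pair _ R1) => //.
    by case: k k7 {kl ku ok R1} => [|[|[|[|[|[|[|k]]]]]]].
  have o1 := op _ _ _ 1 _ R1 isT b1B ub1 phi1.
  have o3 := op _ _ _ 3 _ R1 isT b1B ub1 phi3.
  (* The labels 1 and 3 would be saturated by the second extra block, but they still need the first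
     one. *)
  have k0 : k = 0.
    by case: k k7 ok o1 o3 {kl ku R1 ub1} => [|[|[|[|[|[|[|k]]]]]]].
  subst k; case: (labelled_dec 14 phi u1) => [[j jl ju]|u1n].
    have oj := op _ _ _ j _ R1 jl b1B ub1; rewrite ju in oj; have {}oj := oj u1b.
    have j7 : 6 < j by rewrite ltnNge; apply/negP => j7; have := hu1 j j7; rewrite ju eqxx.
    have je : j = 7.
      by move: j {ju} jl j7 oj; do 14?[case=> //].
    by subst j; apply: (fin 14 7 0 phi).
  have R2 := realizes_extend R1 (in_setT u1) u1n.
  apply: (fin 15 14 0 _ _ R2) => //= i il.
  by rewrite /extend_label ltn_eqF.
have R1 := realizes_extend R0 (in_setT u2) u2n.
set psi := extend_label phi 14 u2 in R1.
have psiE i : i < 14 -> psi i = phi i by move=> il; rewrite /psi /extend_label ltn_eqF.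
have R2 : realizes setT B [::] 15 ((8, 10, 14) :: pieces) psi.
  have bE : [seq bset psi t | t <- pieces] = [seq bset phi t | t <- pieces]; last first.
    by apply: (realizes_cons R1 b2B); rewrite // bE.
  apply/eq_in_map => -[[x y] z] tb; have /allP/(_ _ tb)/and3P[xn yn zn] := r_lab R0.
  by rewrite /= !psiE.
have ub1 : [set phi 1; phi 3; u1] \notin [seq bset psi t | t <- (8, 10, 14) :: pieces].
  rewrite -[phi 1]psiE // -[phi 3]psiE //; exact: (unlisted_pair _ R2).
case: (labelled_dec 15 psi u1) => [[j jl ju]|u1n].
  have oj := op _ _ _ j _ R2 jl b1B ub1; rewrite ju in oj; have {}oj := oj u1b.
  have j7 : 6 < j.
    rewrite ltnNge; apply/negP => j7; have := hu1 j j7.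
    by rewrite -psiE ?ju ?eqxx // (leq_trans (leq_ltn_trans j7 _) (leqnn 14)).
  have [je|je] : j = 7 \/ j = 14.
    case: (j =P 7) => [|nj7]; first by left.
    case: (j =P 14) => [|nj14]; first by right.
    by move: j {ju} jl j7 oj nj7 nj14; do 15?[case=> //].
  - by subst j; apply: (fin 15 7 14 psi).
  - by subst j; apply: (fin 15 14 14 psi).
have R3 := realizes_extend R2 (in_setT u1) u1n.
apply: (fin 16 15 14 _ _ R3) => // i il.
by rewrite /extend_label ltn_eqF ?psiE // ltnW // ltnW.
Qed.

End TwoPieces.

(** * Cubic bipartite multigraphs *)

Module Cubic.

Section Hall.
Variables (V : finType) (r : rel V).
Implicit Types S T X : {set V}.

Definition image_in T X : {set V} := [set y in T | [exists x in X, r x y]].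

Lemma image_inP T X y : reflect (y \in T /\ exists2 x, x \in X & r x y) (y \in image_in T X).
Proof.
rewrite inE; apply: (iffP andP) => -[yT].
  by case/exists_inP => x xX rxy; split=> //; exists x.
by case=> x xX rxy; split=> //; apply/exists_inP; exists x.
Qed.

(** Induction on the size of [S]. A nonempty proper subset with no more neighbours than elements
    splits the problem in two. If there is none, any single edge may be matched and deleted, because
    every nonempty proper subset has a neighbour to spare. *)
Theorem hall S T : (forall X, X \subset S -> #|X| <= #|image_in T X|) ->
  exists2 f : V -> V, forall x, x \in S -> f x \in T /\ r x (f x) & {in S &, injective f}.
Proof.
have [m] := ubnP #|S|; elim: m => // m IH in S T * => leS hS.
case: (set_0Vmem S) => [->|[x0 x0S]].
  by exists id => x; rewrite inE.
case: (boolP [exists X : {set V}, [&& X \proper S, X != set0 & #|image_in T X| <= #|X|]]).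
  case/existsP => X /and3P[XS Xn0 cX]; have sXS := proper_sub XS.
  have cardX : 0 < #|X| by rewrite card_gt0.
  have [|X' sX'|f1 f1P f1inj] := IH X T; first by have := proper_card XS; lia.
    by apply: hS; apply: subset_trans sXS.
  have [||f2 f2P f2inj] := IH (S :\: X) (T :\: image_in T X).
  - have := cardsD S X; have := subset_leq_card sXS; rewrite (setIidPr sXS); lia.
  - move=> X' /subsetDP[X'S dX'].
    have h := hS (X :|: X'); rewrite subUset sXS X'S in h; have {h} := h isT.
    rewrite cardsU disjoint_setI0 1?disjoint_sym // cards0 subn0.
    suff : #|image_in T (X :|: X')| <= #|image_in T X| + #|image_in (T :\: image_in T X) X'| by lia.
    apply: leq_trans (leq_card_setU _ _); apply: subset_leq_card; apply/subsetP => y.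
    rewrite in_setU; case: (boolP (y \in image_in T X)) => //= yX /image_inP[yT [x]].
    rewrite inE => /orP[xX|xX'] rxy.
      by case/negP: yX; apply/image_inP; split=> //; exists x.
    by apply/image_inP; split; [rewrite inE yX|exists x].
  exists (fun x => if x \in X then f1 x else f2 x) => [x xS|x y xS yS].
    case: ifP => xX; first exact: f1P.
    by have [|] := f2P x; rewrite !inE ?xX ?xS // => /andP[].
  have dis u w : u \in X -> w \in S -> w \notin X -> f1 u != f2 w.
    move=> uX wS wX; have [] := f2P w; first by rewrite inE wX.
    rewrite inE => /andP[h _] _; apply: contraNneq h => <-.
    by have [? ?] := f1P u uX; apply/image_inP; split=> //; exists u.
  case: ifP => xX; case: ifP => yX e.
  - exact: f1inj.
  - by case/negP: (dis x y xX yS (negbT yX)); rewrite e.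
  - by case/negP: (dis y x yX xS (negbT xX)); rewrite e.
  - by apply: f2inj; rewrite // inE ?xX ?yX.
rewrite negb_exists => /forallP hprop.
have [y yT rxy] : exists2 y, y \in T & r x0 y.
  have := hS [set x0]; rewrite sub1set x0S cards1 => /(_ isT)/card_gt0P[y].
  by case/image_inP => yT [x]; rewrite inE => /eqP->; exists y.
have [||f fP finj] := IH (S :\ x0) (T :\ y).
- by have := cardsD1 x0 S; rewrite x0S; lia.
- move=> X XS; case: (eqVneq X set0) => [->|Xn0]; first by rewrite cards0.
  have Xp : X \proper S.
    apply/properP; split; first by apply: subset_trans XS (subsetDl _ _).
    by exists x0 => //; apply/negP => /(subsetP XS); rewrite !inE eqxx.
  have := hprop X; rewrite Xp Xn0 /= -ltnNge => lt.
  have sub : image_in T X :\ y \subset image_in (T :\ y) X.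
    apply/subsetP => z; rewrite inE => /andP[zy /image_inP[zT h]].
    by apply/image_inP; split; rewrite // inE zy.
  have := subset_leq_card sub; have := cardsD1 y (image_in T X); lia.
exists (fun x => if x == x0 then y else f x) => [x xS|x z xS zS].
  case: eqP => [->|/eqP xx0] //; have [] := fP x; first by rewrite !inE xx0.
  by rewrite !inE => /andP[].
have dis w : w \in S -> w != x0 -> f w != y.
  by move=> wS wx; have [] := fP w; rewrite !inE ?wx // => /andP[].
case: eqP => [->|/eqP xx0]; case: eqP => [->|/eqP zx0] // e.
- by case/negP: (dis z zS zx0); rewrite -e.
- by case/negP: (dis x xS xx0); rewrite e.
- by apply: finj; rewrite // !inE ?xx0 ?zx0.
Qed.

End Hall.

(* [mu] counts parallel edges and [si] is the bipartition, [true] on points. For vertex sets,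
   [e X Y] counts edges, [d X] is the size of the cut around [X], [sd X s] is the part of [X]
   on side [s], [out s X] counts the cut edges leaving it, and [pm X] says that [X] has a
   perfect matching, given as an involution. *)
Record bicubic (V : finType) := Bicubic {
  mu : V -> V -> nat;
  si : V -> bool;
  mu_sym : forall x y, mu x y = mu y x;
  mu_si : forall x y, si x = si y -> mu x y = 0;
  mu_deg : forall x, \sum_y mu x y = 3 }.

Section Graph.
Variables (V : finType) (G : bicubic V).
Implicit Types (X Y Z : {set V}) (x y z : V) (s : bool).
Notation mu := (mu G).
Notation si := (si G).

Definition adj x y := 0 < mu x y.
Definition e X Y := \sum_(x in X) \sum_(y in Y) mu x y.
Definition d X := e X (~: X).
Definition sd X s := [set x in X | si x == s].

Lemma adjC x y : adj x y = adj y x. Proof. by rewrite /adj mu_sym. Qed.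

Lemma adj_si x y : adj x y -> si y = ~~ si x.
Proof. by rewrite /adj => h; case: (eqVneq (si x) (si y)) => [/mu_si|]; [lia|case: (si x); case: (si y)]. Qed.

Lemma eC X Y : e X Y = e Y X.
Proof. by rewrite /e exchange_big; do 2!apply: eq_bigr => ? _; rewrite mu_sym. Qed.

Lemma eID Y X Z : e X Z = e (X :&: Y) Z + e (X :\: Y) Z.
Proof. exact: big_setID. Qed.

Lemma eIDr Y X Z : e Z X = e Z (X :&: Y) + e Z (X :\: Y).
Proof. by rewrite -!(eC _ Z); apply: eID. Qed.

Lemma eU X Y Z : [disjoint X & Y] -> e (X :|: Y) Z = e X Z + e Y Z.
Proof.
move=> dXY; rewrite (eID X) setUK setDUl setDv set0U; congr (_ + e _ _).
by apply/setDidPl; rewrite disjoint_sym.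
Qed.

Lemma eUr X Y Z : [disjoint X & Y] -> e Z (X :|: Y) = e Z X + e Z Y.
Proof. by move=> dXY; rewrite -!(eC _ Z); apply: eU. Qed.

Lemma e_total X : e X setT = 3 * #|X|.
Proof.
rewrite /e mulnC -sum_nat_const; apply: eq_bigr => x _; rewrite -(mu_deg G x).
by apply: eq_bigl => y; rewrite inE.
Qed.

Lemma e_split X Y : e X Y + e X (~: Y) = 3 * #|X|.
Proof. by rewrite -e_total (eIDr Y setT) setTI setTD. Qed.

Lemma eS X Y X' Y' : X \subset X' -> Y \subset Y' -> e X Y <= e X' Y'.
Proof.
move=> sX sY; rewrite (eID X X') (setIidPr sX) (eIDr Y Y') (setIidPr sY); lia.
Qed.

Lemma e_eq0P X Y : reflect (forall x y, x \in X -> y \in Y -> ~~ adj x y) (e X Y == 0).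
Proof.
rewrite /e sum_nat_eq0; apply: (iffP forall_inP) => h x.
  by move=> y xX yY; have := h x xX; rewrite sum_nat_eq0 => /forall_inP/(_ y yY)/eqP; rewrite /adj => ->.
move=> xX; rewrite sum_nat_eq0; apply/forall_inP => y yY.
by have := h x y xX yY; rewrite /adj -eqn0Ngt.
Qed.

Lemma e_gt0 X Y x y : x \in X -> y \in Y -> adj x y -> 0 < e X Y.
Proof. by move=> xX yY a; rewrite lt0n; apply/negP => /e_eq0P/(_ x y xX yY); rewrite a. Qed.

Lemma e_gt0P X Y : 0 < e X Y -> exists x y, [/\ x \in X, y \in Y & adj x y].
Proof.
move=> h; case: (boolP [exists x in X, exists y in Y, adj x y]).
  by case/exists_inP => x xX /exists_inP[y yY a]; exists x, y.
move=> hn; move: h; rewrite lt0n => /negP[]; apply/e_eq0P => x y xX yY.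
by apply: contra hn => a; apply/exists_inP; exists x => //; apply/exists_inP; exists y.
Qed.

Lemma e1 x Y : e [set x] Y = \sum_(y in Y) mu x y.
Proof. by rewrite /e big_set1. Qed.

Lemma e11 x y : e [set x] [set y] = mu x y.
Proof. by rewrite e1 big_set1. Qed.

Lemma in_sd X s x : (x \in sd X s) = (x \in X) && (si x == s).
Proof. by rewrite inE. Qed.

Lemma sd_sub X s : sd X s \subset X.
Proof. by apply/subsetP => x; rewrite in_sd => /andP[]. Qed.

Lemma card_sd s X : #|X| = #|sd X s| + #|sd X (~~ s)|.
Proof.
rewrite -(cardsID (sd X s) X); congr (_ + _); apply: eq_card => x; rewrite !inE.
  by case: (x \in X).
by case: (x \in X); case: (si x); case: s.
Qed.

Lemma e_sd X Y s : e (sd X s) Y = e (sd X s) (sd Y (~~ s)).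
Proof.
rewrite (eIDr (sd Y (~~ s)) Y) (setIidPr (sd_sub _ _)).
rewrite [X in _ + X](_ : _ = 0) ?addn0 //; apply/eqP/e_eq0P => x y.
rewrite !inE => /andP[_ /eqP sx] /andP[]; case: (y \in Y) => //= sy _.
by apply/negP => /adj_si; rewrite sx => h; rewrite h eqxx in sy.
Qed.

Definition inn X := e (sd X true) (sd X false).
Definition out s X := e (sd X s) (~: X).

(** Counts the edges at the vertices of one side. The two instances together give the congruence
    modulo 3 between the numbers of edges leaving from the two sides. *)
Lemma cutE s X : 3 * #|sd X s| = inn X + out s X.
Proof.
rewrite -(e_split (sd X s) X) /out; congr (_ + _); rewrite /inn.
by case: s; rewrite (e_sd X X) //= eC.
Qed.

Lemma dE s X : d X = out s X + out (~~ s) X.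
Proof.
rewrite /d (eID (sd X s)) (setIidPr (sd_sub _ _)); congr (_ + e _ _).
by apply/setP => x; rewrite !inE; case: (x \in X); case: (si x); case: s.
Qed.

Lemma dC X : d (~: X) = d X.
Proof. by rewrite /d setCK eC. Qed.

Lemma d1 x : d [set x] = 3.
Proof.
have := e_split [set x] [set x]; rewrite e11 cards1 (@mu_si _ G x x erefl) /d; lia.
Qed.

Lemma card_d X : #|X| = 1 -> d X = 3.
Proof. by move/eqP/cards1P => [x ->]; apply: d1. Qed.

Definition pm X := exists f : V -> V,
  forall x, x \in X -> [/\ f x \in X, adj x (f x) & f (f x) = x].

Lemma hall_pm s X : #|sd X s| = #|sd X (~~ s)| ->
  (forall Y, Y \subset sd X s -> #|Y| <= #|image_in adj X Y|) -> pm X.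
Proof.
move=> cs /hall[f fP finj].
have fsd x : x \in sd X s -> f x \in sd X (~~ s).
  move=> xs; have [fX a] := fP x xs; rewrite in_sd fX (adj_si a).
  by move: xs; rewrite in_sd => /andP[_ /eqP->]; rewrite eqxx.
have fim : f @: sd X s = sd X (~~ s).
  apply/eqP; rewrite eqEcard card_in_imset // cs leqnn andbT.
  by apply/subsetP => _ /imsetP[x xs ->]; apply: fsd.
pose g x := if si x == s then f x else odflt x [pick z in sd X s | f z == x].
have gs x : x \in sd X s -> g x = f x by rewrite /g in_sd => /andP[_ ->].
have gf x : x \in sd X s -> g (f x) = x.
  move=> xs; have := fsd x xs; rewrite in_sd => /andP[_ /eqP sf].
  rewrite /g sf; case: ifP => [|_]; first by case: (s).
  case: pickP => [z /andP[zs /eqP fz]|/(_ x)] /=; first exact: finj.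
  by rewrite xs eqxx.
exists g => x xX; case: (eqVneq (si x) s) => sx.
  have xs : x \in sd X s by rewrite in_sd xX sx eqxx.
  by have [fX a] := fP x xs; rewrite gs // gf.
have : x \in sd X (~~ s) by rewrite in_sd xX; move: sx; case: (si x); case: (s).
rewrite -fim => /imsetP[z zs ->]; rewrite gf //.
have [_ a] := fP z zs; rewrite adjC a gs //.
by split=> //; apply: (subsetP (sd_sub X s)).
Qed.

Lemma pmU X Y : [disjoint X & Y] -> pm X -> pm Y -> pm (X :|: Y).
Proof.
move=> dXY [f fP] [g gP]; exists (fun x => if x \in X then f x else g x) => x.
rewrite inE; case: (boolP (x \in X)) => [xX _|xX /= xY].
  by have [fX a ff] := fP x xX; rewrite fX inE fX.
have [gY a gg] := gP x xY; rewrite inE gY orbT.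
have /negPf -> : g x \notin X by apply: contraL gY => gX; rewrite (disjointFr dXY).
by rewrite gg.
Qed.

Lemma pm2 x y : adj x y -> pm [set x; y].
Proof.
move=> a; have xy : y != x.
  by apply: contraTneq a => ->; rewrite /adj mu_si.
exists (fun z => if z == x then y else x) => z; rewrite !inE => /orP[] /eqP->.
  by rewrite !eqxx (negPf xy) orbT.
by rewrite (negPf xy) !eqxx adjC.
Qed.

Definition connected := forall X, X != set0 -> X != setT -> 0 < d X.

Definition good_colouring (c : V -> bool) :=
  forall b, ~~ si b -> exists x y, [/\ adj b x, adj b y & c x != c y].

(** A point outside [X] whose partner block meets [X] gets the colour opposite to a neighbour of
    that block. When no such point is left, the edges at [X] all end in partners of [X]; both sets
    having equal size, no cut edge remains, and connectedness shows that everything is coloured. *)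
Lemma propagate_colouring (f : V -> V) X (c : V -> bool) : connected ->
  (forall x, adj x (f x) /\ f (f x) = x) -> X != set0 -> (forall x, x \in X -> si x) ->
  (forall x, x \in X -> exists y, [/\ y \in X, adj (f x) y & c y != c x]) ->
  exists c', good_colouring c'.
Proof.
move=> conn fP; have [m] := ubnP #|~: X|; elim: m => // m IH in X c * => leX Xn0 Xs hX.
case: (boolP [exists x, [&& si x, x \notin X & [exists y in X, adj (f x) y]]]).
  case/existsP => x /and3P[sx xX /exists_inP[y yX a]].
  apply: (IH (x |: X) (fun z => if z == x then ~~ c y else c z)).
  - have := cardsD1 x (~: X); rewrite inE xX.
    have -> : ~: X :\ x = ~: (x |: X) by apply/setP => z; rewrite !inE negb_or.
    lia.
  - by apply/set0Pn; exists x; rewrite !inE eqxx.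
  - by move=> z; rewrite !inE => /orP[/eqP->|/Xs].
  have nx z : z \in X -> (z == x) = false.
    by move=> zX; apply/negP => /eqP e; rewrite -e zX in xX.
  move=> z; rewrite !inE => /orP[/eqP->|zX].
    by exists y; rewrite inE yX orbT eqxx nx //; split=> //; case: (c y).
  by have [w [wX aw cw]] := hX z zX; exists w; rewrite inE wX orbT !nx.
rewrite negb_exists => /forallP no.
have fs x : si (f x) = ~~ si x by have [/adj_si] := fP x.
have finj : injective f by move=> x y e; rewrite -(fP x).2 e (fP y).2.
pose Y := X :|: f @: X.
have Yt : sd Y true = X.
  apply/setP => x; rewrite !inE eqb_id; apply/andP/idP => [[/orP[//|/imsetP[z zX ->]]]|xX].
    by rewrite fs Xs.
  by rewrite xX Xs.
have Yf : sd Y false = f @: X.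
  apply/setP => x; rewrite !inE eqbF_neg; apply/andP/idP => [[/orP[/Xs->//|//]]|xX].
  by rewrite xX orbT; case/imsetP: xX => z zX ->; rewrite fs Xs.
have ot : out true Y = 0.
  apply/eqP/e_eq0P => x y; rewrite Yt => xX; rewrite !inE negb_or => /andP[yX yfX].
  apply/negP => a; have sy : si y = false by rewrite (adj_si a) Xs.
  have /negP := no (f y); apply; rewrite fs sy /=; apply/andP; split.
    apply: contra yfX => fX; rewrite -(fP y).2; exact: imset_f.
  by apply/exists_inP; exists x => //; rewrite (fP y).2 adjC.
have YT : Y = setT.
  apply/eqP; apply/negPn/negP => YT.
  have Yn0 : Y != set0 by case/set0Pn: Xn0 => x xX; apply/set0Pn; exists x; rewrite inE xX.
  have := conn Y Yn0 YT; rewrite (dE true) ot /=.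
  have := cutE true Y; have := cutE false Y; rewrite ot Yt Yf card_imset //; lia.
exists c => b sb; have fbX : f b \in X by rewrite -Yt YT !inE fs sb.
have [y [yX a cy]] := hX _ fbX; rewrite (fP b).2 in a.
by exists y, (f b); split=> //; have [] := fP b.
Qed.

End Graph.

End Cubic.
Export Cubic.

(** * Colourings from cycles of length divisible by four *)

Lemma cycle_nth (T : Type) (r : rel T) (x0 : T) c i : cycle r c -> i < size c ->
  r (nth x0 c i) (nth x0 c (i.+1 %% size c)).
Proof.
case: c => // x p /= /(pathP x0) h ip; have := h i; rewrite size_rcons => /(_ ip).
rewrite -rcons_cons nth_rcons /= ip; congr r; rewrite nth_rcons.
case: (ltngtP i (size p)) => [lt|lt|->]; last by rewrite modnn.
  by rewrite modn_small.
by move: ip; rewrite ltnS leqNgt lt.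
Qed.

Section Cycles.
Variables (V : finType) (G : bicubic V).
Notation si := (si G).
Notation adj := (adj G).

Definition gcycle (m : nat) (c : seq V) : bool :=
  [&& size c == m, uniq c & cycle adj c].

Lemma gcycle_rot m k c : gcycle m c -> gcycle m (rot k c).
Proof. by case/and3P => sc uc cc; rewrite /gcycle size_rot rot_uniq rot_cycle sc uc. Qed.

Lemma gcycle_side m c x0 i : gcycle m c -> i < m ->
  si (nth x0 c i) = si (nth x0 c 0) (+) odd i.
Proof.
case/and3P => /eqP sc _ cc; elim: i => [|i IH] im; first by rewrite addbF.
have := cycle_nth x0 cc (i := i); rewrite sc ltnW // modn_small // => /(_ isT)/adj_si->.
by rewrite IH 1?ltnW //= addbN.
Qed.

(* Colour the points of the cycle alternately and each block through its partner in the matching. *)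
Lemma cycle_colouring k c : connected G -> 0 < k -> gcycle (4 * k) c ->
  pm G (~: [set x in c]) -> exists col, good_colouring G col.
Proof.
move=> conn k0 gc.
have [x0 _] : exists x, x \in c.
  by case/and3P: gc => /eqP; case: c => [|x c] //=; [lia|exists x; rewrite mem_head].
wlog s0 : c gc / si (nth x0 c 0).
  move=> IH h; case: (boolP (si (nth x0 c 0))) => [|s0]; first by move=> s0; apply: (IH c).
  apply: (IH (rot 1 c)); first exact: gcycle_rot.
    have s1 : si (nth x0 c 1) by rewrite (gcycle_side x0 gc) ?(negPf s0) //; lia.
    by move: s1; case/and3P: gc => /eqP; case: (c) => [|x [|y p]] /=; rewrite ?rot1_cons //; lia.
  by congr (pm G): h; apply/setP => x; rewrite !inE mem_rot.
case=> g gP; case/and3P: (gc) => /eqP sc uc cc.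
(* Along the cycle the matching pairs each even position with the next odd one. *)
pose flip i := if odd i then i.-1 else i.+1.
have flip_lt i : i < 4 * k -> flip i < 4 * k by rewrite /flip; case: ifP; lia.
have flipK i : flip (flip i) = i.
  by rewrite /flip; case: (boolP (odd i)) => oi; case: ifP => //=; lia.
pose f x := if x \in c then nth x0 c (flip (index x c)) else g x.
have memc x : x \in c -> exists2 i, i < 4 * k & x = nth x0 c i.
  by move=> xc; exists (index x c); rewrite ?nth_index // -sc index_mem.
have fE i : i < 4 * k -> f (nth x0 c i) = nth x0 c (flip i).
  by move=> ik; rewrite /f mem_nth ?sc // index_uniq ?sc.
have step i : i < 4 * k -> adj (nth x0 c i) (nth x0 c (i.+1 %% (4 * k))).
  by move=> ik; have := cycle_nth x0 cc (i := i); rewrite sc; apply.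
have fP x : adj x (f x) /\ f (f x) = x.
  case: (boolP (x \in c)) => xc; last first.
    have [|gx a gg] := gP x; first by rewrite !inE.
    move: gx; rewrite !inE => gx; rewrite /f (negPf xc) (negPf gx); by split.
  have [i ik ->] := memc x xc; rewrite !fE ?flip_lt // flipK; split=> //.
  rewrite /flip; case: (boolP (odd i)) => oi.
    have := step i.-1; rewrite prednK ?modn_small ?(adjC _ _ (nth _ _ i)) //; last by lia.
    by apply; lia.
  by have := step i ik; rewrite modn_small //; lia.
pose X := [set x in c | si x].
have inX i : i < 4 * k -> (nth x0 c i \in X) = ~~ odd i.
  by move=> ik; rewrite inE mem_nth ?sc // (gcycle_side x0 gc ik) s0.
(* The points occupy the even positions. Their number [2 * k] is even, so alternating colours close
   up around the cycle. *)
apply: (propagate_colouring (X := X) (c := fun x => odd (index x c)./2) conn fP).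
- by apply/set0Pn; exists (nth x0 c 0); rewrite inX //; lia.
- by move=> x; rewrite inE => /andP[].
move=> x; rewrite inE => /andP[xc sx]; have [i ik xE] := memc x xc.
have oi : ~~ odd i by rewrite -inX // -xE inE xc.
have i1 : i.+1 < 4 * k by lia.
have i2 : i.+2 %% (4 * k) < 4 * k by rewrite ltn_mod; lia.
exists (nth x0 c (i.+2 %% (4 * k))); rewrite inX // xE fE // /flip (negPf oi) !index_uniq ?sc //.
split.
- case: (eqVneq i.+2 (4 * k)) => [->|ne]; first by rewrite modnn.
  by rewrite modn_small /= ?negbK //; lia.
- exact: step.
- case: (eqVneq i.+2 (4 * k)) => [e|ne]; first by rewrite e modnn /=; lia.
  by rewrite modn_small /=; [lia|lia].
Qed.

End Cycles.

(** * Lobes of an 8-cycle *)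

Section Local.
Variables (V : finType) (G : bicubic V).
Notation mu := (mu G).
Notation si := (si G).
Notation adj := (adj G).
Notation e := (e G).
Notation d := (d G).
Notation sd := (sd G).
Notation out := (out G).
Implicit Types (X Y P C : {set V}) (x y z : V) (s : bool).

Lemma e_le k X Y : (forall x, x \in X -> e [set x] Y <= k) -> e X Y <= k * #|X|.
Proof.
move=> h; rewrite mulnC -sum_nat_const; apply: leq_sum => x xX.
by have := h x xX; rewrite e1.
Qed.

Lemma e1_ge x Y : (forall y, y \in Y -> adj x y) -> #|Y| <= e [set x] Y.
Proof. by move=> h; rewrite e1 -sum1_card; apply: leq_sum => y /h. Qed.

Lemma nbr3 x y1 y2 y3 y : uniq [:: y1; y2; y3] -> adj x y1 -> adj x y2 -> adj x y3 ->
  adj x y -> y \in [:: y1; y2; y3].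
Proof.
move=> u a1 a2 a3 a; apply/negPn/negP => yn.
have := e_split G [set x] [set z in [:: y1; y2; y3]]; rewrite cards1.
have h : #|[set z in [:: y1; y2; y3]]| <= e [set x] [set z in [:: y1; y2; y3]].
  by apply: e1_ge => z; rewrite !inE => /or3P[] /eqP->.
have : 0 < e [set x] (~: [set z in [:: y1; y2; y3]]).
  by apply: (e_gt0 (y := y) (set11 x)); rewrite // !inE in yn *.
by move: h; rewrite cardsE (card_uniqP u) /=; lia.
Qed.

Lemma gcycle_two m c x : gcycle G m c -> 2 < m -> x \in c ->
  exists y z, [/\ y \in c, z \in c, y != z, adj x y & adj x z].
Proof.
move=> gc m2 /rot_to[i p Ec].
have := gcycle_rot i gc; rewrite Ec => /and3P[/eqP sp up cp].
have memp z : z \in p -> z \in c by move=> zp; rewrite -(mem_rot i) Ec in_cons zp orbT.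
case: p sp up cp memp {Ec} => [|y p] /= sp; first by lia.
case: (lastP p) sp => [|q z] /=; rewrite ?size_rcons; first by lia.
move=> _ /and3P[_ yq _]; rewrite rcons_path last_rcons => /and3P[axy _ azx] memp.
exists y, z; rewrite !memp ?inE ?eqxx ?mem_rcons ?inE ?eqxx ?orbT // axy adjC azx; split=> //.
by apply: contraNneq yq => ->; rewrite mem_rcons mem_head.
Qed.

Lemma gcycle_in m c x : gcycle G m c -> 2 < m -> x \in c -> 1 < e [set x] [set y in c].
Proof.
move=> gc m2 xc; have [y [z [yc zc yz ay az]]] := gcycle_two gc m2 xc.
apply: (@leq_trans (e [set x] [set y; z])); last first.
  by apply: eS => //; apply/subsetP => w; rewrite !inE => /orP[] /eqP->.
apply: leq_trans (e1_ge _); first by rewrite cards2 yz.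
by move=> w; rewrite !inE => /orP[] /eqP->.
Qed.

Lemma gcycle8P c : gcycle G 8 c -> exists a1 b1 a2 b2 a3 b3 a4 b4,
  [/\ c = [:: a1; b1; a2; b2; a3; b3; a4; b4], uniq c,
      [/\ adj a1 b1, adj b1 a2, adj a2 b2 & adj b2 a3] &
      [/\ adj a3 b3, adj b3 a4, adj a4 b4 & adj b4 a1]].
Proof.
case/and3P => sc uc cc.
case: c sc uc cc => [|a1 [|b1 [|a2 [|b2 [|a3 [|b3 [|a4 [|b4 [|x c]]]]]]]]] // _ uc /=.
rewrite !andbA andbT -!andbA => /and5P[h1 h2 h3 h4 /and4P[h5 h6 h7 h8]].
by exists a1, b1, a2, b2, a3, b3, a4, b4.
Qed.

Lemma gcycle8_sd c s : gcycle G 8 c -> #|sd [set x in c] s| = 4.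
Proof.
move=> gc; have [a1 [b1 [a2 [b2 [a3 [b3 [a4 [b4 [cE uc [h1 h2 h3 h4] [h5 h6 h7 h8]]]]]]]]]] := gcycle8P gc.
transitivity (size [seq x <- c | si x == s]).
  rewrite -(card_uniqP (filter_uniq _ uc)); apply: eq_card => x.
  by rewrite !inE mem_filter andbC.
rewrite cE /= (adj_si h7) (adj_si h6) (adj_si h5) (adj_si h4) (adj_si h3) (adj_si h2) (adj_si h1) !negbK.
by case: (si a1); case: (s).
Qed.

(** Each of the four vertices of one side has two edges on the cycle and at most one leaving it. *)
Lemma gcycle8_out c s : gcycle G 8 c -> e (sd [set x in c] s) (~: [set x in c]) <= 4.
Proof.
move=> gc; rewrite -[4]mul1n -(gcycle8_sd s gc); apply: e_le => x.
rewrite in_sd inE => /andP[xc _]; have := gcycle_in gc isT xc.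
have := e_split G [set x] [set y in c]; rewrite cards1; lia.
Qed.

(* If the complement of [C] has no perfect matching, a Hall violator together with its
   neighbourhood outside [C] is a lobe. *)
Definition lobe s C P := [/\ [disjoint P & C], #|sd P s| = #|sd P (~~ s)|.+1 &
  e (sd P s) (~: (P :|: C)) = 0].

Lemma lobe_out c s P : gcycle G 8 c -> lobe s [set x in c] P ->
  out s P = e (sd P s) [set x in c] /\ out s P = out (~~ s) P + 3.
Proof.
move=> gc [dPC cP e0]; split; last first.
  have := cutE G s P; have := cutE G (~~ s) P; lia.
rewrite /out (eIDr G [set x in c]) setIC -setDE.
have -> : [set x in c] :\: P = [set x in c] by apply/setDidPl; rewrite disjoint_sym.
suff -> : e (sd P s) (~: P :\: [set x in c]) = 0 by rewrite addn0.
by rewrite -e0; congr (e _ _); apply/setP => x; rewrite !inE negb_or andbC.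
Qed.

Lemma lobe_out4 c s P : gcycle G 8 c -> lobe s [set x in c] P -> out s P <= 4.
Proof.
move=> gc hP; have [-> _] := lobe_out gc hP; case: hP => dPC _ _.
rewrite e_sd eC; apply: leq_trans (gcycle8_out (~~ s) gc); apply: eS => //.
apply/subsetP => x; rewrite in_sd => /andP[xP _]; rewrite inE.
by rewrite (disjointFr dPC xP).
Qed.

End Local.

Section Brace.
Variables (V : finType) (G : bicubic V) (v : V).
Notation mu := (mu G).
Notation si := (si G).
Notation adj := (adj G).
Notation e := (e G).
Notation d := (d G).
Notation sd := (sd G).
Notation out := (out G).
Implicit Types (X Y P C : {set V}) (x y z : V) (s : bool).

Hypothesis nocut : forall X, 1 < #|X| -> 1 < #|~: X| -> 3 < d X.
Hypothesis no8 : forall c, gcycle G 8 c -> v \notin c -> ~ pm G (~: [set x in c]).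

Lemma d_ge3 X : X != set0 -> X != setT -> 3 <= d X.
Proof.
rewrite -card_gt0 => X0 XT.
have : 0 < #|~: X| by rewrite card_gt0; apply: contra XT => /eqP h; rewrite -(setCK X) h setC0.
rewrite leq_eqVlt => /orP[/eqP/esym/(card_d G)|XC]; first by rewrite dC => ->.
move: X0; rewrite leq_eqVlt => /orP[/eqP/esym/(card_d G) -> //|X1].
by apply: ltnW; apply: nocut.
Qed.

(** At most four edges run from a Hall violator to the cycle, so its deficiency is exactly one and
    at most one edge leaves its neighbourhood. By balance the remaining vertices off the cycle form
    a lobe of the other side. *)
Lemma lobes c : gcycle G 8 c -> v \notin c -> exists P,
  [/\ lobe G true [set x in c] P, lobe G false [set x in c] (~: ([set x in c] :|: P)) &
      e P (~: ([set x in c] :|: P)) <= 1].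
Proof.
move=> gc vc; set C := [set x in c].
have c4 s := gcycle8_sd s gc; rewrite -/C in c4.
have bal : #|sd setT true| = #|sd setT false|.
  have := cutE G true setT; have := cutE G false setT; rewrite /out setCT.
  have e0 X : e X set0 = 0 by apply/eqP/e_eq0P => x y; rewrite inE.
  rewrite !e0; lia.
have cC s : #|sd (~: C) s| + 4 = #|sd setT s|.
  rewrite -(c4 s) addnC -(cardsID (sd C s) (sd setT s)); congr (_ + _); apply: eq_card => x; rewrite !inE.
    by case: (si x == s); rewrite ?andbF ?andbT.
  by case: (si x == s); rewrite ?andbF ?andbT.
case: (boolP [forall Y : {set V}, (Y \subset sd (~: C) true) ==> (#|Y| <= #|image_in adj (~: C) Y|)]).
  move=> /forallP h; case: (no8 gc vc); apply: (@hall_pm _ _ true) => [|Y YS].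
    by apply/eqP; rewrite -(eqn_add2r 4) !cC bal.
  by have := h Y; rewrite YS.
rewrite negb_forall => /existsP[S]; rewrite negb_imply -ltnNge => /andP[SC lt].
set N := image_in adj (~: C) S in lt.
have St x : x \in S -> si x /\ x \notin C.
  by move=> /(subsetP SC); rewrite !inE => /andP[-> /eqP->].
have Nf x : x \in N -> ~~ si x /\ x \notin C.
  by case/image_inP; rewrite inE => -> [z /St[sz _] /adj_si->]; rewrite sz.
pose P := S :|: N.
have Pt : sd P true = S.
  apply/setP => x; rewrite in_sd in_setU; apply/andP/idP => [[/orP[//|/Nf[/negPf-> //]]]|xS].
  by have [-> _] := St x xS; rewrite xS.
have Pf : sd P false = N.
  apply/setP => x; rewrite in_sd in_setU; apply/andP/idP => [[/orP[/St[-> //]|//]]|xN].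
  by have [/negPf-> _] := Nf x xN; rewrite xN orbT.
have memP x : (x \in P) = (x \in S) || (x \in N) by rewrite in_setU.
clearbody P.
have dPC : [disjoint P & C].
  apply/pred0P => x /=; rewrite memP; apply/negP => /andP[/orP[/St[_]|/Nf[_]] /negPf->//].
have eP : e (sd P true) (~: (P :|: C)) = 0.
  apply/eqP/e_eq0P => x y; rewrite Pt => xS; rewrite in_setC in_setU memP !negb_or => /andP[/andP[_ yN] yC].
  by apply: contra yN => a; apply/image_inP; rewrite in_setC yC; split=> //; exists x.
have ot : out true P <= 4.
  rewrite /out (eIDr G C) [X in _ + X](_ : _ = 0) ?addn0.
    rewrite e_sd eC; apply: leq_trans (gcycle8_out false gc); apply: eS.
      by apply/subsetP => x; rewrite !inE => /andP[/andP[_ ->]].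
    apply/subsetP => x; rewrite Pt => /St[_ xC]; by rewrite inE.
  by rewrite -eP setCU setDE.
have cP := cutE G true P; have cP' := cutE G false P; rewrite Pt Pf in cP cP'.
have hP : lobe G true C P by split=> //; rewrite Pt Pf; lia.
exists P; split=> //.
- split.
  + by rewrite -setI_eq0; apply/eqP/setP => x; rewrite !inE negb_or; case: (x \in c); rewrite ?andbF.
  + have sC s : #|sd (~: C) s| = #|sd P s| + #|sd (~: (C :|: P)) s|.
      have sub : sd P s \subset sd (~: C) s.
        by apply/subsetP => x; rewrite !in_sd in_setC => /andP[xP ->]; rewrite (disjointFr dPC).
      rewrite -(cardsID (sd P s) (sd (~: C) s)) (setIidPr sub); congr (_ + _).
      apply: eq_card => x; rewrite in_setD !in_sd !in_setC in_setU negb_or.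
      by case: (x \in C); case: (x \in P); case: (si x == s).
    have := sC true; have := sC false; have := cC true; have := cC false; rewrite Pt Pf bal /=; lia.
  + apply/eqP/e_eq0P => x y; rewrite !inE !negb_or => /andP[/andP[xC xP] /eqP sx] /andP[yQ yC].
    apply/negP => a; have sy : si y by rewrite (adj_si a) sx.
    have yP : y \in P by move: yQ; rewrite yC /= negbK.
    have yS : y \in S by rewrite -Pt in_sd yP sy.
    case/negP: xP; rewrite memP; apply/orP; right; apply/image_inP; rewrite !inE xC.
    by split=> //; exists y; rewrite // adjC.
- rewrite (eID G (sd P true)) (setIidPr (sd_sub _ _ _)).
  have -> : e (sd P true) (~: (C :|: P)) = 0 by rewrite setUC.
  rewrite add0n; apply: (@leq_trans (out false P)); last by lia.
  apply: eS.
    by apply/subsetP => x; rewrite !inE; case: (x \in P); case: (si x).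
  by apply/subsetP => x; rewrite !inE negb_or => /andP[].
Qed.

End Brace.

(** The conditions on cycles spare those through [v], which will stand for a contracted set: such a
    cycle is not one of the original graph, and nothing is known about it. *)
Record brace (V : finType) (G : bicubic V) (v : V) : Prop := Brace {
  br_cut : forall X : {set V}, 1 < #|X| -> 1 < #|~: X| -> 3 < d G X;
  br_no4 : forall c, gcycle G 4 c -> v \notin c -> False;
  br_no8 : forall c, gcycle G 8 c -> v \notin c -> ~ pm G (~: [set x in c]);
  br_card : 3 < #|V| }.

(** * Graphs with only trivial 3-edge cuts, and uncrossing of lobes *)

Section BraceTheory.
Variables (V : finType) (G : bicubic V) (v : V).
Notation mu := (mu G).
Notation si := (si G).
Notation adj := (adj G).
Notation e := (e G).
Notation d := (d G).
Notation sd := (sd G).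
Notation out := (out G).
Implicit Types (X Y P C : {set V}) (x y z : V) (s : bool).
Hypothesis H : brace G v.

(** The ends of a double edge would have a cut of at most two edges. *)
Lemma mu_le1 x y : mu x y <= 1.
Proof.
case: (boolP (adj x y)) => [a|]; last by rewrite /adj; lia.
have xy : x != y by apply: contraTneq a => ->; rewrite /adj mu_si.
have c2 : #|[set x; y]| = 2 by rewrite cards2 xy.
have := br_cut H (X := [set x; y]); rewrite c2 => /(_ isT).
have := cardsC [set x; y]; have := br_card H; rewrite c2 => V4 cC.
have -> : 1 < #|~: [set x; y]| by lia.
move=> /(_ isT); rewrite /d /=.
have := e_split G [set x; y] [set x; y]; rewrite c2.
have : e [set x] [set y] + e [set y] [set x] <= e [set x; y] [set x; y].
  rewrite (eID G [set x] [set x; y]); apply: leq_add; apply: eS; rewrite ?sub1set ?inE ?eqxx ?orbT //.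
  by rewrite eq_sym xy.
rewrite !e11 (mu_sym G y x); rewrite -/(Cubic.e G [set x; y] (~: [set x; y])); lia.
Qed.

Lemma muE x y : mu x y = adj x y.
Proof. by have := mu_le1 x y; rewrite /adj; case: (mu x y) => [|[|]]. Qed.

Lemma e1_card x Y : e [set x] Y = #|[set y in Y | adj x y]|.
Proof.
rewrite e1 -sum1_card big_mkcond [RHS]big_mkcond /=; apply: eq_bigr => y _.
by rewrite inE muE; case: (y \in Y); case: (adj x y).
Qed.

Definition nb x := [set y | adj x y].

Lemma card_nb x : #|nb x| = 3.
Proof.
have := e_total G [set x]; rewrite cards1 e1_card muln1 => <-.
by apply: eq_card => y; rewrite !inE.
Qed.

Lemma no4_cycle x b y b' : x != v -> b != v -> y != v -> b' != v -> x != y -> b != b' ->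
  adj x b -> adj b y -> adj y b' -> adj b' x -> False.
Proof.
move=> xv bv yv bv' xy bb a1 a2 a3 a4; apply: (br_no4 H (c := [:: x; b; y; b'])).
  have ne u w : adj u w -> u != w by move=> a; apply: contraTneq a => ->; rewrite /adj mu_si.
  rewrite /gcycle /= !inE !negb_or a1 a2 a3 a4 xy bb (ne _ _ a1) (ne _ _ a2) (ne _ _ a3).
  by rewrite eq_sym (ne _ _ a4).
by rewrite !inE !negb_or !(eq_sym v) xv bv yv bv'.
Qed.

Lemma gcycle8_side s c : gcycle G 8 c -> v \notin c -> exists a1 b1 a2 b2 a3 b3 a4 b4,
  [/\ gcycle G 8 [:: a1; b1; a2; b2; a3; b3; a4; b4], c =i [:: a1; b1; a2; b2; a3; b3; a4; b4],
   [/\ si a1 = s, si a2 = s, si a3 = s & si a4 = s] &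
   [/\ si b1 = ~~ s, si b2 = ~~ s, si b3 = ~~ s & si b4 = ~~ s]].
Proof.
move=> gc vc; wlog hs : c gc vc / si (head v c) = s.
  move=> IH; case: (eqVneq (si (head v c)) s) => [|hs]; first exact: IH.
  have [||| a1 [b1 [a2 [b2 [a3 [b3 [a4 [b4 [h1 h2 h3 h4]]]]]]]]] := IH (rot 1 c).
  - exact: gcycle_rot.
  - by rewrite mem_rot.
  - have := gcycle_side v gc (i := 1) isT; rewrite nth0.
    case/and3P: gc => /eqP; case: (c) hs => [|x [|y p]] //= hs _ _ _ ->.
    by move: hs; case: (si x); case: (s).
  exists a1, b1, a2, b2, a3, b3, a4, b4; split=> // x; by rewrite -(mem_rot 1) h2.
have [a1 [b1 [a2 [b2 [a3 [b3 [a4 [b4 [cE uc [h1 h2 h3 h4] [h5 h6 h7 h8]]]]]]]]]] := gcycle8P gc.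
exists a1, b1, a2, b2, a3, b3, a4, b4; rewrite cE in gc hs *; split=> //=.
  by rewrite (adj_si h6) (adj_si h5) (adj_si h4) (adj_si h3) (adj_si h2) (adj_si h1) hs !negbK.
by rewrite (adj_si h7) (adj_si h6) (adj_si h5) (adj_si h4) (adj_si h3) (adj_si h2) (adj_si h1) hs !negbK.
Qed.

Lemma sd_cycle s a1 b1 a2 b2 a3 b3 a4 b4 :
  [/\ si a1 = s, si a2 = s, si a3 = s & si a4 = s] ->
  [/\ si b1 = ~~ s, si b2 = ~~ s, si b3 = ~~ s & si b4 = ~~ s] ->
  sd [set x in [:: a1; b1; a2; b2; a3; b3; a4; b4]] (~~ s) = [set x in [:: b1; b2; b3; b4]].
Proof.
move=> [A1 A2 A3 A4] [B1 B2 B3 B4]; apply/setP => x; rewrite in_sd !inE; apply/andP/idP.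
  case=> h; move: h; do 8?[case: eqP => [->|_] /=]; rewrite ?eqxx ?orbT // ?A1 ?A2 ?A3 ?A4;
  by case: (s).
by case/or4P => /eqP->; rewrite ?B1 ?B2 ?B3 ?B4 ?eqxx ?orbT.
Qed.

Lemma e1_seq4 x b1 b2 b3 b4 : uniq [:: b1; b2; b3; b4] ->
  e [set x] [set y in [:: b1; b2; b3; b4]] = mu x b1 + mu x b2 + mu x b3 + mu x b4.
Proof.
move=> u; rewrite e1.
rewrite (eq_bigl (fun y => y \in [:: b1; b2; b3; b4])); last by move=> y; rewrite inE.
by rewrite -big_uniq //= !big_cons big_nil addn0 !addnA.
Qed.

Lemma uniq_evens (T : eqType) (a1 b1 a2 b2 a3 b3 a4 b4 : T) :
  uniq [:: a1; b1; a2; b2; a3; b3; a4; b4] -> uniq [:: b1; b2; b3; b4].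
Proof.
move=> u; apply: (subseq_uniq _ u).
exact: (mask_subseq [:: false; true; false; true; false; true; false; true] [:: a1; b1; a2; b2; a3; b3; a4; b4]).
Qed.

(** Two such neighbours of [x] would form a 4-cycle with [x] and the cycle vertex between them. *)
Lemma consecutive a1 b1 a2 b2 a3 b3 a4 b4 x :
  gcycle G 8 [:: a1; b1; a2; b2; a3; b3; a4; b4] ->
  v \notin [:: a1; b1; a2; b2; a3; b3; a4; b4] -> x != v ->
  x \notin [:: a1; b1; a2; b2; a3; b3; a4; b4] ->
  [/\ ~~ (adj x b1 && adj x b2), ~~ (adj x b2 && adj x b3),
      ~~ (adj x b3 && adj x b4) & ~~ (adj x b4 && adj x b1)].
Proof.
move=> gc vc xv xc.
have [? [? [? [? [? [? [? [? [[<- <- <- <- <- <- <- <-] uc [h1 h2 h3 h4] [h5 h6 h7 h8]]]]]]]]]] := gcycle8P gc.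
have uE := uniq_evens uc.
have key b a b' : b \in [:: a1; b1; a2; b2; a3; b3; a4; b4] -> a \in [:: a1; b1; a2; b2; a3; b3; a4; b4] ->
   b' \in [:: a1; b1; a2; b2; a3; b3; a4; b4] -> b != b' -> adj b a -> adj a b' -> ~~ (adj x b && adj x b').
  move=> bc ac bc' bb ab ab'; apply/negP => /andP[xb xb'].
  have nv u : u \in [:: a1; b1; a2; b2; a3; b3; a4; b4] -> u != v by apply: contraTneq => ->.
  have xa : x != a by apply: contraNneq xc => ->.
  by apply: (no4_cycle xv (nv _ bc) (nv _ ac) (nv _ bc') xa bb); rewrite // adjC.
move: uE; rewrite /= !inE !negb_or -!andbA => /and5P[n12 n13 n14 n23 /andP[n24 /andP[n34 _]]].
split; [apply: (key _ a2)|apply: (key _ a3)|apply: (key _ a4)|apply: (key _ a1)];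
  by rewrite // ?inE ?eqxx ?orbT // eq_sym.
Qed.

Lemma outer_le2 c x : gcycle G 8 c -> v \notin c -> x \notin c -> x != v ->
  e [set x] [set y in c] <= 2.
Proof.
move=> gc vc xc xv.
have [a1 [b1 [a2 [b2 [a3 [b3 [a4 [b4 [gc' cE A B]]]]]]]]] := gcycle8_side (si x) gc vc.
have -> : [set y in c] = [set y in [:: a1; b1; a2; b2; a3; b3; a4; b4]] by apply/setP => y; rewrite !inE cE !inE.
have -> : [set x] = sd [set x] (si x) by apply/setP => y; rewrite in_sd inE; case: eqP => //= ->; rewrite eqxx.
rewrite e_sd (sd_cycle A B).
have -> : sd [set x] (si x) = [set x] by apply/setP => y; rewrite in_sd inE; case: eqP => //= ->; rewrite eqxx.
rewrite e1_seq4; last by case/and3P: gc' => _ /uniq_evens.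
have [] := consecutive gc' _ xv _; rewrite -?cE // !muE.
by do 4!case: (adj x _).
Qed.

(** With only three edges leaving from side [s], the lobe would have a cut of three, hence be a
    single vertex with all its neighbours on the cycle, while [outer_le2] allows two. *)
Lemma lobe5 s c X : gcycle G 8 c -> v \notin c -> lobe G s [set x in c] X -> v \notin X ->
  [/\ out s X = 4, out (~~ s) X = 1 & d X = 5].
Proof.
move=> gc vc hX vX; have [oE o3] := lobe_out gc hX; have o4 := lobe_out4 gc hX.
have [dXC cX _] := hX.
suff : out s X != 3 by rewrite (dE G s) => /eqP ?; split; lia.
apply/eqP => os; have d3 : d X = 3 by rewrite (dE G s); lia.
have sX : 0 < #|sd X s| by lia.
have X1 : #|X| <= 1.
  rewrite leqNgt; apply/negP => X1; have : 3 < d X; last by rewrite d3.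
  apply: br_cut H _ X1 _; apply: (@leq_trans #|[set x in c]|); last first.
    by apply: subset_leq_card; rewrite subsets_disjoint setCK disjoint_sym.
  by rewrite (card_sd G s) !(gcycle8_sd _ gc).
have /card_gt0P[x xs] := sX; have xX : x \in X by move: xs; rewrite in_sd => /andP[].
have XE : X = [set x].
  by apply/esym/eqP; rewrite eqEcard sub1set xX cards1.
have xsE : sd X s = [set x].
  apply/eqP; rewrite eqEsubset sub1set xs andbT -XE; exact: sd_sub.
have := outer_le2 gc vc (x := x); rewrite -xsE -oE os => h.
have : 3 <= 2 by apply: h; [have := disjointFr dXC xX; rewrite inE => ->|apply: contraNneq vX => <-].
by [].
Qed.

(** A vertex on the cycle has two neighbours there. Any other vertex outside can receive from [X]
    only the single edge that leaves from side [~~ s]. *)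
Lemma lobe_within s c X z : gcycle G 8 c -> v \notin c -> lobe G s [set x in c] X -> v \notin X ->
  z \notin X -> 1 < e [set z] (~: X).
Proof.
move=> gc vc hX vX zX; have [os os' _] := lobe5 gc vc hX vX; have [dXC _ e0] := hX.
case: (boolP (z \in c)) => zc.
  apply: leq_trans (gcycle_in gc isT zc) _; apply: eS => //.
  by rewrite subsets_disjoint setCK disjoint_sym.
suff : e [set z] X <= 1 by have := e_split G [set z] X; rewrite cards1; lia.
rewrite eC (eID G (sd X s)) (setIidPr (sd_sub _ _ _)).
have -> : e (sd X s) [set z] = 0.
  apply/eqP; rewrite -leqn0 -e0; apply: eS => //; rewrite sub1set !inE negb_or zX.
  by rewrite zc.
rewrite add0n -os'; apply: eS; last by rewrite sub1set inE.
by apply/subsetP => x; rewrite !inE; case: (x \in X); case: (si x); case: (s).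
Qed.

(** If both lobes of [c'] reach outside [X], they divide the complement of [X] into two parts with
    at most one edge between them. Each part has at least two vertices, so each has a cut of at
    least four edges. The two cuts need eight in all, but [d X = 5] and one edge counted twice give
    at most seven. *)
Lemma uncross s c X c' : gcycle G 8 c -> v \notin c -> lobe G s [set x in c] X -> v \notin X ->
  gcycle G 8 c' -> (forall x, x \in c' -> x \in X) ->
  exists s' P, lobe G s' [set x in c'] P /\ P \subset X.
Proof.
move=> gc vc hX vX gc' c'X; have [os os' d5] := lobe5 gc vc hX vX.
have vc' : v \notin c' by apply: contra vX => /c'X.
have [P [hP hQ ePQ]] := lobes (br_no8 H) gc' vc'.
set Q := ~: _ in hQ ePQ.
case: (boolP (P \subset X)) => PX; first by exists true, P.
case: (boolP (Q \subset X)) => QX; first by exists false, Q.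
pose Zp := P :\: X; pose Zq := Q :\: X.
have disPQ : [disjoint P & Q].
  by rewrite -setI_eq0; apply/eqP/setP => x; rewrite !inE negb_or; case: (x \in P); rewrite ?andbF.
have ZE : ~: X = Zp :|: Zq.
  apply/setP => x; rewrite !inE negb_or; case xX: (x \in X) => //=.
  have /negPf-> : x \notin c' by apply/negP => /c'X; rewrite xX.
  by case: (x \in P).
have disZ : [disjoint Zp & Zq].
  by apply: disjointWl (subsetDl _ _) (disjointWr (subsetDl _ _) disPQ).
have Zp0 : Zp != set0 by rewrite setD_eq0.
have Zq0 : Zq != set0 by rewrite setD_eq0.
have eZ : e Zp Zq <= 1 by apply: leq_trans ePQ; apply: eS; apply: subsetDl.
have key A B : ~: X = A :|: B -> [disjoint A & B] -> A != set0 -> e A B <= 1 -> 1 < #|A|.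
  move=> XE dAB A0 eAB; rewrite ltnNge; apply/negP => A1.
  have /cards1P[z zE] : #|A| == 1 by rewrite eqn_leq A1 card_gt0.
  have zX : z \notin X by rewrite -in_setC XE zE !inE eqxx.
  have := lobe_within gc vc hX vX zX; rewrite XE eUr // {1}zE e11 mu_si // -zE.
  by move: eAB; clear; lia.
have cut A B : ~: X = A :|: B -> [disjoint A & B] -> A != set0 -> e A B <= 1 ->
    3 < e A B + e A X.
  move=> XE dAB A0 eAB; have A1 := key A B XE dAB A0 eAB.
  rewrite -eUr; last by rewrite disjoint_sym disjoints_subset -setCS setCK XE subsetUr.
  have <- : ~: A = B :|: X.
    apply/setP => x; have := in_setC x X; rewrite XE !inE => h; have := disjointFr dAB (x := x).
    by case xA: (x \in A) h; case xB: (x \in B); case: (x \in X) => //= _ /(_ isT).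
  apply: (br_cut H A1); apply: (@leq_trans #|[set x in c']|).
    by rewrite (card_sd G s) !(gcycle8_sd _ gc').
  apply: subset_leq_card; apply/subsetP => x; rewrite !inE => /c'X xX.
  apply/negP => xA; have : x \in ~: X by rewrite XE inE xA.
  by rewrite inE xX.
have h1 := cut _ _ ZE disZ Zp0 eZ.
have h2 : 3 < e Zq Zp + e Zq X.
  by apply: cut; rewrite 1?setUC 1?disjoint_sym // eC.
move: d5; rewrite /Cubic.d ZE eUr //.
move: h1 h2; rewrite (eC G Zq Zp) (eC G Zq X) (eC G Zp X) => h1 h2 d5.
by move: h1 h2 d5 eZ; clear; lia.
Qed.

End BraceTheory.

(** * Configurations with boundary inside a graph *)

Section Pole.
Variables (V : finType) (G : bicubic V) (v : V).
Notation mu := (mu G).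
Notation si := (si G).
Notation adj := (adj G).
Notation e := (e G).
Notation d := (d G).
Notation sd := (sd G).
Notation out := (out G).
Notation nb := (nb G).
Implicit Types (X Y P C : {set V}) (x y z : V) (s : bool).
Hypothesis H : brace G v.
Variables (X : {set V}) (s : bool).
Hypothesis vX : v \notin X.
Hypothesis d5 : d X <= 5.
Hypothesis out1 : forall w, w \notin X -> si w = s -> e [set w] X <= 1.

(** The vertices of side [~~ s] in [X] act as blocks. The outer ends of their edges are kept as
    points, so that every block has three. *)
Definition pole_points := [set x | (si x == s) && ((x \in X) || [exists b in sd X (~~ s), adj b x])].
Definition pole_blocks := [set nb b | b in sd X (~~ s)].

Lemma nb_side b x : b \in sd X (~~ s) -> adj b x -> si x = s.
Proof. by rewrite in_sd => /andP[_ /eqP sb] /adj_si->; rewrite sb negbK. Qed.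

Lemma two_blocks_inside b b' x : b \in sd X (~~ s) -> b' \in sd X (~~ s) -> b != b' ->
  adj b x -> adj b' x -> x \in X.
Proof.
move=> bX bX' bb a a'; apply/negPn/negP => xX.
have := out1 xX (nb_side bX a); rewrite (e1_card H).
suff : 1 < #|[set y in X | adj x y]| by lia.
apply: (@leq_trans #|[set b; b']|); first by rewrite cards2 bb.
apply: subset_leq_card; apply/subsetP => y; rewrite !inE => /orP[] /eqP->.
  by rewrite (subsetP (sd_sub _ _ _) _ bX) adjC.
by rewrite (subsetP (sd_sub _ _ _) _ bX') adjC.
Qed.

Lemma pole_lin b b' x y : b \in sd X (~~ s) -> b' \in sd X (~~ s) -> x != y ->
  adj b x -> adj b y -> adj b' x -> adj b' y -> b = b'.
Proof.
move=> bX bX' xy bx by_ b'x b'y; apply/eqP/negPn/negP => bb.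
have xX := two_blocks_inside bX bX' bb bx b'x; have yX := two_blocks_inside bX bX' bb by_ b'y.
have nv u : u \in X -> u != v by apply: contraTneq => ->.
have inX u : u \in sd X (~~ s) -> u != v by move=> /(subsetP (sd_sub _ _ _)); apply: nv.
by apply: (no4_cycle H (inX _ bX) (nv _ xX) (inX _ bX') (nv _ yX) bb xy); rewrite // adjC.
Qed.

Lemma nb_inj b b' : b \in sd X (~~ s) -> b' \in sd X (~~ s) -> nb b = nb b' -> b = b'.
Proof.
move=> bX bX' nbE; have : 1 < #|nb b| by rewrite (card_nb H).
case/card_gt1P => x [y [xb yb xy]]; have xb' := xb; have yb' := yb.
rewrite nbE in xb' yb'; move: xb yb xb' yb'; rewrite !inE => xb yb xb' yb'.
exact: (pole_lin bX bX' xy).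
Qed.

Lemma pole_bdeg x : x \in pole_points -> bdeg pole_blocks x = e [set x] X.
Proof.
rewrite inE => /andP[/eqP sx _]; rewrite (e1_card H).
have -> : [set y in X | adj x y] = [set b in sd X (~~ s) | adj x b].
  apply/setP => b; rewrite !inE; case: (boolP (adj x b)) => [a|]; rewrite ?andbF // !andbT.
  by rewrite (adj_si a) sx eqxx andbT.
rewrite -[RHS](card_in_imset (f := nb)).
  apply: eq_card => B; rewrite !inE; apply/andP/imsetP.
    by case=> /imsetP[b bX ->]; rewrite inE => a; exists b; rewrite // !inE -in_sd bX adjC.
  case=> b; rewrite inE => /andP[bX a] ->; rewrite inE adjC a; split=> //; exact: imset_f.
move=> b b'; rewrite !in_set => /andP[/andP[h1 h2] _] /andP[/andP[h3 h4] _]; apply: nb_inj.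
  by rewrite in_sd h1.
by rewrite in_sd h3.
Qed.

(** For connectedness: a proper closed set would split [X] into two nonempty parts with no edge
    between them. Each part has a cut of at least three edges, against [d X <= 5]. *)
Lemma pole_linear_space : linear_space pole_points pole_blocks.
Proof.
split.
- by move=> _ /imsetP[b _ ->]; apply: card_nb H _.
- move=> _ /imsetP[b bX ->]; apply/subsetP => x; rewrite !inE => a.
  by rewrite (nb_side bX a) eqxx; apply/orP; right; apply/exists_inP; exists b.
- move=> _ _ x y /imsetP[b bX ->] /imsetP[b' bX' ->] xy; rewrite !inE => h1 h2 h3 h4.
  by rewrite (pole_lin bX bX' xy h1 h2 h3 h4).
move=> S Sp S0 hS; apply/eqP; rewrite eqEsubset Sp /=; apply/subsetP => y yp.
apply/negPn/negP => yS.
have closed b x z : b \in sd X (~~ s) -> adj b x -> x \in S -> adj b z -> z \in S.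
  move=> bX bx xS bz; have := hS (nb b) x; rewrite imset_f // !inE bx => /(_ isT isT xS).
  by move/subsetP => /(_ z); rewrite inE bz; apply.
pose Y := (S :&: X) :|: [set b in sd X (~~ s) | [exists x in S, adj b x]].
have Ss x : x \in S -> si x = s by move=> /(subsetP Sp); rewrite inE => /andP[/eqP].
have Yb b : b \in Y -> si b = ~~ s -> b \in sd X (~~ s) /\ exists2 x, x \in S & adj b x.
  rewrite !inE => /orP[/andP[bS _]|/andP[bX /exists_inP[x xS a]]] sb.
    by rewrite (Ss b bS) in sb; move: sb; case: (s).
  by split=> //; exists x.
have Yp x : x \in Y -> si x = s -> x \in S.
  rewrite !inE => /orP[/andP[]//|/andP[/andP[_ /eqP->]]] _; by case: (s).
have YX : Y \subset X.
  by apply/subsetP => x; rewrite !inE => /orP[/andP[]//|/andP[/andP[]]].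
have Y0 : Y != set0.
  case/set0Pn: S0 => x xS; have := subsetP Sp x xS; rewrite inE => /andP[_ /orP[xX|/exists_inP[b bX a]]].
    by apply/set0Pn; exists x; rewrite !inE xS xX.
  apply/set0Pn; exists b; rewrite in_setU; apply/orP; right; rewrite inE bX; apply/exists_inP; exists x => //.
have XY0 : X :\: Y != set0.
  move: yp; rewrite inE => /andP[/eqP sy /orP[yX|/exists_inP[b bX a]]].
    by apply/set0Pn; exists y; rewrite in_setD yX andbT; apply: contra yS => /Yp; apply.
  apply/set0Pn; exists b; rewrite in_setD (subsetP (sd_sub _ _ _) _ bX) andbT; apply: contra yS => bY.
  have [|_ [x xS bx]] := Yb b bY; first by move: bX; rewrite in_sd => /andP[_ /eqP].
  exact: (closed b x y).
have e0 : e Y (X :\: Y) = 0.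
  apply/eqP/e_eq0P => x z xY; rewrite in_setD => /andP[zY zX]; apply/negP => a.
  have sz := adj_si a; case: (eqVneq (si x) s) => sx.
    case/negP: zY; rewrite in_setU; apply/orP; right; rewrite !inE zX sz sx eqxx.
    by apply/exists_inP; exists x; [apply: Yp | rewrite adjC].
  have sx' : si x = ~~ s by move: sx; case: (si x); case: (s).
  have [xX [w wS xw]] := Yb x xY sx'.
  case/negP: zY; rewrite in_setU in_setI zX andbT; apply/orP; left; exact: (closed x w z).
clearbody Y.
have XYd : (X :\: Y) :&: Y = set0.
  by apply/setP => z; rewrite in_setI in_setD in_set0; case: (z \in Y); rewrite ?andbF.
have h1 : 3 <= d Y.
  apply: (d_ge3 (br_cut H)) => //; apply: contraNneq XY0 => YT.
  by rewrite -XYd YT setIT.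
have h2 : 3 <= d (X :\: Y).
  apply: (d_ge3 (br_cut H)) => //; apply: contraNneq Y0 => YT.
  by rewrite -XYd YT setTI.
have dX : d X = d Y + d (X :\: Y).
  have cE : ~: Y = ~: X :|: (X :\: Y).
    apply/setP => z; rewrite !(in_setC, in_setU, in_setD); have /implyP := subsetP YX z.
    by case: (z \in Y); case: (z \in X).
  have cE' : ~: (X :\: Y) = ~: X :|: Y.
    apply/setP => z; rewrite !(in_setC, in_setU, in_setD) negb_and negbK orbC.
    by [].
  have dis (A : {set V}) : A \subset X -> [disjoint ~: X & A] by move=> AX; rewrite disjoint_sym disjoints_subset setCK.
  rewrite /Cubic.d cE cE' !eUr ?dis ?subsetDl // e0 (eC G _ Y) e0 !addn0.
  by rewrite (eID G Y X) (setIidPr YX).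
lia.
Qed.

Lemma quad_free_pole : (forall c, gcycle G 8 c -> ~~ all [in X] c) -> quad_free pole_blocks.
Proof.
move=> no; move=> _ _ _ _ x1 x2 x3 x4 /imsetP[b1 bX1 ->] /imsetP[b2 bX2 ->] /imsetP[b3 bX3 ->] /imsetP[b4 bX4 ->].
move=> ub ux; rewrite !inE => h1 h2 h3 h4 h5 h6 h7 h8.
have ub' : uniq [:: b1; b2; b3; b4] by apply: (@map_uniq _ _ nb).
have xs x b : b \in sd X (~~ s) -> adj b x -> si x = s by apply: nb_side.
have bs b : b \in sd X (~~ s) -> si b = ~~ s by rewrite in_sd => /andP[_ /eqP].
have bb := ub'; rewrite /= !inE !negb_or -!andbA in bb; case/and5P: bb => b12 b13 b14 b23 /andP[b24 /andP[b34 _]].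
have iX b : b \in sd X (~~ s) -> b \in X by apply/subsetP/sd_sub.
have xX1 : x1 \in X by apply: (two_blocks_inside bX1 bX4 b14).
have xX2 : x2 \in X by apply: (two_blocks_inside bX1 bX2 b12).
have xX3 : x3 \in X by apply: (two_blocks_inside bX2 bX3 b23).
have xX4 : x4 \in X by apply: (two_blocks_inside bX3 bX4 b34).
suff gc : gcycle G 8 [:: x1; b1; x2; b2; x3; b3; x4; b4].
  by have /negP := no _ gc; apply; rewrite /= xX1 xX2 xX3 xX4 !iX.
have xb x b b' : b \in sd X (~~ s) -> b' \in sd X (~~ s) -> adj b x -> x != b'.
  move=> bX bX' a; apply/eqP => xE; have := xs _ _ bX a; rewrite xE (bs _ bX'); by case: (s).
have bx x b b' : b \in sd X (~~ s) -> b' \in sd X (~~ s) -> adj b x -> b' != x.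
  by move=> *; rewrite eq_sym; apply: (xb _ b).
move: ux; rewrite /= !inE !negb_or -!andbA => /and5P[x12 x13 x14 x23 /andP[x24 /andP[x34 _]]].
rewrite /gcycle /= !inE !negb_or !andbT b12 b13 b14 b23 b24 b34 x12 x13 x14 x23 x24 x34.
rewrite (adjC _ x1) h1 h2 (adjC _ x2) h3 h4 (adjC _ x3) h5 h6 (adjC _ x4) h7 h8 /= !andbT.
by rewrite !(xb x1 b1) // !(xb x2 b1) // !(xb x3 b2) // !(xb x4 b3) // !(bx x2 b1) // !(bx x3 b2) // !(bx x4 b3).
Qed.

End Pole.

Section PoleCycles.
Variables (V : finType) (G : bicubic V) (v : V).
Notation mu := (mu G).
Notation si := (si G).
Notation adj := (adj G).
Notation e := (e G).
Notation d := (d G).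
Notation sd := (sd G).
Notation out := (out G).
Notation nb := (nb G).
Implicit Types (X Y P C : {set V}) (x y z : V) (s : bool).
Hypothesis H : brace G v.

Lemma cycle8_or_none X : (exists2 c, gcycle G 8 c & forall x, x \in c -> x \in X) \/
  (forall c, gcycle G 8 c -> ~~ all [in X] c).
Proof.
case: (pickP (fun t : 8.-tuple V => gcycle G 8 t && all [in X] t)) => [t /andP[gc /allP h]|h].
  by left; exists t.
right=> c gc; have sc : size c == 8 by case/and3P: gc.
by have := h (Tuple sc); rewrite /= gc => /= ->.
Qed.

Lemma e_seq4 b1 b2 b3 b4 Y : uniq [:: b1; b2; b3; b4] ->
  e Y [set x in [:: b1; b2; b3; b4]] = e Y [set b1] + e Y [set b2] + e Y [set b3] + e Y [set b4].
Proof.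
move=> ub; rewrite eC /e (eq_bigl (fun y => y \in [:: b1; b2; b3; b4])); last by move=> y; rewrite inE.
by rewrite -big_uniq //= !big_cons big_nil addn0 !addnA -!/(e _ _) !(eC G Y) /e !big_set1.
Qed.

(** The four edges from the lobe to the cycle end in [b1] to [b4], and each of these has room for
    only one, so each has exactly one foot in the lobe. Consecutive feet differ by [consecutive],
    but opposite ones may coincide. *)
Lemma lobe_feet s c X a1 b1 a2 b2 a3 b3 a4 b4 :
  gcycle G 8 c -> v \notin c -> lobe G s [set x in c] X -> v \notin X ->
  gcycle G 8 [:: a1; b1; a2; b2; a3; b3; a4; b4] -> c =i [:: a1; b1; a2; b2; a3; b3; a4; b4] ->
  [/\ si a1 = s, si a2 = s, si a3 = s & si a4 = s] ->
  [/\ si b1 = ~~ s, si b2 = ~~ s, si b3 = ~~ s & si b4 = ~~ s] ->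
  exists y1 y2 y3 y4, [/\ [/\ y1 \in sd X s, y2 \in sd X s, y3 \in sd X s & y4 \in sd X s],
    forall x, x \in sd X s -> [/\ mu x b1 = (x == y1), mu x b2 = (x == y2), mu x b3 = (x == y3) & mu x b4 = (x == y4)] &
    [/\ y1 != y2, y2 != y3, y3 != y4 & y1 != y4]].
Proof.
move=> gc vc hX vX gc' cE A B; have [os os' d5] := lobe5 H gc vc hX vX.
have [dXC cX e0] := hX; have [oE _] := lobe_out gc hX.
have sdX x t : x \in sd X t -> x \in X by apply/subsetP/sd_sub.
have CE : [set y in c] = [set y in [:: a1; b1; a2; b2; a3; b3; a4; b4]].
  by apply/setP => y; rewrite !inE cE !inE.
have ub : uniq [:: b1; b2; b3; b4] by case/and3P: gc' => _ /uniq_evens.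
have eC4 : e (sd X s) [set x in c] = e (sd X s) [set x in [:: b1; b2; b3; b4]].
  by rewrite e_sd CE (sd_cycle A B).
have e4 Y := e_seq4 Y ub.
have bc b : b \in [:: b1; b2; b3; b4] -> b \in c.
  by rewrite cE !inE => /or4P[] /eqP->; rewrite eqxx ?orbT.
have ble b : b \in [:: b1; b2; b3; b4] -> e (sd X s) [set b] <= 1.
  move=> /bc bc'; have := gcycle_in gc isT bc'; have := e_split G [set b] [set x in c]; rewrite cards1.
  have : e [set b] (sd X s) <= e [set b] (~: [set x in c]).
    by apply: eS => //; apply/subsetP => x /sdX xX; rewrite inE (disjointFr dXC xX).
  by rewrite eC; clear; lia.
have be b : b \in [:: b1; b2; b3; b4] -> e (sd X s) [set b] = 1.
  have := ble b1; have := ble b2; have := ble b3; have := ble b4; rewrite !inE !eqxx !orbT.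
  move=> /(_ isT) l4 /(_ isT) l3 /(_ isT) l2 /(_ isT) l1.
  have sum4 : e (sd X s) [set b1] + e (sd X s) [set b2] + e (sd X s) [set b3] + e (sd X s) [set b4] = 4.
    by rewrite -e4 -eC4 -oE.
  by case/or4P => /eqP->; move: l1 l2 l3 l4 sum4; clear; lia.
have yex b : b \in [:: b1; b2; b3; b4] -> exists y, y \in sd X s /\ forall x, x \in sd X s -> mu x b = (x == y).
  move=> bb; have := be b bb => eb.
  have [y [z [yX]]] : exists y z, [/\ y \in sd X s, z \in [set b] & adj y z] by apply: e_gt0P; rewrite eb.
  rewrite inE => /eqP-> a; exists y; split=> // x xX.
  case: (eqVneq x y) => [->|xy]; first by rewrite (muE H) a.
  move: eb; rewrite (eID G [set y]); have -> : sd X s :&: [set y] = [set y] by apply/setIidPr; rewrite sub1set.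
  rewrite e11 (muE H y b) a => -[] /eqP/e_eq0P/(_ x b).
  by rewrite !inE xy -in_sd xX eqxx => /(_ isT isT); rewrite (muE H) => /negPf->.
have [y1 [yX1 m1]] := yex b1 (mem_head _ _).
have [y2 [yX2 m2]] : exists y, y \in sd X s /\ forall x, x \in sd X s -> mu x b2 = (x == y) by apply: yex; rewrite !inE eqxx orbT.
have [y3 [yX3 m3]] : exists y, y \in sd X s /\ forall x, x \in sd X s -> mu x b3 = (x == y) by apply: yex; rewrite !inE eqxx !orbT.
have [y4 [yX4 m4]] : exists y, y \in sd X s /\ forall x, x \in sd X s -> mu x b4 = (x == y) by apply: yex; rewrite !inE eqxx !orbT.
have cons x : x \in sd X s -> [/\ ~~ ((x == y1) && (x == y2)), ~~ ((x == y2) && (x == y3)),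
    ~~ ((x == y3) && (x == y4)) & ~~ ((x == y4) && (x == y1))].
  move=> xs; have xX := sdX _ _ xs.
  have := @consecutive _ _ _ H a1 b1 a2 b2 a3 b3 a4 b4 x gc'; rewrite -!cE.
  have xc : x \notin c by have := disjointFr dXC xX; rewrite inE => ->.
  have xv : x != v by apply: contraNneq vX => <-.
  move=> /(_ vc xv xc); rewrite /adj !m1 // !m2 // !m3 // !m4 //.
  by do 4!case: (x == _).
have [n12 _ _ n41] := cons y1 yX1; have [_ n23 _ _] := cons y2 yX2; have [_ _ n34 _] := cons y3 yX3.
rewrite !eqxx /= ?andbT in n12 n41 n23 n34.
exists y1, y2, y3, y4; split=> // x xX; by rewrite m1 // m2 // m3 // m4.
Qed.

(* The points of a lobe [X], with the outer end [w] of its single edge not going to the cycle. *)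
Lemma five_pole_cycle s c X : gcycle G 8 c -> v \notin c -> lobe G s [set x in c] X ->
  v \notin X -> #|X| <= 23 -> #|X| != 3 ->
  exists2 c', gcycle G 8 c' & forall x, x \in c' -> x \in X.
Proof.
move=> gc vc hX vX X23 X3; have [os os' d5] := lobe5 H gc vc hX vX.
have [dXC cX e0] := hX; have [oE _] := lobe_out gc hX.
case: (cycle8_or_none X) => // no8.
have out1 w : w \notin X -> si w = s -> e [set w] X <= 1.
  move=> wX sw; rewrite -os'; have -> : [set w] = sd [set w] s.
    by apply/setP => x; rewrite in_sd inE; case: eqP => //= ->; rewrite sw eqxx.
  rewrite e_sd eC; apply: eS => //; apply/subsetP => x; rewrite in_sd !inE.
  by case/andP => /eqP->.
have d5' : d X <= 5 by rewrite d5.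
have LS := pole_linear_space H vX d5' out1.
have qf := quad_free_pole H vX d5' out1 no8.
have bd := pole_bdeg H vX d5' out1.
have sdX x t : x \in sd X t -> x \in X by apply/subsetP/sd_sub.
have [b0 [w [b0X wX a0]]] : exists b w, [/\ b \in sd X (~~ s), w \in ~: X & adj b w].
  by apply: e_gt0P; rewrite -/(Cubic.out G (~~ s) X) os'.
rewrite in_setC in wX.
have ptsE : pole_points G X s = w |: sd X s.
  apply/setP => x; rewrite in_setU1 in_sd inE; case: (eqVneq x w) => [->|xw] /=.
    apply/andP; split; first by rewrite (nb_side b0X a0) eqxx.
    by apply/orP; right; apply/exists_inP; exists b0.
  case xX: (x \in X); rewrite ?andbT //=; apply/negP => /andP[_ /exists_inP[b bX a]].
  have : 2 <= out (~~ s) X; last by rewrite os'.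
  rewrite /out eC; apply: (@leq_trans (e [set x] (sd X (~~ s)) + e [set w] (sd X (~~ s)))).
    have := e_gt0 (set11 x) bX (etrans (adjC G x b) a).
    by have := e_gt0 (set11 w) b0X (etrans (adjC G w b0) a0); clear; lia.
  rewrite -eU; last by rewrite disjoints1 inE.
  apply: eS => //; apply/subsetP => z; rewrite !inE => /orP[] /eqP->; by rewrite ?xX.
have bdw : bdeg (pole_blocks G X s) w = 1.
  rewrite bd; last by rewrite ptsE setU11.
  apply/eqP; rewrite eqn_leq out1 ?(nb_side b0X a0) //=.
  by apply: (e_gt0 (y := b0) (set11 w)); [apply: sdX b0X|rewrite adjC].
have [a1 [b1 [a2 [b2 [a3 [b3 [a4 [b4 [gc' cE A B]]]]]]]]] := gcycle8_side s gc vc.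
have CE : [set y in c] = [set y in [:: a1; b1; a2; b2; a3; b3; a4; b4]].
  by apply/setP => y; rewrite !inE cE !inE.
have ub : uniq [:: b1; b2; b3; b4] by case/and3P: gc' => _ /uniq_evens.
have e4 Y := e_seq4 Y ub.
have bc b : b \in [:: b1; b2; b3; b4] -> b \in c.
  by rewrite cE !inE => /or4P[] /eqP->; rewrite eqxx ?orbT.
have [y1 [y2 [y3 [y4 [[yX1 yX2 yX3 yX4] m [n12 n23 n34 n41]]]]]] := lobe_feet gc vc hX vX gc' cE A B.
have bdx x : x \in sd X s -> bdeg (pole_blocks G X s) x = 3 - ((x == y1) + (x == y2) + (x == y3) + (x == y4)).
  move=> xs; rewrite bd; last by rewrite ptsE inE xs orbT.
  have [<- <- <- <-] := m x xs; rewrite -!e11 -e4.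
  have -> : e [set x] [set x in [:: b1; b2; b3; b4]] = e [set x] (~: X).
    apply/eqP; rewrite eqn_leq; apply/andP; split.
      apply: eS => //; apply/subsetP => b; rewrite inE => /bc bC; rewrite inE.
      by have := disjointFl dXC (x := b); rewrite inE => /(_ bC) ->.
    rewrite (eIDr G [set y in c] (~: X)).
    have -> : e [set x] (~: X :\: [set y in c]) = 0.
      apply/eqP; rewrite -leqn0 -e0; apply: eS; first by rewrite sub1set.
      by rewrite setDE -setCU.
    rewrite addn0.
    have xE : [set x] = sd [set x] s.
      by apply/setP => z; rewrite in_sd inE; case: eqP => //= ->; move: xs; rewrite in_sd => /andP[_ ->].
    rewrite {1}xE e_sd -xE; apply: eS => //; rewrite -(sd_cycle A B) -CE.
    by apply/subsetP => z; rewrite !in_sd in_setI => /andP[/andP[_ ->]].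
  by have := e_split G [set x] X; rewrite cards1; clear; lia.
have wy y : y \in sd X s -> w != y by move=> /sdX; apply: contraTneq => <-.
(* Side [s] has one vertex more than the other, so at most 12 of the 23; the outer end [w] is the
   thirteenth point. *)
have szX : #|pole_points G X s| <= 13.
  by rewrite ptsE cardsU1 in_sd (negPf wX); have := card_sd G s X; move: cX X23; clear; lia.
have sz3 : #|pole_points G X s| != 3.
  by rewrite ptsE cardsU1 in_sd (negPf wX); apply/eqP; have := card_sd G s X; move: cX X3; clear; lia.
(* The list [l] consists of the outer end and the distinct feet; all other points have degree 3. *)
have run caps l : caps \in [:: [:: 1; 2; 2; 2; 2]; [:: 1; 1; 2; 2]; [:: 1; 1; 1]] ->
    size caps = size l -> uniq l -> {subset l <= w |: sd X s} ->
    (forall i, i < size caps -> bdeg (pole_blocks G X s) (nth w l i) = nth 3 caps i) ->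
    {subset [:: w; y1; y2; y3; y4] <= l} -> False.
  move=> cin sl ul lsub ldeg lsup.
  apply: (five_pole_not_quad_free LS szX sz3 cin (phi := nth w l) _ qf); apply: realizes_caps => //.
  - by move=> i; rewrite sl => il; rewrite ptsE; apply: lsub; apply: mem_nth.
  - by move=> i j; rewrite sl => il jl /eqP; rewrite nth_uniq // => /eqP.
  move=> x; rewrite ptsE => xp xl.
  have xnl : x \notin l.
    by apply/negP => /(nthP w)[i il xE]; have := xl i; rewrite sl il xE eqxx => /(_ isT).
  have ne y : y \in [:: w; y1; y2; y3; y4] -> x == y = false.
    by move=> /lsup yl; apply/negP => /eqP xE; rewrite xE yl in xnl.
  move: xp; rewrite !inE ne ?mem_head //= -in_sd => xs.
  by rewrite bdx // !ne // !inE eqxx ?orbT.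
have sub4 l : {subset l <= [:: w; y1; y2; y3; y4]} -> {subset l <= w |: sd X s}.
  move=> h x /h; rewrite !inE => /orP[->//|]; rewrite -in_sd.
  by case/or4P => /eqP->; rewrite ?yX1 ?yX2 ?yX3 ?yX4 orbT.
have fl (a b : V) : a != b -> ((a == b) = false) * ((b == a) = false).
  by move=> ab; rewrite (eq_sym b) (negPf ab).
exfalso; have wy1 := wy _ yX1; have wy2 := wy _ yX2; have wy3 := wy _ yX3; have wy4 := wy _ yX4.
(* A foot carrying two edges has degree 1 inside. The possible coincidences of opposite feet give
   the three degree lists. *)
case: (eqVneq y1 y3) => [e13|n13]; case: (eqVneq y2 y4) => [e24|n24].
- apply: (run [:: 1; 1; 1] [:: w; y1; y2]) => //.
  + by rewrite /= !inE negb_or wy1 wy2 n12.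
  + by apply: sub4 => x; rewrite !inE => /or3P[] /eqP->; rewrite eqxx ?orbT.
  + case=> [|[|[|]]] //= _; rewrite ?bdx // -?e13 -?e24 ?eqxx ?(fl _ _ n12) //.
  + by move=> x; rewrite !inE -e13 -e24; do 3!case: (x == _).
- apply: (run [:: 1; 1; 2; 2] [:: w; y1; y2; y4]) => //.
  + by rewrite /= !inE !negb_or wy1 wy2 wy4 n12 n41 n24.
  + by apply: sub4 => x; rewrite !inE => /or4P[] /eqP->; rewrite eqxx ?orbT.
  + case=> [|[|[|[|]]]] //= _; rewrite ?bdx // -?e13 ?eqxx ?(fl _ _ n12) ?(fl _ _ n41) ?(fl _ _ n24) //.
  + by move=> x; rewrite !inE -e13; do 4!case: (x == _).
- apply: (run [:: 1; 1; 2; 2] [:: w; y2; y1; y3]) => //.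
  + by rewrite /= !inE !negb_or wy1 wy2 wy3 n23 n13 eq_sym n12.
  + by apply: sub4 => x; rewrite !inE => /or4P[] /eqP->; rewrite eqxx ?orbT.
  + case=> [|[|[|[|]]]] //= _; rewrite ?bdx // -?e24 ?eqxx ?(fl _ _ n12) ?(fl _ _ n23) ?(fl _ _ n13) //.
  + by move=> x; rewrite !inE -e24; do 4!case: (x == _).
apply: (run [:: 1; 2; 2; 2; 2] [:: w; y1; y2; y3; y4]) => //.
- by rewrite /= !inE !negb_or wy1 wy2 wy3 wy4 n12 n13 n41 n23 n24 n34.
- exact: sub4.
case=> [|[|[|[|[|]]]]] //= _; rewrite ?bdx // ?eqxx ?(fl _ _ n12) ?(fl _ _ n13) ?(fl _ _ n41)
  ?(fl _ _ n23) ?(fl _ _ n24) ?(fl _ _ n34) //.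
Qed.

End PoleCycles.

(** * Finding an 8-cycle and shrinking a lobe to three vertices *)

Section Descent.
Variables (V : finType) (G : bicubic V) (v : V).
Notation mu := (mu G).
Notation si := (si G).
Notation adj := (adj G).
Notation e := (e G).
Notation d := (d G).
Notation sd := (sd G).
Notation out := (out G).
Notation nb := (nb G).
Implicit Types (X Y P C : {set V}) (x y z : V) (s : bool).

Lemma balanced : #|sd setT true| = #|sd setT false|.
Proof.
have := cutE G true setT; have := cutE G false setT; rewrite /out setCT.
have e0 X : e X set0 = 0 by apply/eqP/e_eq0P => x y; rewrite inE.
rewrite !e0; clear; lia.
Qed.

Lemma card_side s : #|V| = 2 * #|sd setT s|.
Proof.
rewrite -cardsT (card_sd G s); have := balanced; case: s => /=; clear; lia.
Qed.

Hypothesis H : brace G v.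

Lemma nbP x : exists y1 y2 y3, uniq [:: y1; y2; y3] /\ nb x = [set z in [:: y1; y2; y3]].
Proof.
have := card_nb H x; rewrite cardE; case E: (enum (nb x)) => [|y1 [|y2 [|y3 [|]]]] // _.
exists y1, y2, y3; rewrite -E enum_uniq; split=> //.
by apply/setP => z; rewrite [RHS]inE mem_enum.
Qed.

(** Deleting [v] leaves its three neighbours with degree 2 and the other vertices of their side with
    degree 3. That side has at most 16 vertices, so [search_pole3] applies. *)
Lemma three_pole_cycle : #|V| <= 32 -> exists2 c, gcycle G 8 c & v \notin c.
Proof.
move=> V32; pose X := ~: [set v].
have vX : v \notin X by rewrite !inE eqxx.
have d5 : d X <= 5 by rewrite dC d1.
pose s := ~~ si v.
have out1 w : w \notin X -> si w = s -> e [set w] X <= 1.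
  by rewrite !inE negbK => /eqP->; rewrite /s; case: (si v).
case: (cycle8_or_none G X) => [[c gc cX]|no8].
  by exists c => //; apply: contra vX => /cX.
have LS := pole_linear_space H vX d5 out1.
have qf := quad_free_pole H vX d5 out1 no8.
have bd := pole_bdeg H vX d5 out1.
have ptsE : pole_points G X s = sd setT s.
  apply/setP => x; rewrite !inE; case: (eqVneq (si x) s) => //= sx; apply/orP; left.
  by apply: contra_eqN sx => /eqP->; rewrite /s; case: (si v).
have [y1 [y2 [y3 [uy nbE]]]] := nbP v.
have ya y : y \in [:: y1; y2; y3] -> adj v y.
  by move=> yl; have : y \in nb v by [rewrite nbE inE]; rewrite inE.
have eX x : e [set x] X = 3 - adj x v.
  have := e_split G [set x] [set v]; rewrite e11 (muE H) cards1 -/X; case: (adj x v); clear; lia.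
exfalso; apply: (three_pole_not_quad_free LS (phi := nth v [:: y1; y2; y3]) _ _ _ _ _ qf).
- rewrite ptsE; have := card_side s; move: V32; clear; lia.
- move=> i il; rewrite ptsE in_sd inE /=; have /ya/adj_si-> : nth v [:: y1; y2; y3] i \in [:: y1; y2; y3].
    exact: mem_nth.
  by rewrite /s eqxx.
- by move=> i j il jl /eqP; rewrite nth_uniq // => /eqP.
- move=> i il; have yl : nth v [:: y1; y2; y3] i \in [:: y1; y2; y3] by apply: mem_nth.
  rewrite bd; first by rewrite eX adjC ya.
  by rewrite ptsE in_sd inE /= (adj_si (ya _ yl)) /s eqxx.
move=> x xp xl; rewrite bd // eX; case: (boolP (adj x v)) => // a.
have : x \in [:: y1; y2; y3].
  have : x \in nb v by rewrite inE adjC.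
  by rewrite nbE inE.
case/(nthP v) => i il xE; have := xl i il; by rewrite xE eqxx.
Qed.

(** A lobe whose size is not 3 contains an 8-cycle. By uncrossing, a lobe of that cycle lies inside
    it, and is smaller because it misses the cycle. *)
Lemma small_lobe s c X : gcycle G 8 c -> v \notin c -> lobe G s [set x in c] X ->
  v \notin X -> #|X| <= 23 ->
  exists s c X, [/\ gcycle G 8 c, v \notin c, lobe G s [set x in c] X, v \notin X & #|X| = 3].
Proof.
have [m] := ubnP #|X|; elim: m => // m IH in s c X * => Xm gc vc hX vX X23.
case: (eqVneq #|X| 3) => [X3|X3]; first by exists s, c, X.
have [c' gc' c'X] := five_pole_cycle H gc vc hX vX X23 X3.
have [s' [P [hP PX]]] := uncross H gc vc hX vX gc' c'X.
have vc' : v \notin c' by apply: contra vX => /c'X.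
have vP : v \notin P by apply: contra vX => /(subsetP PX).
have Pl : #|P| < #|X|.
  apply: proper_card; apply/properP; split=> //.
  have [a1 [b1 [a2 [b2 [a3 [b3 [a4 [b4 [cE _ _ _]]]]]]]]] := gcycle8P gc'.
  have a1c : a1 \in c' by rewrite cE mem_head.
  exists a1; first exact: c'X.
  by have [dPC _ _] := hP; have := disjointFl dPC (x := a1); rewrite inE => ->.
apply: (IH s' c' P) => //; move: Pl Xm X23; clear; lia.
Qed.

End Descent.

(** * Recognizing the Heawood graph *)

(** The set 0, 1, 3 is a perfect difference set modulo 7. Using sums instead of differences makes
    the relation symmetric. *)
Definition fano (i j : nat) : bool := (i + j) %% 7 \in [:: 0; 1; 3].

Record heawood (V : finType) (G : bicubic V) (s : bool) (p q : nat -> V) : Prop := Heawood {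
  hw_p : forall i, i < 7 -> si G (p i) = s;
  hw_q : forall j, j < 7 -> si G (q j) = ~~ s;
  hw_mu : forall i j, i < 7 -> j < 7 -> mu G (p i) (q j) = fano i j;
  hw_all : forall x, exists2 i, i < 7 & x = p i \/ x = q i }.

Section Core.
Variables (V : finType) (G : bicubic V) (v : V).
Notation mu := (mu G).
Notation si := (si G).
Notation adj := (adj G).
Notation e := (e G).
Notation d := (d G).
Notation sd := (sd G).
Notation out := (out G).
Notation nb := (nb G).
Implicit Types (X Y P C : {set V}) (x y z : V) (s : bool).
Hypothesis H : brace G v.

(** It is enough to exhibit the 21 edges, since the three prescribed neighbours of a vertex exhaust
    its degree. *)
Lemma heawood_intro s (la lb : seq V) : size la = 7 -> size lb = 7 -> uniq lb ->
  (forall x, x \in la -> si x = s) -> (forall x, x \in lb -> si x = ~~ s) ->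
  (forall x, x \in la ++ lb) ->
  (forall i j, i < 7 -> j < 7 -> fano i j -> adj (nth v la i) (nth v lb j)) ->
  heawood G s (nth v la) (nth v lb).
Proof.
move=> sa sb ub ha hb hall had; split.
- by move=> i i7; apply: ha; rewrite mem_nth ?sa.
- by move=> i i7; apply: hb; rewrite mem_nth ?sb.
- move=> i j i7 j7; rewrite (muE H); congr nat_of_bool; apply/idP/idP => [a|]; last exact: had.
  pose js := [seq j <- iota 0 7 | fano i j].
  have [j1 [j2 [j3 [E [l1 l2 l3] [f1 f2 f3] [n1 n2 n3]]]]] : exists j1 j2 j3, [/\ js = [:: j1; j2; j3],
      [/\ j1 < 7, j2 < 7 & j3 < 7], [/\ fano i j1, fano i j2 & fano i j3] & [/\ j1 != j2, j1 != j3 & j2 != j3]].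
    rewrite /js; do 7?[case: i i7 a @js => [|i] i7 a js; [by do 3!eexists; split|]] => //.
  have := nbr3 (G := G) (x := nth v la i) (y1 := nth v lb j1) (y2 := nth v lb j2) (y3 := nth v lb j3) _ _ _ _ a.
  rewrite !had //= !inE !negb_or !nth_uniq ?sb // n1 n2 n3 => /(_ isT isT isT isT).
  by case/or3P => /eqP->.
- move=> x; have := hall x; rewrite mem_cat => /orP[] /(nthP v)[i il <-]; exists i; rewrite -?sa -?sb //; auto.
  by rewrite sa -sb.
Qed.

Lemma e_seq (l : seq V) Y : uniq l -> e [set x in l] Y = \sum_(x <- l) e [set x] Y.
Proof.
move=> ul; rewrite big_uniq //= /e (eq_bigl (fun y => y \in l)); last by move=> y; rewrite inE.
by apply: eq_bigr => x _; rewrite big_set1.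
Qed.

Lemma card_sd_seq (l : seq V) s : uniq l ->
  #|sd [set x in l] s| = count (fun x => si x == s) l.
Proof.
move=> ul; rewrite -size_filter -(card_uniqP (filter_uniq _ ul)); apply: eq_card => x.
by rewrite !inE mem_filter andbC.
Qed.

Lemma e_closed0 (l : seq V) x : (forall y, adj x y -> y \in l) -> e [set x] (~: [set y in l]) = 0.
Proof.
move=> h; apply/eqP/e_eq0P => z y; rewrite !inE => /eqP->; apply: contra; exact: h.
Qed.

Lemma e_two_le1 (l : seq V) x y z : y \in l -> z \in l -> y != z -> adj x y -> adj x z ->
  e [set x] (~: [set y in l]) <= 1.
Proof.
move=> yl zl yz ay az.
have : 2 <= e [set x] [set w in l].
  apply: (@leq_trans (e [set x] [set y; z])).
    apply: leq_trans (e1_ge _); first by rewrite cards2 yz.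
    by move=> w; rewrite !inE => /orP[] /eqP->.
  by apply: eS => //; apply/subsetP => w; rewrite !inE => /orP[] /eqP->.
have := e_split G [set x] [set w in l]; rewrite cards1; clear; lia.
Qed.

Lemma pm_pairs (l : seq (V * V)) : uniq (flatten [seq [:: p.1; p.2] | p <- l]) ->
  all (fun p => adj p.1 p.2) l -> pm G [set x in flatten [seq [:: p.1; p.2] | p <- l]].
Proof.
elim: l => [|[x y] l IH] /=; first by exists id => z; rewrite inE.
rewrite !inE negb_or -!andbA => /and4P[xy xl yl ul] /andP[a al].
have -> : [set z in [:: x, y & flatten [seq [:: p.1; p.2] | p <- l]]] =
  [set x; y] :|: [set z in flatten [seq [:: p.1; p.2] | p <- l]].
  by apply/setP => z; rewrite !inE orbA.
apply: pmU; [|exact: pm2|exact: IH].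
apply/pred0P => z /=; rewrite !inE; apply/negP => /andP[/orP[] /eqP->]; by rewrite ?(negPf xl) ?(negPf yl).
Qed.

Lemma cycle_rest (c r : seq V) : uniq (c ++ r) -> (forall x, x \in c ++ r) ->
  ~: [set x in c] = [set x in r].
Proof.
rewrite cat_uniq => /and3P[_ /hasPn h _] m; apply/setP => x; rewrite !inE.
have := m x; have := h x; rewrite mem_cat /=; by case: (x \in r); case: (x \in c) => //= /(_ isT).
Qed.

Lemma nb_full x y1 y2 y3 : (forall y, adj x y -> y \in [:: y1; y2; y3]) ->
  [/\ adj x y1, adj x y2 & adj x y3].
Proof.
move=> h; have sub : nb x \subset [set y in [:: y1; y2; y3]] by apply/subsetP => y; rewrite !inE => /h; rewrite !inE.
have c3 : #|[set y in [:: y1; y2; y3]]| <= 3 by rewrite cardsE; apply: card_size.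
have : nb x == [set y in [:: y1; y2; y3]] by rewrite eqEcard sub (card_nb H) c3.
move/eqP/setP => E; have := E y1; have := E y2; have := E y3; rewrite !inE !eqxx ?orbT => -> -> ->.
by [].
Qed.

(* An 8-cycle [a1 b1 ... a4 b4] together with the smallest lobe [s1 t s2]. *)
Definition wheel (a1 b1 a2 b2 a3 b3 a4 b4 s1 s2 t : V) : Prop :=
  [/\ uniq [:: a1; b1; a2; b2; a3; b3; a4; b4; s1; s2; t],
      v \notin [:: a1; b1; a2; b2; a3; b3; a4; b4; s1; s2; t],
      [/\ adj a1 b1, adj b1 a2, adj a2 b2 & adj b2 a3],
      [/\ adj a3 b3, adj b3 a4, adj a4 b4 & adj b4 a1] &
      [/\ [/\ adj s1 b1, adj s1 b3, adj s2 b2 & adj s2 b4], adj t s1 & adj t s2]].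

(** Turning the cycle by one step exchanges [s1] and [s2], so that statements about [a1] carry over
    to [a2], [a3] and [a4]. *)
Lemma wheel_rot (a1 b1 a2 b2 a3 b3 a4 b4 s1 s2 t : V) : wheel a1 b1 a2 b2 a3 b3 a4 b4 s1 s2 t ->
  wheel a2 b2 a3 b3 a4 b4 a1 b1 s2 s1 t.
Proof.
have pe : perm_eq [:: a1; b1; a2; b2; a3; b3; a4; b4; s1; s2; t] [:: a2; b2; a3; b3; a4; b4; a1; b1; s2; s1; t].
  rewrite -[X in perm_eq X]/([:: a1; b1] ++ [:: a2; b2; a3; b3; a4; b4; s1; s2; t]) perm_sym.
  rewrite -[X in perm_eq X]/(([:: a2; b2; a3; b3; a4; b4] ++ [:: a1; b1]) ++ [:: s2; s1; t]).
  rewrite -[X in perm_eq _ X]/([:: a1; b1] ++ [:: a2; b2; a3; b3; a4; b4] ++ [:: s1; s2; t]) catA.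
  apply: perm_cat; first by rewrite perm_catC.
  by rewrite -[X in perm_eq X]/([:: s2] ++ [:: s1] ++ [:: t]) perm_catCA.
case=> u vn [h1 h2 h3 h4] [h5 h6 h7 h8] [[g1 g2 g3 g4] k1 k2]; split; rewrite -?(perm_uniq pe) -?(perm_mem pe) //.
Qed.

Section Wheel.
Variables (a1 b1 a2 b2 a3 b3 a4 b4 s1 s2 t : V).
Hypothesis D : wheel a1 b1 a2 b2 a3 b3 a4 b4 s1 s2 t.
Let L := [:: a1; b1; a2; b2; a3; b3; a4; b4; s1; s2; t].

Lemma wheel_side : [/\ si a2 = si a1, si a3 = si a1, si a4 = si a1, si s1 = si a1 & si s2 = si a1] /\
  [/\ si b1 = ~~ si a1, si b2 = ~~ si a1, si b3 = ~~ si a1, si b4 = ~~ si a1 & si t = ~~ si a1].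
Proof.
have [_ _ [h1 h2 h3 h4] [h5 h6 h7 h8] [[g1 g2 g3 g4] k1 k2]] := D.
rewrite adjC in k1; rewrite adjC in g1; rewrite adjC in g3.
by rewrite (adj_si k1) (adj_si g3) (adj_si g1) (adj_si h7) (adj_si h6) (adj_si h5) (adj_si h4) (adj_si h3) (adj_si h2) (adj_si h1) !negbK.
Qed.

Lemma wheel_uniq idx : uniq idx -> all (gtn 11) idx -> uniq [seq nth v L i | i <- idx].
Proof.
move=> ui /allP hi; have [uL _ _ _ _] := D.
rewrite map_inj_in_uniq // => i j /hi il /hi jl /eqP.
by rewrite (nth_uniq v _ _ uL) // => /eqP.
Qed.

Lemma wheel_mem idx x : {subset iota 0 11 <= idx} -> x \in L -> x \in [seq nth v L i | i <- idx].
Proof.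
move=> h xL; have i11 : index x L < 11 by rewrite -[11]/(size L) index_mem.
by rewrite -(nth_index v xL); apply: map_f; apply: h; rewrite mem_iota.
Qed.

Lemma wheel_nb y :
  [/\ adj b1 y -> y \in [:: a1; a2; s1], adj b2 y -> y \in [:: a2; a3; s2],
      adj b3 y -> y \in [:: a3; a4; s1], adj b4 y -> y \in [:: a4; a1; s2] &
      (adj s1 y -> y \in [:: b1; b3; t]) /\ (adj s2 y -> y \in [:: b2; b4; t])].
Proof.
have [_ _ [h1 h2 h3 h4] [h5 h6 h7 h8] [[g1 g2 g3 g4] k1 k2]] := D.
split; last split; apply: nbr3; rewrite // 1?adjC //.
- exact: (@wheel_uniq [:: 0; 2; 8]).
- exact: (@wheel_uniq [:: 2; 4; 9]).
- exact: (@wheel_uniq [:: 4; 6; 8]).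
- exact: (@wheel_uniq [:: 6; 0; 9]).
- exact: (@wheel_uniq [:: 1; 5; 10]).
- exact: (@wheel_uniq [:: 3; 7; 10]).
Qed.

Lemma wheel_closed x y : x \in [:: b1; b2; b3; b4; s1; s2] -> adj x y -> y \in L.
Proof.
have [n1 n2 n3 n4 [n5 n6]] := wheel_nb y.
have sub l : {subset l <= L} -> y \in l -> y \in L by move=> h; apply: h.
rewrite !inE => /or4P[|||/or3P[]] /eqP->; [move/n1|move/n2|move/n3|move/n4|move/n5|move/n6];
  by rewrite !inE => /or3P[] /eqP->; rewrite eqxx ?orbT.
Qed.

Lemma wheel_a : [/\ e [set a1] (~: [set x in L]) <= 1, e [set a2] (~: [set x in L]) <= 1,
   e [set a3] (~: [set x in L]) <= 1 & e [set a4] (~: [set x in L]) <= 1].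
Proof.
have [_ _ [h1 h2 h3 h4] [h5 h6 h7 h8] _] := D.
have ne i j : i < 11 -> j < 11 -> i != j -> nth v L i != nth v L j.
  by move=> il jl ij; have [uL _ _ _ _] := D; rewrite (nth_uniq v _ _ uL).
split; [apply: (@e_two_le1 _ _ b4 b1)|apply: (@e_two_le1 _ _ b1 b2)|apply: (@e_two_le1 _ _ b2 b3)|apply: (@e_two_le1 _ _ b3 b4)];
 rewrite ?inE ?eqxx ?orbT // 1?adjC //.
- exact: (ne 7 1).
- exact: (ne 1 3).
- exact: (ne 3 5).
- exact: (ne 5 7).
Qed.

(** A second 8-cycle, through both [s1] and [s2]; of the eleven vertices it leaves out [a1], [a3]
    and [t]. *)
Let c2 := [:: s1; b3; a4; b4; s2; b2; a2; b1].

Lemma wheel_c2 : gcycle G 8 c2 /\ v \notin c2.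
Proof.
have [_ vL [h1 h2 h3 h4] [h5 h6 h7 h8] [[g1 g2 g3 g4] k1 k2]] := D; split.
  apply/and3P; split=> //; first exact: (@wheel_uniq [:: 8; 5; 6; 7; 9; 3; 2; 1]).
  by rewrite /= (adjC G b4 s2) (adjC G b2 a2) (adjC G a2 b1) (adjC G b1 s1) g1 g2 g3 g4 h2 h3 h6 h7.
apply: contra vL; rewrite !inE => h.
by case/or4P: h => [|||/or4P[|||/orP[]]] /eqP->; rewrite eqxx ?orbT.
Qed.

(** Then at most three edges leave the eleven vertices, so by parity exactly one vertex [q] is
    missing, and it is adjacent to [a2], [a3] and [a4]. The edges [a1 t] and [a3 q] match the
    complement of [c2], which is impossible in a brace. *)
Lemma wheel_foot_on_cycle : adj t a1 -> False.
Proof.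
move=> ta1; have [uL vL [h1 h2 h3 h4] [h5 h6 h7 h8] [[g1 g2 g3 g4] k1 k2]] := D.
have nt y : adj t y -> y \in [:: s1; s2; a1].
  by apply: nbr3 => //; apply: (@wheel_uniq [:: 8; 9; 0]).
have na1 y : adj a1 y -> y \in [:: b4; b1; t].
  by apply: nbr3; rewrite // 1?adjC //; apply: (@wheel_uniq [:: 7; 1; 10]).
pose Q := ~: [set x in L].
have clo x y : x \in [:: b1; b2; b3; b4; s1; s2; t; a1] -> adj x y -> y \in L.
  rewrite -[X in x \in X]/([:: b1; b2; b3; b4; s1; s2] ++ [:: t; a1]) mem_cat => /orP[/wheel_closed|]; first exact.
  rewrite !inE => /orP[] /eqP->; [move/nt|move/na1];
    by rewrite !inE => /or3P[] /eqP->; rewrite eqxx ?orbT.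
have z x : x \in [:: b1; b2; b3; b4; s1; s2; t; a1] -> e [set x] Q = 0.
  by move=> xl; apply: e_closed0 => y; apply: clo.
have dQ : d Q <= 3.
  have -> : d Q = e [set x in L] Q by rewrite /Q dC.
  rewrite e_seq // !big_cons big_nil (z a1) ?(z b1) ?(z b2) ?(z b3) ?(z b4) ?(z s1) ?(z s2) ?(z t) ?inE ?eqxx ?orbT //.
  have [_ l2 l3 l4] := wheel_a; move: l2 l3 l4; rewrite -/Q; clear; lia.
have cL : #|[set x in L]| = 11 by rewrite cardsE (card_uniqP uL).
have cQ : #|[set x in L]| + #|Q| = #|V| by rewrite cardsC.
have V2 := card_side G true; rewrite cL in cQ.
have Q1 : #|Q| <= 1.
  rewrite leqNgt; apply/negP => Q1; have : 3 < d Q; last by rewrite ltnNge dQ.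
  by apply: (br_cut H) => //; rewrite setCK cL.
have /cards1P[q QE] : #|Q| == 1 by apply/eqP; move: Q1 V2 cQ; clear; lia.
have qL : q \notin L by have : q \in Q; [rewrite QE set11|rewrite !inE].
have Lq x : x \in L \/ x = q.
  case: (boolP (x \in L)) => xL; [by left|right]; apply/eqP.
  by have : x \in Q; [rewrite !inE in xL *|rewrite QE inE].
have nq y : adj q y -> y \in [:: a2; a3; a4].
  move=> a; have yq : y <> q by move=> yq; move: a; rewrite yq /adj mu_si.
  have bad : y \notin [:: b1; b2; b3; b4; s1; s2; t; a1].
    by apply: contra qL => yl; apply: (clo y) => //; rewrite adjC.
  case: (Lq y) => [|//] yL; move: bad; apply: contraR => yn.
  move: yL yn; rewrite !inE; do 11!case: (y == _) => //=.
have [_ qa3 _] := nb_full nq.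
have [gc vc] := wheel_c2; apply: (br_no8 H gc vc).
have uall : uniq (c2 ++ [:: a1; t; a3; q]).
  rewrite -[c2 ++ _]/(rcons [seq nth v L i | i <- [:: 8; 5; 6; 7; 9; 3; 2; 1; 0; 10; 4]] q).
  rewrite rcons_uniq wheel_uniq // andbT; apply: contra qL => /mapP[i].
  by move=> il ->; apply: mem_nth; move: il; rewrite !inE; do 11?[case/orP => [/eqP->//|]] => /eqP->.
have mall x : x \in c2 ++ [:: a1; t; a3; q].
  rewrite -[c2 ++ _]/(rcons [seq nth v L i | i <- [:: 8; 5; 6; 7; 9; 3; 2; 1; 0; 10; 4]] q).
  rewrite mem_rcons in_cons; case: (Lq x) => [xL|->]; last by rewrite eqxx.
  by rewrite wheel_mem ?orbT // => i; rewrite mem_iota; move: i; do 11?[case=> //].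
rewrite (cycle_rest uall mall); apply: (@pm_pairs [:: (a1, t); (a3, q)]).
  by move: uall; rewrite cat_uniq => /and3P[].
by rewrite /= adjC ta1 adjC qa3.
Qed.

Lemma wheel_mem_side x : x \in L -> si x = ~~ si a1 -> x \in [:: b1; b2; b3; b4; t].
Proof.
have [[S2 S3 S4 S5 S6] _] := wheel_side.
rewrite !inE; do 11?[case: eqP => [->|_] /=]; rewrite ?orbT // ?S2 ?S3 ?S4 ?S5 ?S6; by case: (si a1).
Qed.

(** Otherwise the complement of [c2] is matched by [a1 z1], [a3 z3], [t u] and a matching of the
    remaining set [W]. In the whole graph each set [S] to be matched has two neighbours to spare,
    since nontrivial cuts have at least four edges, so the loss of [z1] and [z3] does no harm. *)
Lemma wheel_pair u z1 z3 : u \notin L -> z1 \notin L -> z3 \notin L ->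
  adj t u -> adj a1 z1 -> adj a3 z3 -> z1 = z3.
Proof.
move=> uL zL1 zL3 tu az1 az3; apply/eqP/negPn/negP => z13.
have [uniqL vL [h1 h2 h3 h4] [h5 h6 h7 h8] [[g1 g2 g3 g4] k1 k2]] := D.
have [[S2 S3 S4 S5 S6] [B1 B2 B3 B4 B5]] := wheel_side.
have neL x y : x \in L -> y \notin L -> x != y by move=> xL; apply: contraNneq => <-.
have su : si u = si a1 by rewrite (adj_si tu) B5 negbK.
have sz1 : si z1 = ~~ si a1 by rewrite (adj_si az1).
have sz3 : si z3 = ~~ si a1 by rewrite (adj_si az3) S3.
have uz z : si z = ~~ si a1 -> u != z.
  by move=> sz; apply/eqP => uz; move: su; rewrite uz sz; case: (si a1).
have nt y : adj t y -> y \in [:: s1; s2; u].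
  apply: nbr3 => //; have ss : s1 != s2 by have := @wheel_uniq [:: 8; 9] isT isT; rewrite /= inE andbT.
  by rewrite /= !inE negb_or ss !neL // !inE eqxx ?orbT.
pose L14 := L ++ [:: u; z1; z3].
have uL14 : uniq L14.
  rewrite cat_uniq uniqL; apply/and3P; split=> //; last by rewrite /= !inE negb_or z13 !uz.
  by apply/hasPn => x; rewrite !in_cons in_nil orbF => /or3P[] /eqP->.
pose W := ~: [set x in L14].
have WL x : x \in W -> x \notin L /\ x \notin [:: u; z1; z3].
  by rewrite !in_set mem_cat negb_or => /andP[].
have Wout x y : x \in sd W (si a1) -> adj x y -> y \notin L /\ si y = ~~ si a1.
  rewrite in_sd => /andP[/WL[xL xu] /eqP sx] a; have sy : si y = ~~ si a1 by rewrite (adj_si a) sx.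
  split=> //; apply/negP => yL; have := wheel_mem_side yL sy.
  rewrite -[X in y \in X]/([:: b1; b2; b3; b4] ++ [:: t]) mem_cat => /orP[yb|].
    case/negP: xL; apply: (@wheel_closed y); last by rewrite adjC.
    by move: yb; rewrite !inE => /or4P[] /eqP->; rewrite eqxx ?orbT.
  rewrite inE => /eqP yt; move: a; rewrite yt adjC => /nt; rewrite !inE => /or3P[] /eqP xE.
  - by rewrite xE !inE eqxx !orbT in xL.
  - by rewrite xE !inE eqxx !orbT in xL.
  - by rewrite xE !inE eqxx in xu.
have bal s : #|sd [set x in L14] s| + #|sd W s| = #|sd setT s|.
  rewrite -(cardsID (sd [set x in L14] s) (sd setT s)); congr (_ + _); apply: eq_card => x; rewrite !in_set.
    by case: (x \in L14); case: (si x == s).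
  by case: (x \in L14); case: (si x == s).
have c7 s : #|sd [set x in L14] s| = 7.
  rewrite card_sd_seq //= S2 S3 S4 S5 S6 B1 B2 B3 B4 B5 su sz1 sz3; by case: (si a1); case: (s).
have pmW : pm G W.
  apply: (@hall_pm _ _ (si a1)) => [|S SW].
    have := bal true; have := bal false; rewrite !c7 (balanced G); case: (si a1) => /=; clear; lia.
  case: (eqVneq S set0) => [->|S0]; first by rewrite cards0.
  pose N := image_in adj setT S.
  have NP y : y \in N -> y \notin L /\ si y = ~~ si a1.
    by case/image_inP => _ [x xS a]; apply: (Wout x) => //; apply: (subsetP SW).
  have Ss x : x \in S -> x \in W /\ si x = si a1.
    by move=> /(subsetP SW); rewrite in_sd => /andP[-> /eqP].
  pose Y := S :|: N.
  have Yt : sd Y (si a1) = S.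
    apply/setP => x; rewrite in_sd in_setU; apply/andP/idP => [[/orP[//|/NP[_ ->]]]|xS].
      by case: (si a1).
    by have [_ ->] := Ss x xS; rewrite xS eqxx.
  have Yf : sd Y (~~ si a1) = N.
    apply/setP => x; rewrite in_sd in_setU; apply/andP/idP => [[/orP[/Ss[_ ->]|//]]|xN].
      by case: (si a1).
    by have [_ ->] := NP x xN; rewrite xN orbT eqxx.
  have ot : out (si a1) Y = 0.
    apply/eqP/e_eq0P => x y; rewrite Yt => xS; rewrite in_setC in_setU negb_or => /andP[_ yN].
    by apply: contra yN => a; apply/image_inP; split=> //; exists x.
  have q1 := cutE G (si a1) Y; have q2 := cutE G (~~ si a1) Y; rewrite Yt Yf ot in q1 q2.
  have dY := dE G (si a1) Y; rewrite ot in dY.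
  have S1 : 0 < #|S| by rewrite card_gt0.
  have LY : [set x in L] \subset ~: Y.
    apply/subsetP => x; rewrite in_set => xL; rewrite in_setC in_setU; apply/negP => /orP[/Ss[/WL[]]|/NP[]];
      by rewrite xL.
  have cY : 1 < #|~: Y|.
    by apply: leq_trans (subset_leq_card LY); rewrite cardsE (card_uniqP uniqL).
  have Y1 : 1 < #|Y| by rewrite (card_sd G (si a1)) Yt Yf; move: S1 q1 q2; clear; lia.
  (* The cut size is three times the excess of [N] over [S]; being at least four, it makes the
     excess at least two. *)
  have := br_cut H Y1 cY; rewrite dY => d3.
  have sub : N :\: [set z1; z3] \subset image_in adj W S.
    apply/subsetP => y; rewrite in_setD => /andP[yz yN]; have [yL sy] := NP y yN.
    have /image_inP[_ ex] := yN; apply/image_inP; split=> //.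
    rewrite !in_set mem_cat negb_or yL /= !inE negb_or eq_sym uz //=.
    by move: yz; rewrite !inE.
  have := subset_leq_card sub; rewrite cardsD.
  have : #|N :&: [set z1; z3]| <= 2.
    by apply: leq_trans (subset_leq_card (subsetIr _ _)) _; rewrite cards2; case: (z1 != z3).
  move: d3 q1 q2; clear; lia.
have [gc vc] := wheel_c2; apply: (br_no8 H gc vc).
have uall : uniq (c2 ++ [:: a1; z1; a3; z3; t; u]).
  have -> : uniq (c2 ++ [:: a1; z1; a3; z3; t; u]) = uniq ((c2 ++ [:: a1; a3; t]) ++ [:: u; z1; z3]).
    apply: perm_uniq; rewrite -catA perm_cat2l.
    rewrite -[X in perm_eq X]/([:: a1] ++ [:: z1] ++ [:: a3] ++ [:: z3; t; u]).
    rewrite -[X in perm_eq _ X]/([:: a1] ++ ([:: a3; t; u] ++ [:: z1; z3])) perm_cat2l.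
    rewrite -[X in perm_eq X]/([:: z1] ++ [:: a3; z3; t; u]) perm_catC.
    rewrite -[X in perm_eq X]/([:: a3] ++ [:: z3] ++ [:: t; u; z1]).
    rewrite -[X in perm_eq _ X]/([:: a3] ++ ([:: t; u; z1] ++ [:: z3])) perm_cat2l.
    by rewrite perm_catC.
  have cE : c2 ++ [:: a1; a3; t] = [seq nth v L i | i <- [:: 8; 5; 6; 7; 9; 3; 2; 1; 0; 4; 10]] by [].
  rewrite cat_uniq cE wheel_uniq //; apply/and3P; split=> //; last first.
    by rewrite /= !inE negb_or z13 !uz.
  apply/hasPn => x xin; apply: contraL xin => xm.
  have xL : x \in L.
    by case/mapP: xm => i il ->; apply: mem_nth; move: il; rewrite !inE; do 11?[case/orP => [/eqP->//|]] => /eqP->.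
  by rewrite !inE !negb_or !neL.
have -> : ~: [set x in c2] = [set x in [:: a1; z1; a3; z3; t; u]] :|: W.
  apply/setP => x; rewrite !in_set mem_cat.
  case: (boolP (x \in c2)) => xc /=.
    have xL : x \in L.
      by move: xc; rewrite !inE => h; case/or4P: h => [|||/or4P[|||/orP[]]] /eqP->; rewrite eqxx ?orbT.
    rewrite xL /= orbF; apply/esym; move: uall; rewrite cat_uniq => /and3P[_ /hasPn h _].
    by apply/negP => /h; rewrite /= xc.
  apply/esym; case: (boolP (x \in L)) => xL /=.
    by rewrite orbF; move: xL xc; rewrite !inE; do 14?[case: (x == _) => //=].
  by rewrite ?inE; do 6?[case: (x == _) => //=].
apply: pmU => //.
  apply/pred0P => x /=; apply/negP => /andP[xl /WL[xL xu]]; move: xl xL xu; rewrite !inE.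
  by do 6!case: (x == _); rewrite ?orbT.
apply: (@pm_pairs [:: (a1, z1); (a3, z3); (t, u)]); last by rewrite /= az1 az3 tu.
by move: uall; rewrite cat_uniq => /and3P[].
Qed.

(** The neighbourhoods of [b2] and [b3] are complete without [a1], and [t] is excluded by
    hypothesis, so nothing in [L] is left. *)
Lemma wheel_third : ~~ adj t a1 -> exists2 z, adj a1 z & z \notin L.
Proof.
move=> nta; have [uniqL vL [h1 h2 h3 h4] [h5 h6 h7 h8] _] := D.
have [y1 [y2 [y3 [uy nbE]]]] := nbP H a1.
have ex : exists2 z, adj a1 z & z \notin [:: b4; b1].
  have := card_nb H a1; case: (boolP [exists z, adj a1 z && (z \notin [:: b4; b1])]).
    by case/existsP => z /andP[]; exists z.
  rewrite negb_exists => /forallP h; have : nb a1 \subset [set b4; b1].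
    by apply/subsetP => z; rewrite inE => a; have := h z; rewrite a negbK !inE.
  by move/subset_leq_card; rewrite cards2 => /[swap] ->; case: (_ != _).
case: ex => z a zn; exists z => //; apply/negP => zL.
have := wheel_mem_side zL (adj_si a); have [_ n2 n3 _ _] := wheel_nb a1.
rewrite !inE in zn *; case/norP: zn => /negPf z4 /negPf z1; rewrite z4 z1 /= => /or3P[] /eqP zE; move: a; rewrite zE adjC.
- move/n2; rewrite !inE; have := @wheel_uniq [:: 0; 2; 4; 9] isT isT; rewrite /= !inE !negb_or -!andbA.
  by case/and4P => /negPf-> /negPf-> /negPf->.
- move/n3; rewrite !inE; have := @wheel_uniq [:: 0; 4; 6; 8] isT isT; rewrite /= !inE !negb_or -!andbA.
  by case/and4P => /negPf-> /negPf-> /negPf->.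
- by rewrite (negPf nta).
Qed.

End Wheel.
End Core.

Section BraceHeawood.
Variables (V : finType) (G : bicubic V) (v : V).
Notation mu := (mu G).
Notation si := (si G).
Notation adj := (adj G).
Notation e := (e G).
Notation d := (d G).
Notation sd := (sd G).
Notation out := (out G).
Notation nb := (nb G).
Implicit Types (X Y P C : {set V}) (x y z : V).
Hypothesis H : brace G v.

(** Applied to the rotated wheels, [wheel_pair] gives [a1], [a3] a common third neighbour [p] and
    [a2], [a4] a common [q]. Then only [t], [p] and [q] can send an edge further, at most one each,
    so a single vertex [u] completes the graph. *)
Lemma wheel_heawood (a1 b1 a2 b2 a3 b3 a4 b4 s1 s2 t : V) :
  wheel G v a1 b1 a2 b2 a3 b3 a4 b4 s1 s2 t -> exists s p q, heawood G s p q.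
Proof.
move=> D1; have D2 := wheel_rot D1; have D3 := wheel_rot D2; have D4 := wheel_rot D3.
set L := [:: a1; b1; a2; b2; a3; b3; a4; b4; s1; s2; t].
have L2 x : (x \in L) = (x \in [:: a2; b2; a3; b3; a4; b4; a1; b1; s2; s1; t]).
  by rewrite !inE; do 11?[case: (x == _); rewrite ?orbT //].
have L3 x : (x \in L) = (x \in [:: a3; b3; a4; b4; a1; b1; a2; b2; s1; s2; t]).
  by rewrite !inE; do 11?[case: (x == _); rewrite ?orbT //].
have L4 x : (x \in L) = (x \in [:: a4; b4; a1; b1; a2; b2; a3; b3; s2; s1; t]).
  by rewrite !inE; do 11?[case: (x == _); rewrite ?orbT //].
have [uniqL vL [h1 h2 h3 h4] [h5 h6 h7 h8] [[g1 g2 g3 g4] k1 k2]] := D1; rewrite -/L in uniqL.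
have [[S2 S3 S4 S5 S6] [B1 B2 B3 B4 B5]] := wheel_side D1.
have nt1 : ~~ adj t a1 by apply/negP => /(wheel_foot_on_cycle H D1).
have nt2 : ~~ adj t a2 by apply/negP => /(wheel_foot_on_cycle H D2).
have nt3 : ~~ adj t a3 by apply/negP => /(wheel_foot_on_cycle H D3).
have nt4 : ~~ adj t a4 by apply/negP => /(wheel_foot_on_cycle H D4).
have neL x y : x \in L -> y \notin L -> x != y by move=> xL; apply: contraNneq => <-.
have [u tu uL] : exists2 u, adj t u & u \notin L.
  have ss : s1 != s2 by have := @wheel_uniq _ _ _ _ _ _ _ _ _ _ _ _ _ _ D1 [:: 8; 9] isT isT; rewrite /= inE andbT.
  case: (boolP [exists u, adj t u && (u \notin [:: s1; s2])]); last first.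
    rewrite negb_exists => /forallP h; have : nb t \subset [set s1; s2].
      by apply/subsetP => z; rewrite inE => a; have := h z; rewrite a negbK !inE.
    by move/subset_leq_card; rewrite cards2 (card_nb H); case: (_ != _).
  case/existsP => u /andP[tu un]; exists u => //; apply/negP => uL.
  have su : si u = si a1 by rewrite (adj_si tu) B5 negbK.
  have {uL} : exists2 y, y \in L & u = y by exists u.
  case=> y; rewrite !inE => yL uy; move: un tu su; rewrite uy => un tu su.
  have {}yL : y \in [:: a1; a2; a3; a4; s1; s2; b1; b2; b3; b4; t].
    by move: yL; rewrite !inE; do 11?[case: (y == _); rewrite ?orbT //].
  move: yL; rewrite -[X in y \in X]/([:: a1; a2; a3; a4] ++ [:: s1; s2] ++ [:: b1; b2; b3; b4; t]).
  rewrite !mem_cat => /or3P[ya|yss|yb].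
  - by move: ya tu; rewrite !inE => /or4P[] /eqP->; rewrite ?(negPf nt1) ?(negPf nt2) ?(negPf nt3) ?(negPf nt4).
  - by rewrite yss in un.
  - by move: yb su; rewrite !inE => /or4P[|||/orP[]] /eqP->; rewrite ?B1 ?B2 ?B3 ?B4 ?B5; case: (si a1).
have [z1 az1 zL1] := wheel_third H D1 nt1; rewrite -/L in zL1.
have [z2 az2] := wheel_third H D2 nt2; rewrite -L2 => zL2.
have [z3 az3] := wheel_third H D3 nt3; rewrite -L3 => zL3.
have [z4 az4] := wheel_third H D4 nt4; rewrite -L4 => zL4.
have z13 : z1 = z3 by apply: (wheel_pair H D1 (u := u)).
have z24 : z2 = z4 by apply: (wheel_pair H D2 (u := u)); rewrite -?L2.
subst z3 z4; move: z1 z2 az1 az2 zL1 zL2 az3 az4 {zL3 zL4} => p q pa1 qa2 pL qL pa3 qa4.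
have us idx : uniq idx -> all (gtn 11) idx -> uniq [seq nth v L i | i <- idx].
  exact: (wheel_uniq D1).
have sp : si p = ~~ si a1 by rewrite (adj_si pa1).
have sq : si q = ~~ si a1 by rewrite (adj_si qa2) S2.
have su : si u = si a1 by rewrite (adj_si tu) B5 negbK.
(* Otherwise one vertex would have the four neighbours [a1] to [a4]. *)
have pq : p != q.
  apply/eqP => pq; have : a4 \in [:: a1; a2; a3].
    apply: (nbr3 (G := G) (x := p)); [exact: (us [:: 0; 2; 4])|rewrite adjC //..].
    - by rewrite pq.
    - by rewrite pq.
  have a4n : a4 \notin [:: a1; a2; a3] by have /andP[] := us [:: 6; 0; 2; 4] isT isT.
  by rewrite (negPf a4n).
pose L13 := L ++ [:: p; q].
have uL13 : uniq L13.
  rewrite cat_uniq uniqL; apply/and3P; split=> //; last by rewrite /= inE pq.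
  by apply/hasPn => x; rewrite !in_cons in_nil orbF => /orP[] /eqP->.
have uL13' : u \notin L13.
  rewrite mem_cat negb_or uL /= !inE negb_or; apply/andP; split; apply/eqP => ue; move: su; rewrite ue ?sp ?sq;
  by case: (si a1).
pose Q := ~: [set x in L13].
have na (a b b' z : V) i j k : nth v L i = a -> nth v L j = b -> nth v L k = b' -> j < 11 -> k < 11 -> j != k ->
    adj a b -> adj a b' -> adj a z -> z \in [:: p; q] -> forall y, adj a y -> y \in L13.
  move=> ia ib ib' jl kl jk ab ab' az zpq y ay.
  have zL : z \notin L by move: zpq; rewrite mem_seq2 => /orP[] /eqP->.
  have bL : b \in L by rewrite -ib; apply: mem_nth.
  have bL' : b' \in L by rewrite -ib'; apply: mem_nth.
  have : y \in [:: b; b'; z].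
    apply: (nbr3 (G := G) (x := a)) => //; rewrite /= !inE negb_or (neL b z) // (neL b' z) //.
    by have := us [:: j; k]; rewrite /= !inE ib ib' !andbT jk jl kl => ->.
  by rewrite mem_seq3 => /or3P[] /eqP->; rewrite mem_cat ?bL ?bL' ?zpq ?orbT.
have clo x y : x \in [:: b1; b2; b3; b4; s1; s2; a1; a2; a3; a4] -> adj x y -> y \in L13.
  rewrite -[X in x \in X]/([:: b1; b2; b3; b4; s1; s2] ++ [:: a1; a2; a3; a4]) mem_cat => /orP[xb a|].
    by rewrite mem_cat (wheel_closed D1 xb a).
  rewrite mem_seq4 => /or4P[] /eqP-> a.
  - by apply: (na a1 b4 b1 p 0 7 1); rewrite // ?mem_seq2 ?eqxx // 1?adjC //.
  - by apply: (na a2 b1 b2 q 2 1 3); rewrite // ?mem_seq2 ?eqxx ?orbT // 1?adjC //.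
  - by apply: (na a3 b2 b3 p 4 3 5); rewrite // ?mem_seq2 ?eqxx // 1?adjC //.
  - by apply: (na a4 b3 b4 q 6 5 7); rewrite // ?mem_seq2 ?eqxx ?orbT // 1?adjC //.
have z x : x \in [:: b1; b2; b3; b4; s1; s2; a1; a2; a3; a4] -> e [set x] Q = 0.
  by move=> xl; apply: e_closed0 => y; apply: clo.
have ne2 x y : uniq [:: x; y] -> x != y by rewrite /= inE andbT.
have ss : s1 != s2 by apply: ne2; apply: (us [:: 8; 9]).
have a13 : a1 != a3 by apply: ne2; apply: (us [:: 0; 4]).
have a24 : a2 != a4 by apply: ne2; apply: (us [:: 2; 6]).
have inL x : x \in L -> x \in L13 by rewrite mem_cat => ->.
have lt : e [set t] Q <= 1 by apply: (@e_two_le1 _ _ _ _ s1 s2); rewrite // inL // !inE eqxx ?orbT.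
have lp : e [set p] Q <= 1.
  by apply: (@e_two_le1 _ _ _ _ a1 a3); rewrite // 1?adjC // inL // !inE eqxx ?orbT.
have lq : e [set q] Q <= 1.
  by apply: (@e_two_le1 _ _ _ _ a2 a4); rewrite // 1?adjC // inL // !inE eqxx ?orbT.
have dQ : d Q <= 3.
  have -> : d Q = e [set x in L13] Q by rewrite /Q dC.
  rewrite e_seq // /L13 /L /= !big_cons big_nil.
  rewrite (z a1) ?(z a2) ?(z a3) ?(z a4) ?(z b1) ?(z b2) ?(z b3) ?(z b4) ?(z s1) ?(z s2) ?inE ?eqxx ?orbT //.
  move: lt lp lq; clear; lia.
have cL : #|[set x in L13]| = 13 by rewrite cardsE (card_uniqP uL13).
have Q1 : #|Q| <= 1.
  rewrite leqNgt; apply/negP => Q1; have : 3 < d Q; last by rewrite ltnNge dQ.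
  by apply: (br_cut H) => //; rewrite setCK cL.
have uQ : u \in Q by rewrite !in_set.
have all14 x : x \in L13 \/ x = u.
  case: (boolP (x \in L13)) => xL; [by left|right]; apply/eqP; apply/negPn/negP => xu.
  have : #|[set x; u]| <= 1.
    by apply: leq_trans Q1; apply: subset_leq_card; apply/subsetP => y; rewrite in_set2 => /orP[] /eqP->; rewrite // !in_set.
  by rewrite cards2 xu.
have nu y : adj u y -> y \in [:: t; p; q].
  move=> a; have yu : y <> u by move=> yu; move: a; rewrite yu /adj mu_si.
  have bad : y \notin [:: b1; b2; b3; b4; s1; s2; a1; a2; a3; a4].
    by apply: contra uL13' => yl; apply: (clo y) => //; rewrite adjC.
  case: (all14 y) => // yL; move: bad; apply: contraR => yn.
  by move: yL yn; rewrite !inE; do 13?[case: (y == _) => //=].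
have [ut up uq] := nb_full H nu.
(* An explicit labelling by residues modulo 7; the last line of the proof tests its 21 edges. *)
exists (si a1), (nth v [:: a2; s1; s2; a1; u; a4; a3]), (nth v [:: b1; b2; b3; q; p; b4; t]).
apply: (heawood_intro H) => //.
- have ub : uniq ([:: b1; b2; b3; b4; t] ++ [:: p; q]).
    rewrite cat_uniq; apply/and3P; split; first exact: (us [:: 1; 3; 5; 7; 10]).
      apply/hasPn => x xpq; apply/negP => xb; have : x \in L.
        by move: xb; rewrite !inE => /or4P[|||/orP[]] /eqP->; rewrite eqxx ?orbT.
      by move: xpq; rewrite !in_cons in_nil orbF => /orP[] /eqP->; apply/negP.
    by rewrite /= inE pq.
  rewrite (_ : uniq _ = uniq ([:: b1; b2; b3; b4; t] ++ [:: p; q])) //; apply: perm_uniq.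
  rewrite -[X in perm_eq X]/([:: b1; b2; b3] ++ ([:: q; p] ++ [:: b4; t])).
  rewrite -[X in perm_eq _ X]/([:: b1; b2; b3] ++ ([:: b4; t] ++ [:: p; q])).
  rewrite perm_cat2l perm_catC perm_cat2l -[X in perm_eq X]/([:: q] ++ [:: p]).
  by rewrite perm_catC.
- by move=> x; rewrite !inE => /or4P[|||/or4P[]] /eqP->.
- by move=> x; rewrite !inE => /or4P[|||/or4P[]] /eqP->.
- move=> x; case: (all14 x) => [|->]; rewrite !inE ?eqxx ?orbT //.
  by do 13?[case: (x == _); rewrite ?orbT //].
case=> [|[|[|[|[|[|[|i]]]]]]] // [|[|[|[|[|[|[|j]]]]]]] //= _ _ _; rewrite 1?adjC //.
Qed.

(** A lobe of three vertices has only two of side [s] for the four feet, so opposite feet coincide,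
    and the third vertex is adjacent to both: this is a wheel. *)
Lemma brace_heawood s c X : gcycle G 8 c -> v \notin c -> lobe G s [set x in c] X ->
  v \notin X -> #|X| <= 23 -> exists s p q, heawood G s p q.
Proof.
move=> gc0 vc0 hX0 vX0 X23.
have [{}s [{gc0 vc0 hX0}c [{vX0 X23}X [gc vc hX vX X3]]]] := small_lobe H gc0 vc0 hX0 vX0 X23.
have [dXC cX e0] := hX.
have [a1 [b1 [a2 [b2 [a3 [b3 [a4 [b4 [gc' cE A B]]]]]]]]] := gcycle8_side s gc vc.
have [y1 [y2 [y3 [y4 [[yX1 yX2 yX3 yX4] m [n12 n23 n34 n41]]]]]] := lobe_feet H gc vc hX vX gc' cE A B.
have sX : #|sd X s| = 2 by have := card_sd G s X; move: cX X3; clear; lia.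
have sX' : #|sd X (~~ s)| = 1 by move: cX sX; clear; lia.
have XE : sd X s = [set y1; y2].
  by apply/esym/eqP; rewrite eqEcard sX cards2 n12 andbT; apply/subsetP => x; rewrite !inE => /orP[] /eqP->; rewrite -in_sd.
have e13 : y3 = y1.
  by move: yX3; rewrite XE !inE => /orP[] /eqP // e3; rewrite e3 eqxx in n23.
have e24 : y4 = y2.
  by move: yX4; rewrite XE !inE => /orP[] /eqP // e4; rewrite e4 eqxx in n41.
subst y3 y4.
have /cards1P[t tE] : #|sd X (~~ s)| == 1 by rewrite sX'.
have tX : t \in X by apply: (subsetP (sd_sub G X (~~ s))); rewrite tE set11.
have sdX x r : x \in sd X r -> x \in X by apply/subsetP/sd_sub.
have [A1 A2 A3 A4] := A; have [B1 B2 B3 B4] := B.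
have foot y : y \in sd X s -> forall x, adj y x -> x = t \/ x \in [:: b1; b2; b3; b4].
  move=> yX x a; have sy : si y = s by move: yX; rewrite in_sd => /andP[_ /eqP].
  have sx : si x = ~~ s by rewrite (adj_si a) sy.
  case: (boolP (x \in X)) => xX.
    by left; apply/eqP; rewrite -in_set1 -tE in_sd xX sx eqxx.
  right; case: (boolP (x \in c)) => xc.
    have : x \in sd [set x in c] (~~ s) by rewrite in_sd inE xc sx eqxx.
    have -> : [set x in c] = [set x in [:: a1; b1; a2; b2; a3; b3; a4; b4]] by apply/setP => z; rewrite !inE cE !inE.
    by rewrite (sd_cycle A B) inE.
  move/eqP/e_eq0P: e0 => /(_ y x yX); rewrite a !inE negb_or xX xc => /(_ isT); by [].
(* A foot with only two neighbours on the cycle has its third one inside the lobe, where [t] is the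
   only choice. *)
have ty y b b' : y \in sd X s -> (forall x, adj y x -> x \in [:: b1; b2; b3; b4] -> x \in [:: b; b']) -> adj t y.
  move=> yX h; rewrite adjC; have [] // := @nb_full _ _ _ H y t b b'.
  move=> x a; rewrite in_cons; case: (foot y yX x a) => [->|xb]; first by rewrite eqxx.
  by rewrite h ?orbT.
have [m11 m12 m13 m14] := m y1 yX1; have [m21 m22 m23 m24] := m y2 yX2.
rewrite !eqxx ?(eq_sym y2) (negPf n12) !(muE H) in m11 m12 m13 m14 m21 m22 m23 m24.
apply: (@wheel_heawood a1 b1 a2 b2 a3 b3 a4 b4 y1 y2 t).
have [? [? [? [? [? [? [? [? [[<- <- <- <- <- <- <- <-] uc h1 h2]]]]]]]]] := gcycle8P gc'.
have inX x : x \in [:: y1; y2; t] -> x \in X.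
  by rewrite !inE => /or3P[] /eqP->; rewrite ?tX // (sdX _ s).
split=> //.
- rewrite -[[:: a1, b1 & _]]/([:: a1; b1; a2; b2; a3; b3; a4; b4] ++ [:: y1; y2; t]) cat_uniq uc.
  apply/and3P; split=> //.
    apply/hasPn => x /inX xX; rewrite -cE; have := disjointFr dXC xX; by rewrite inE => ->.
  rewrite /= !inE negb_or n12 /= andbT; apply/andP; split; apply/eqP => yt.
    by move: yX1; rewrite yt in_sd => /andP[_ /eqP ts]; have : t \in sd X (~~ s) by [rewrite tE set11]; rewrite in_sd ts => /andP[_]; case: (s).
  by move: yX2; rewrite yt in_sd => /andP[_ /eqP ts]; have : t \in sd X (~~ s) by [rewrite tE set11]; rewrite in_sd ts => /andP[_]; case: (s).
- rewrite -[[:: a1, b1 & _]]/([:: a1; b1; a2; b2; a3; b3; a4; b4] ++ [:: y1; y2; t]) mem_cat negb_or -cE vc.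
  by apply: contra vX => /inX.
have bT (b : bool) : nat_of_bool b = true -> b by case: b.
have bF (b : bool) : nat_of_bool b = false -> ~~ b by case: b.
split; first by split; apply: bT.
  apply: (ty y1 b1 b3) => // x a; rewrite !inE => /or4P[] /eqP xE; rewrite xE ?eqxx ?orbT //;
  by move: a; rewrite xE ?(negPf (bF _ m12)) ?(negPf (bF _ m14)).
apply: (ty y2 b2 b4) => // x a; rewrite !inE => /or4P[] /eqP xE; rewrite xE ?eqxx ?orbT //;
by move: a; rewrite xE ?(negPf (bF _ m21)) ?(negPf (bF _ m23)).
Qed.

End BraceHeawood.

(** * Contraction across a 3-edge cut *)

Section Contraction.
Variables (V : finType) (G : bicubic V) (Y : {set V}) (s : bool).
Hypothesis dY : d G Y = 3.
Hypothesis outY : out G (~~ s) Y = 0.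

(** [None] stands for the contracted set [Y]. As all three cut edges leave [Y] from side [s], this
    becomes the side of the new vertex. *)
Definition ctype : finType := option {x : V | x \notin Y}.
Definition crep (x : V) : ctype := insub x.
Definition cpre (X : {set ctype}) : {set V} := [set x | crep x \in X].
Definition csi (x : ctype) : bool := if x is Some z then si G (val z) else s.
(** The test [x == y] discards the edges inside [Y], which would become loops. *)
Definition cmu (x y : ctype) : nat := if x == y then 0 else e G (cpre [set x]) (cpre [set y]).

Lemma cpre_Some z : cpre [set Some z] = [set val z].
Proof.
apply/setP => x; rewrite !inE /crep; case: insubP => [u _ <-|xY] /=.
  by rewrite (inj_eq (@Some_inj _)) (inj_eq val_inj).
by apply/esym/eqP => xE; rewrite xE (valP z) in xY.
Qed.

Lemma cpre_None : cpre [set None] = Y.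
Proof.
by apply/setP => x; rewrite !inE /crep; case: insubP => [u xY _|]; rewrite ?negbK // (negPf xY).
Qed.

Lemma e_cpre X (Z : {set ctype}) : e G X (cpre Z) = \sum_(z in Z) e G X (cpre [set z]).
Proof.
rewrite /e [RHS]exchange_big /=; apply: eq_bigr => x _.
rewrite (partition_big crep (fun z => z \in Z)) /=; last by move=> y; rewrite inE.
apply: eq_bigr => z zZ; apply: eq_bigl => y; rewrite !inE.
by case: eqP => [->|]; rewrite ?zZ ?andbF.
Qed.

Lemma cmu_sym x y : cmu x y = cmu y x.
Proof. by rewrite /cmu eq_sym eC. Qed.

Lemma d_cpre1 x : d G (cpre [set x]) = 3.
Proof. by case: x => [z|]; rewrite ?cpre_Some ?d1 // cpre_None. Qed.

Lemma cpreC Z : cpre (~: Z) = ~: cpre Z.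
Proof. by apply/setP => x; rewrite !inE. Qed.

Lemma cmu_deg x : \sum_y cmu x y = 3.
Proof.
rewrite -(d_cpre1 x) /d -cpreC e_cpre (bigD1 x) //= {1}/cmu eqxx add0n.
rewrite (eq_bigl (fun y => y \in ~: [set x])); last by move=> y; rewrite !inE.
by apply: eq_bigr => y; rewrite !inE /cmu eq_sym => /negPf->.
Qed.

Lemma cmu_si x y : csi x = csi y -> cmu x y = 0.
Proof.
have key z : z \notin Y -> si G z = s -> e G Y [set z] = 0.
  move=> zY sz; apply/eqP/e_eq0P => w z' wY; rewrite inE => /eqP->; apply/negP => a.
  have : 0 < out G (~~ s) Y; last by rewrite outY.
  apply: (e_gt0 (x := w) (y := z)) => //; last by rewrite inE.
  by rewrite in_sd wY -sz (adj_si a) negbK eqxx.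
case: x y => [x|] [y|]; rewrite /cmu ?cpre_Some ?cpre_None /=.
- by case: eqP => // _ sxy; rewrite e11; apply: mu_si.
- by move=> sx; rewrite eC key ?(valP x).
- by move=> sx; rewrite key ?(valP y).
- by [].
Qed.

Definition con : bicubic ctype := Bicubic cmu_sym cmu_si cmu_deg.

Lemma con_d X : d con X = d G (cpre X).
Proof.
have -> : d G (cpre X) = \sum_(y in ~: X) \sum_(x in X) e G (cpre [set x]) (cpre [set y]).
  rewrite /d -cpreC e_cpre; apply: eq_bigr => y _; rewrite eC e_cpre.
  by apply: eq_bigr => x _; rewrite eC.
rewrite /d /e exchange_big /=; apply: eq_bigr => y yX; apply: eq_bigr => x xX; rewrite /cmu.
by case: eqP => // xy; move: yX; rewrite inE -xy xX.
Qed.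

Lemma Y_nonempty : exists y, y \in Y.
Proof.
have [y [z [yY _ _]]] : exists y z, [/\ y \in Y, z \in ~: Y & adj G y z].
  by apply: e_gt0P; rewrite -/(d G Y) dY.
by exists y.
Qed.

Lemma crep_surj x : exists z, crep z = x.
Proof.
case: x => [x|]; first by exists (val x); rewrite /crep valK.
by have [y yY] := Y_nonempty; exists y; rewrite /crep insubN // negbK.
Qed.

Lemma con_connected : connected G -> connected con.
Proof.
move=> conn X X0 XT; rewrite con_d; apply: conn.
  case/set0Pn: X0 => x xX; have [z zx] := crep_surj x.
  by apply/set0Pn; exists z; rewrite inE zx.
apply: contra XT => /eqP XT; apply/eqP/setP => x; have [z zx] := crep_surj x.
by have := in_setT z; rewrite -XT !inE zx.
Qed.

Lemma con_mu_Some x y : mu con (Some x) (Some y) = mu G (val x) (val y).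
Proof.
rewrite /= /cmu !cpre_Some e11; case: eqP => // -[->].
by rewrite mu_si.
Qed.

Lemma con_mu_None y : mu con None (Some y) = e G Y [set val y].
Proof. by rewrite /= /cmu cpre_Some cpre_None. Qed.

Lemma card_ctype : #|ctype| = (#|~: Y|).+1.
Proof. by rewrite card_option card_sig; congr _.+1; apply: eq_card => x; rewrite !inE. Qed.

Lemma card_cpre (X : {set ctype}) : None \notin X -> #|cpre X| = #|X|.
Proof.
move=> nX; have ->: cpre X = [set val x | x : {x : V | x \notin Y} & Some x \in X].
  apply/setP => x; rewrite inE; apply/idP/imsetP => [|[z]].
    rewrite /crep; case: insubP => [u _ <- uX|_ uX]; last by rewrite uX in nX.
    by exists u; rewrite ?inE.
  by rewrite inE => zX ->; rewrite /crep valK.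
rewrite card_imset; last exact: val_inj.
have Sinj : injective (@Some {x : V | x \notin Y}) by move=> a b [].
rewrite -(card_imset _ Sinj); apply: eq_card => x.
apply/imsetP/idP => [[z]|xX]; first by rewrite inE => zX ->.
by case: x xX => [z|] zX; [exists z; rewrite ?inE|rewrite zX in nX].
Qed.

End Contraction.

(** * Cuts of three edges and minimal sets *)

Section Cuts.
Variables (V : finType) (G : bicubic V).
Notation mu := (mu G).
Notation si := (si G).
Notation adj := (adj G).
Notation e := (e G).
Notation d := (d G).
Notation sd := (sd G).
Notation out := (out G).
Implicit Types (X Y Z : {set V}) (x y z : V) (s : bool).

Lemma out_compl s Y : out s (~: Y) = out (~~ s) Y.
Proof. by rewrite /Cubic.out setCK e_sd eC [RHS]e_sd negbK. Qed.

(** The numbers of edges leaving from the two sides agree modulo 3 and add up to 3. *)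
Lemma cut3_side Y : d Y = 3 -> exists s, out s Y = 3 /\ out (~~ s) Y = 0.
Proof.
have := cutE G true Y; have := cutE G false Y; rewrite (dE G true) /= => c1 c2 c3.
have [h|h] : (out true Y = 3 /\ out false Y = 0) \/ (out false Y = 3 /\ out true Y = 0).
  move: c1 c2 c3; clear; lia.
- by exists true.
- by exists false.
Qed.

Hypothesis conn : connected G.

(** A set [S] on the smaller side of the complement has all its neighbours outside [Y]. By
    connectedness the cut around [S] and its neighbours is not empty, and being a multiple of 3 it
    yields at least one neighbour more than elements, so [x] can be spared. *)
Lemma pm_outside s Y x : d Y = 3 -> out (~~ s) Y = 0 -> x \in ~: Y -> si x = ~~ s -> pm G (~: Y :\ x).
Proof.
move=> dY oY xY sx; set Z := ~: Y in xY *.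
have oZ : out s Z = 0 by rewrite out_compl.
have cs : #|sd Z (~~ s)| = #|sd Z s|.+1.
  have q1 := cutE G s Z; have q2 := cutE G (~~ s) Z; have := dE G s Z; rewrite dC dY oZ => q3.
  move: q1 q2 q3; rewrite oZ; clear; lia.
have sdx : sd (Z :\ x) s = sd Z s.
  by apply/setP => z; rewrite !in_sd !inE; case: eqP => //= ->; rewrite sx; case: (s); rewrite !andbF.
have sdx' : #|sd (Z :\ x) (~~ s)| = #|sd Z s|.
  have -> : sd (Z :\ x) (~~ s) = sd Z (~~ s) :\ x by apply/setP => z; rewrite !in_sd !inE andbA.
  have := cardsD1 x (sd Z (~~ s)); rewrite in_sd xY sx eqxx cs; clear; lia.
apply: (@hall_pm _ _ s) => [|S]; rewrite sdx ?sdx' // => SZ.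
case: (eqVneq S set0) => [->|S0]; first by rewrite cards0.
pose N := image_in adj setT S.
have Ss w : w \in S -> w \in Z /\ si w = s by move=> /(subsetP SZ); rewrite in_sd => /andP[-> /eqP].
have NZ y : y \in N -> y \in Z /\ si y = ~~ s.
  case/image_inP => _ [w wS a]; have [wZ sw] := Ss w wS; rewrite (adj_si a) sw; split=> //.
  apply/negPn/negP => yZ; have : 0 < out s Z; last by rewrite oZ.
  by apply: (e_gt0 (x := w) (y := y)) => //; rewrite ?in_sd ?wZ ?sw ?eqxx // in_setC.
pose W := S :|: N.
have Wt : sd W s = S.
  apply/setP => w; rewrite in_sd in_setU; apply/andP/idP => [[/orP[//|/NZ[_ ->]]]|wS].
    by case: (s).
  by have [_ ->] := Ss w wS; rewrite wS eqxx.
have Wf : sd W (~~ s) = N.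
  apply/setP => w; rewrite in_sd in_setU; apply/andP/idP => [[/orP[/Ss[_ ->]|//]]|wN].
    by case: (s).
  by have [_ ->] := NZ w wN; rewrite wN orbT eqxx.
have ot : out s W = 0.
  apply/eqP/e_eq0P => w y; rewrite Wt => wS; rewrite in_setC in_setU negb_or => /andP[_ yN].
  by apply: contra yN => a; apply/image_inP; split=> //; exists w.
have q1 := cutE G s W; have q2 := cutE G (~~ s) W; have q3 := dE G s W; rewrite Wt Wf ot in q1 q2 q3.
have dW : 0 < d W.
  apply: conn; first by apply: contraNneq S0 => W0; rewrite -Wt W0; apply/eqP/setP => w; rewrite in_sd !inE.
  apply/eqP => WT; have [y [z [yY _ _]]] : exists y z, [/\ y \in Y, z \in ~: Y & adj y z].
    by apply: e_gt0P; rewrite -/(Cubic.d G Y) dY.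
  have : y \in W by rewrite WT inE.
  by rewrite in_setU => /orP[/Ss[]|/NZ[]]; rewrite in_setC yY.
have sub : N :\ x \subset image_in adj (Z :\ x) S.
  apply/subsetP => y; rewrite in_setD1 => /andP[yx yN]; have [yZ _] := NZ y yN.
  by have /image_inP[_ ex] := yN; apply/image_inP; split=> //; rewrite in_setD1 yx.
have := subset_leq_card sub; have := cardsD1 x N; case: (x \in N) => /=; move: dW q1 q2 q3; clear; lia.
Qed.

Definition clean Y := forall x y, x \in Y -> y \in Y -> mu x y <= 1.

Lemma d_remove x Y : x \in Y -> d (Y :\ x) + 2 * e [set x] (~: Y) = d Y + 3.
Proof.
move=> xY; have YE : Y = x |: (Y :\ x) by rewrite setD1K.
have dis : [disjoint [set x] & Y :\ x] by rewrite disjoints1 !inE eqxx.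
have q1 : e Y (~: Y) = e [set x] (~: Y) + e (Y :\ x) (~: Y) by rewrite {1}YE eU.
have q2 : e (Y :\ x) (~: (Y :\ x)) = e (Y :\ x) (~: Y) + e (Y :\ x) [set x].
  rewrite -eUr; last by rewrite disjoint_sym disjoints1 inE xY.
  by congr (e _ _); apply/setP => z; rewrite !inE; case: eqP => [->|_]; rewrite ?orbT ?orbF.
have q3 := e_split G [set x] Y; rewrite cards1 in q3.
have q4 : e [set x] Y = e [set x] (Y :\ x).
  by rewrite {1}YE eUr // e11 mu_si.
have q5 : e (Y :\ x) [set x] = e [set x] (Y :\ x) by rewrite eC.
rewrite /Cubic.d; move: q1 q2 q3 q4 q5; clear; lia.
Qed.

(** By the congruence modulo 3, a minimal set has a cut of three edges or of two, one from each
    side. In the latter case deleting the end of a cut edge keeps the cut at most 3 and contradicts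
    minimality, unless the set is just a double edge, which [clean] forbids. *)
Lemma kernel_exists Y0 : clean Y0 -> 1 < #|Y0| -> Y0 != setT -> d Y0 <= 3 ->
  exists Y, [/\ Y \subset Y0, 2 < #|Y|, d Y = 3 & forall X, X \subset Y -> 1 < #|X| -> d X <= 3 -> X = Y].
Proof.
move=> cl c0 T0 d0.
pose P := [pred X : {set V} | [&& X \subset Y0, 1 < #|X| & d X <= 3]].
have PY0 : P Y0 by rewrite /= subxx c0 d0.
case: (arg_minnP (fun X : {set V} => #|X|) PY0) => Y /and3P[YY0 Y1 Y3] minY.
have mini X : X \subset Y -> 1 < #|X| -> d X <= 3 -> X = Y.
  move=> XY X1 X3; apply/eqP; rewrite eqEcard XY /=; apply: minY.
  by rewrite /= (subset_trans XY YY0) X1 X3.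
have Y0' : Y != set0 by rewrite -card_gt0; apply: ltnW.
have YT : Y != setT.
  by apply: contraNneq T0 => YT; rewrite eqEsubset subsetT -YT YY0.
have dpos := conn Y0' YT.
have q1 := cutE G true Y; have q2 := cutE G false Y; have q3 := dE G true Y; have q4 := card_sd G true Y.
have [dY|dY] : d Y = 3 \/ d Y = 2 by move: q1 q2 q3 Y3 dpos => /=; clear; lia.
  exists Y; split=> //; move: q1 q2 q3 q4 Y1 => /=; rewrite dY; clear; lia.
exfalso.
have Y4 : 3 < #|Y|.
  rewrite ltnNge; apply/negP => Yle; have Y2 : #|Y| = 2 by move: q1 q2 q3 q4 Y1 Yle => /=; rewrite dY; clear; lia.
  have [st sf] : #|sd Y true| = 1 /\ #|sd Y false| = 1 by move: q1 q2 q3 q4 Y2 => /=; rewrite dY; clear; lia.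
  have /cards1P[x xE] : #|sd Y true| == 1 by rewrite st.
  have /cards1P[y yE] : #|sd Y false| == 1 by rewrite sf.
  have xY : x \in Y by apply: (subsetP (sd_sub G Y true)); rewrite xE set11.
  have yY : y \in Y by apply: (subsetP (sd_sub G Y false)); rewrite yE set11.
  have := cl x y (subsetP YY0 _ xY) (subsetP YY0 _ yY); rewrite -e11 -xE -yE.
  move: q1 q2 q3; rewrite dY st sf /inn /=; clear; lia.
have [x [y [xY yY a]]] : exists x y, [/\ x \in Y, y \in ~: Y & adj x y] by apply: e_gt0P; rewrite -/(Cubic.d G Y) dY.
have out1 : 0 < e [set x] (~: Y) by apply: (e_gt0 (set11 x) yY a).
have := d_remove xY; have cx := cardsD1 x Y; rewrite xY in cx => dx.
have YE : Y :\ x = Y.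
  apply: mini; first exact: subsetDl.
    by move: cx Y4; clear; lia.
  by move: dx out1; rewrite dY; clear; lia.
by move: cx; rewrite YE; clear; lia.
Qed.

End Cuts.

Definition uncolourable (V : finType) (G : bicubic V) := forall c, ~ good_colouring G c.

Lemma card_disjoint3 (T : finType) (A B : {set T}) : [disjoint B & A] ->
  #|A| + #|B| + #|~: (A :|: B)| = #|T|.
Proof.
rewrite disjoint_sym -setI_eq0 => /eqP AB.
by rewrite -(cardsC (A :|: B)) cardsU AB cards0 subn0.
Qed.

Section FourCycles.
Variables (V : finType) (G : bicubic V).
Notation si := (si G).
Notation adj := (adj G).
Notation e := (e G).
Notation sd := (sd G).
Notation out := (out G).
Hypothesis conn : connected G.
Hypothesis U : uncolourable G.

Lemma gcycle4_sd c s : gcycle G 4 c -> #|sd [set x in c] s| = 2.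
Proof.
move=> gc; have /and3P[sc uc cc] := gc.
rewrite card_sd_seq //; case: c sc uc cc {gc} => [|a1 [|b1 [|a2 [|b2 [|x c]]]]] // _ uc /=.
case/and5P => h1 h2 h3 h4 _; rewrite (adj_si h3) (adj_si h2) (adj_si h1) !negbK.
by case: (si a1); case: (s).
Qed.

(** A Hall violator needs at least three edges to the cycle, but a side of a 4-cycle receives only
    two. So the complement always has a perfect matching, which yields a colouring. *)
Lemma no_gcycle4 c : ~ gcycle G 4 c.
Proof.
move=> gc; set C := [set x in c].
suff pmC : pm G (~: C) by have [col] := cycle_colouring (k := 1) conn isT gc pmC; apply: U.
have c2 s : #|sd C s| = 2 by apply: gcycle4_sd.
have cC s : #|sd (~: C) s| + 2 = #|sd setT s|.
  rewrite -(c2 s) addnC -(cardsID (sd C s) (sd setT s)); congr (_ + _); apply: eq_card => x; rewrite !inE.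
    by case: (si x == s); rewrite ?andbF ?andbT.
  by case: (si x == s); rewrite ?andbF ?andbT.
apply: (@hall_pm _ _ true) => [|S SC].
  by apply/eqP; rewrite -(eqn_add2r 2) !cC (balanced G).
set N := image_in adj (~: C) S; rewrite leqNgt; apply/negP => lt.
have St x : x \in S -> si x /\ x \notin C.
  by move=> /(subsetP SC); rewrite !inE => /andP[-> /eqP->].
have Nf x : x \in N -> ~~ si x /\ x \notin C.
  by case/image_inP; rewrite inE => -> [z /St[sz _] /adj_si->]; rewrite sz.
pose P := S :|: N.
have Pt : sd P true = S.
  apply/setP => x; rewrite in_sd in_setU; apply/andP/idP => [[/orP[//|/Nf[/negPf-> //]]]|xS].
  by have [-> _] := St x xS; rewrite xS.
have Pf : sd P false = N.
  apply/setP => x; rewrite in_sd in_setU; apply/andP/idP => [[/orP[/St[-> //]|//]]|xN].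
  by have [/negPf-> _] := Nf x xN; rewrite xN orbT.
have ot : out true P <= 2.
  apply: (@leq_trans (e (sd C false) (~: C))).
    rewrite /Cubic.out Pt; apply: (@leq_trans (e S (sd C false))); last first.
      by rewrite eC; apply: eS => //; apply/subsetP => x /St[_]; rewrite in_setC.
    rewrite (eIDr G (sd C false)); have -> : e S (~: P :\: sd C false) = 0.
      apply/eqP/e_eq0P => x y xS; rewrite in_setD in_setC in_setU negb_or => /and3P[yC _ yN].
      apply/negP => a; case: (boolP (y \in C)) => yC'.
        by case/negP: yC; rewrite in_sd yC' (adj_si a); have [-> _] := St x xS.
      by case/negP: yN; apply/image_inP; rewrite in_setC yC'; split=> //; exists x.
    by rewrite addn0; apply: eS => //; apply: subsetIr.
  rewrite -[2]mul1n -(c2 false); apply: e_le => x; rewrite in_sd inE => /andP[xc _].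
  have := gcycle_in gc isT xc; have := e_split G [set x] C; rewrite cards1 /C; clear; lia.
have := cutE G true P; have := cutE G false P; rewrite Pt Pf; move: lt ot; clear; lia.
Qed.

End FourCycles.

(** * A minimal set with its complement contracted *)

Section Kernel.
Variables (V : finType) (G : bicubic V) (Y : {set V}) (s : bool).
Hypothesis conn : connected G.
Hypothesis U : uncolourable G.
Hypothesis Y2 : 2 < #|Y|.
Hypothesis dY : d G Y = 3.
Hypothesis outY : out G (~~ s) Y = 0.

Lemma dYC : d G (~: Y) = 3. Proof. by rewrite dC. Qed.
Lemma outYC : out G (~~ ~~ s) (~: Y) = 0. Proof. by rewrite negbK out_compl. Qed.

Definition kernel := con dYC outYC.
Definition kin (x : ctype (~: Y)) : V := if x is Some z then val z else xchoose (Y_nonempty dY).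

Lemma kin_inj x y : x != None -> y != None -> kin x = kin y -> x = y.
Proof. by case: x y => [x|] [y|] //= _ _ /val_inj->. Qed.

Lemma kin_in x : x != None -> kin x \in Y.
Proof. by case: x => [z|] //= _; have := valP z; rewrite inE negbK. Qed.

Lemma kin_mu x y : x != None -> y != None -> mu kernel x y = mu G (kin x) (kin y).
Proof. by case: x y => [x|] [y|] // _ _; rewrite con_mu_Some. Qed.

Lemma kin_surj z : z \in Y -> exists2 x, x != None & kin x = z.
Proof.
move=> zY; have zC : z \notin ~: Y by rewrite inE negbK.
by exists (Some (exist _ z zC)).
Qed.

Lemma kin_gcycle m c : gcycle kernel m c -> None \notin c -> gcycle G m (map kin c).
Proof.
move=> /and3P[/eqP sc uc cc] nc; apply/and3P; split.
- by rewrite size_map sc.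
- rewrite map_inj_in_uniq // => x y xc yc; apply: kin_inj.
    by apply: contraNneq nc => <-.
  by apply: contraNneq nc => <-.
have ad : {in c &, forall x y, adj kernel x y = adj G (kin x) (kin y)}.
  move=> x y xc yc; rewrite /adj kin_mu //.
    by apply: contraNneq nc => <-.
  by apply: contraNneq nc => <-.
move: cc; apply: (homo_cycle_in (P := [in c])); last exact: allss.
by move=> x y xc yc; rewrite ad.
Qed.

Hypothesis minY : forall X : {set V}, X \subset Y -> 1 < #|X| -> d G X <= 3 -> X = Y.

(** The side of the cut that misses [None] is a subset of [Y] with the same cut in [G]. By
    minimality it could only be [Y] itself, which leaves a single vertex on the other side. *)
Lemma kernel_cut (X : {set ctype (~: Y)}) : 1 < #|X| -> 1 < #|~: X| -> 3 < d kernel X.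
Proof.
wlog nX : X / None \notin X.
  move=> IH X1 X2; case: (boolP (None \in X)) => nX; last exact: IH.
  by rewrite -dC; apply: IH; rewrite ?setCK // inE nX.
move=> X1 X2; rewrite con_d ltnNge; apply/negP => d3.
have sub : cpre X \subset Y.
  apply/subsetP => x; rewrite inE /crep; case: insubP => [u|_]; last by rewrite (negPf nX).
  by rewrite inE negbK.
have cE := minY sub; rewrite card_cpre // in cE; have {}cE := cE X1 d3.
have : ~: X \subset [set None].
  apply/subsetP => x; rewrite inE; case: x => [z|]; last by rewrite inE.
  have : val z \in cpre X by rewrite cE; have := valP z; rewrite inE negbK.
  by rewrite inE /crep valK => ->.
by move/subset_leq_card; rewrite cards1 leqNgt X2.
Qed.

Lemma crepK (x : ctype (~: Y)) : x != None -> crep (~: Y) (kin x) = x.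
Proof. by case: x => // z _; rewrite /crep /= valK. Qed.

Lemma crep_in z : z \in Y -> crep (~: Y) z != None /\ kin (crep (~: Y) z) = z.
Proof. by move=> /kin_surj[x xN <-]; rewrite crepK. Qed.

Lemma kernel_None x : x != None -> mu kernel None x = e G (~: Y) [set kin x].
Proof. by case: x => // z _; rewrite con_mu_None. Qed.

(** The matching edge at [None] comes from an edge [y0 x0] across the cut, and [pm_outside] matches
    the rest of the complement of [Y]. *)
Lemma kernel_pm c : None \notin c -> pm kernel (~: [set x in c]) ->
  pm G (~: [set x in map kin c]).
Proof.
move=> nc [f fP].
have memc x : x != None -> (kin x \in map kin c) = (x \in c).
  move=> xN; apply/mapP/idP => [[y yc /kin_inj]|xc]; last by exists x.
  by move=> /(_ xN) -> //; apply: contraNneq nc => <-.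
have {}fP x : x \notin c -> [/\ f x \notin c, adj kernel x (f x) & f (f x) = x].
  by move=> xc; have := fP x; rewrite !inE; apply.
have [fN aN ffN] := fP None nc.
have f0 : f None != None by apply: contraTneq aN => ->; rewrite /adj mu_si.
set y0 := kin (f None); have y0Y : y0 \in Y := kin_in f0.
have [x0 [z0 [x0Y]]] : exists x z, [/\ x \in ~: Y, z \in [set y0] & adj G x z].
  by apply: e_gt0P; rewrite -kernel_None.
rewrite inE => /eqP-> {z0} a0.
have sy0 : si G y0 = s.
  apply/eqP; apply/negPn/negP => sy; have : 0 < out G (~~ s) Y; last by rewrite outY.
  apply: (e_gt0 (x := y0) (y := x0)) => //; last by rewrite adjC.
  by rewrite in_sd y0Y; move: sy; case: (si G y0); case: (s).
have sx0 : si G x0 = ~~ s by rewrite adjC in a0; rewrite (adj_si a0) sy0.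
have pmZ := pm_outside conn dY outY x0Y sx0.
pose A := (Y :\: [set x in map kin c]) :\ y0.
have pmA : pm G A.
  have AP x : x != None -> (kin x \in A) = (x \notin c) && (x != f None).
    move=> xN; rewrite in_setD1 in_setD inE memc // (kin_in xN) andbT andbC; congr (_ && ~~ _).
    by apply/eqP/eqP => [/(kin_inj xN f0)|->].
  exists (fun z => kin (f (crep (~: Y) z))) => z zA.
  have zY : z \in Y by move: zA; rewrite in_setD1 in_setD => /and3P[].
  have [xN zE] := crep_in zY; set x := crep (~: Y) z in xN zE *.
  move: zA; rewrite -zE AP // => /andP[xc xf]; have [fc ax ff] := fP x xc.
  have fxN : f x != None by apply: contraNneq xf => fx; rewrite -fx ff.
  rewrite AP // fc crepK // ff /adj -kin_mu //; split=> //.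
  by apply: contraNneq xN => fx; rewrite -ff fx ffN.
have y0c : y0 \notin map kin c by rewrite memc.
have cY z : z \in map kin c -> z \in Y.
  by case/mapP => x xc ->; apply: kin_in; apply: contraNneq nc => <-.
have -> : ~: [set x in map kin c] = A :|: ([set y0; x0] :|: (~: Y :\ x0)).
  apply/setP => z; rewrite /A !inE.
  case: (boolP (z \in map kin c)) => /= zc.
    rewrite (cY z zc) /= !andbF orbF /=; apply/esym/negP => /orP[] /eqP zE.
      by rewrite -zE zc in y0c.
    by move: x0Y; rewrite in_setC -zE cY.
  by case: (z == y0); case: (z == x0); case: (z \in Y).
rewrite in_setC in x0Y.
apply: pmU; [|exact: pmA|apply: pmU; [|by apply: pm2; rewrite adjC|exact: pmZ]].
- apply/pred0P => z /=; rewrite /A !inE.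
  case: (eqVneq z y0) => //= zy; case: (eqVneq z x0) => [->|_]; first by rewrite (negPf x0Y) andbF.
  by case: (z \in Y); rewrite ?andbF.
- apply/pred0P => z /=; rewrite !inE.
  by case: (eqVneq z x0) => [->|_]; rewrite ?andbF //= orbF; case: eqP => // ->; rewrite y0Y.
Qed.

Lemma kernel_brace : brace kernel None.
Proof.
split; first exact: kernel_cut.
- move=> c gc nc; exact: (no_gcycle4 conn U (kin_gcycle gc nc)).
- move=> c gc nc pmc; have gc' := kin_gcycle gc nc.
  by have [col] := cycle_colouring (k := 2) conn isT gc' (kernel_pm nc pmc); apply: U.
- by rewrite card_ctype setCK.
Qed.

(** At least one of the two lobes of an 8-cycle missing [None] also misses [None]. With eight
    vertices on the cycle and [None] elsewhere, it has at most 32 - 9 = 23 vertices. *)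
Lemma kernel_heawood : #|Y| <= 31 -> exists t p q, heawood kernel t p q.
Proof.
move=> Y31; have V32 : #|ctype (~: Y)| <= 32 by rewrite card_ctype setCK.
have [c gc nc] := three_pole_cycle kernel_brace V32.
have [P [hP hQ _]] := lobes (br_no8 kernel_brace) gc nc.
set Q := ~: ([set x in c] :|: P) in hQ.
have cc : #|[set x in c]| = 8 by rewrite cardsE; case/and3P: gc => /eqP <- /card_uniqP.
have [dPC _ _] := hP; have [dQC _ _] := hQ.
have cardT : 8 + #|P| + #|Q| = #|ctype (~: Y)|.
  by rewrite -cc; apply: card_disjoint3.
case: (boolP (None \in P)) => nP; last first.
  apply: (brace_heawood kernel_brace gc nc hP nP).
  have : 0 < #|Q| by apply/card_gt0P; exists None; rewrite !inE negb_or nc.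
  move: cardT V32; clear; lia.
have nQ : None \notin Q by rewrite !inE negb_or nP andbF.
apply: (brace_heawood kernel_brace gc nc hQ nQ).
have : 0 < #|P| by apply/card_gt0P; exists None.
move: cardT V32; clear; lia.
Qed.

End Kernel.

(** * The Heawood graph as incidence graph of the Fano plane *)

Lemma fanoC i j : fano i j = fano j i.
Proof. by rewrite /fano addnC. Qed.

Lemma all7P (P : nat -> bool) : all P (iota 0 7) -> forall i, i < 7 -> P i.
Proof. by move/allP => h i i7; apply: h; rewrite mem_iota. Qed.

Section HeawoodFacts.
Variables (V : finType) (G : bicubic V).
Notation si := (si G).
Notation adj := (adj G).

Lemma hw_swap t p q : heawood G t p q -> heawood G (~~ t) q p.
Proof.
case=> hp hq hm ha; split; rewrite ?negbK //.
  by move=> i j i7 j7; rewrite mu_sym hm // fanoC.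
by move=> x; have [i i7 h] := ha x; exists i => //; case: h; auto.
Qed.

Section Labelled.
Variables (t : bool) (p q : nat -> V).
Hypothesis Hw : heawood G t p q.

Lemma hw_label x : si x = t -> exists2 i, i < 7 & x = p i.
Proof.
move=> sx; have [i i7 [->|xE]] := hw_all Hw x; first by exists i.
by move: sx; rewrite xE (hw_q Hw i7); case: (t).
Qed.

Lemma hw_adj i j : i < 7 -> j < 7 -> adj (p i) (q j) = fano i j.
Proof. by move=> i7 j7; rewrite /adj (hw_mu Hw) //; case: (fano i j). Qed.

(** Two points of the Fano plane lie on a common line. This and the next facts are decided by
    running through all labels; [hw_swap] gives their duals. *)
Lemma hw_common_t x y : si x = t -> si y = t -> exists z, adj x z && adj y z.
Proof.
move=> /hw_label[i i7 ->] /hw_label[j j7 ->].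
have chk : all (fun i => all (fun j => has (fun k => fano i k && fano j k) (iota 0 7)) (iota 0 7)) (iota 0 7) by [].
have /hasP[k] := all7P (all7P chk i7) j7; rewrite mem_iota /= => k7 h.
by exists (q k); rewrite !hw_adj.
Qed.

Lemma hw_private_t x y : si x = t -> si y = t -> x != y -> exists z, adj x z && ~~ adj y z.
Proof.
move=> /hw_label[i i7 ->] /hw_label[j j7 ->] xy.
have ij : i != j by apply: contraNneq xy => ->.
have chk : all (fun i => all (fun j => (i == j) || has (fun k => fano i k && ~~ fano j k) (iota 0 7)) (iota 0 7)) (iota 0 7) by [].
have := all7P (all7P chk i7) j7; rewrite (negPf ij) => /hasP[k]; rewrite mem_iota /= => k7 h.
by exists (q k); rewrite !hw_adj.
Qed.

Lemma hw_unique_t x y z z' : si x = t -> si y = t -> x != y ->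
  adj x z -> adj y z -> adj x z' -> adj y z' -> z = z'.
Proof.
move=> sx sy xy xz yz xz' yz'.
have lab w : adj x w -> exists2 k, k < 7 & w = q k.
  move/adj_si; rewrite sx => sw; have [i i7 [wE|->]] := hw_all Hw w; last by exists i.
  by move: sw; rewrite wE (hw_p Hw i7); case: (t).
have [k k7 zE] := lab z xz; have [k' k7' zE'] := lab z' xz'; subst z z'.
move: xy xz yz xz' yz'; have [i i7 ->] := hw_label sx; have [j j7 ->] := hw_label sy.
rewrite !hw_adj // => xy h1 h2 h3 h4; have ij : i != j by apply: contraNneq xy => ->.
have chk : all (fun i => all (fun j => (i == j) || all (fun k => all (fun k' =>
   [&& fano i k, fano j k, fano i k' & fano j k'] ==> (k == k')) (iota 0 7)) (iota 0 7)) (iota 0 7)) (iota 0 7) by [].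
have := all7P (all7P chk i7) j7; rewrite (negPf ij) orFb => h.
by have := all7P (all7P h k7) k7'; rewrite h1 h2 h3 h4 => /eqP->.
Qed.

Lemma hw_inj i j : i < 7 -> j < 7 -> p i = p j -> i = j.
Proof.
move=> i7 j7 pij.
have chk : all (fun i => all (fun j => all (fun k => fano i k == fano j k) (iota 0 7) ==> (i == j)) (iota 0 7)) (iota 0 7) by [].
have /implyP h := all7P (all7P chk i7) j7; apply/eqP/h/allP => k; rewrite mem_iota => k7.
by rewrite -!hw_adj // pij.
Qed.

End Labelled.

Variables (t : bool) (p q : nat -> V).
Hypothesis Hw : heawood G t p q.

Lemma hw_common x y : si x = si y -> exists z, adj x z && adj y z.
Proof.
move=> sxy; case: (eqVneq (si y) t) => sy.
  by apply: (hw_common_t Hw); rewrite ?sxy.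
have sy' : si y = ~~ t by move: sy; case: (si y); case: (t).
by apply: (hw_common_t (hw_swap Hw)); rewrite ?sxy.
Qed.

Lemma hw_private x y : si x = si y -> x != y -> exists z, adj x z && ~~ adj y z.
Proof.
move=> sxy; case: (eqVneq (si y) t) => sy.
  by apply: (hw_private_t Hw); rewrite ?sxy.
have sy' : si y = ~~ t by move: sy; case: (si y); case: (t).
by apply: (hw_private_t (hw_swap Hw)); rewrite ?sxy.
Qed.

Lemma hw_unique x y z z' : si x = si y -> x != y ->
  adj x z -> adj y z -> adj x z' -> adj y z' -> z = z'.
Proof.
move=> sxy; case: (eqVneq (si y) t) => sy.
  by apply: (hw_unique_t Hw); rewrite ?sxy.
have sy' : si y = ~~ t by move: sy; case: (si y); case: (t).
by apply: (hw_unique_t (hw_swap Hw)); rewrite ?sxy.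
Qed.

Lemma hw_mu_le1 x y : mu G x y <= 1.
Proof.
case: (boolP (adj x y)) => [a|]; last by rewrite /adj -eqn0Ngt => /eqP->.
have [i i7 [xE|xE]] := hw_all Hw x; have [j j7 [yE|yE]] := hw_all Hw y; rewrite xE yE.
- by rewrite mu_si ?(hw_p Hw).
- by rewrite (hw_mu Hw) //; case: (fano _ _).
- by rewrite mu_sym (hw_mu Hw) //; case: (fano _ _).
- by rewrite mu_si ?(hw_q Hw).
Qed.

Lemma hw_card : #|V| = 14.
Proof.
pose l := [seq p i | i <- iota 0 7] ++ [seq q i | i <- iota 0 7].
have ul : uniq l.
  rewrite cat_uniq; apply/and3P; split.
  - rewrite map_inj_in_uniq ?iota_uniq // => i j; rewrite !mem_iota => i7 j7; exact: (hw_inj Hw).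
  - apply/hasPn => x /mapP[j]; rewrite mem_iota => j7 -> {x}.
    apply/mapP => -[i]; rewrite mem_iota => i7 /(congr1 si); rewrite (hw_p Hw i7) (hw_q Hw j7).
    by case: (t).
  - rewrite map_inj_in_uniq ?iota_uniq // => i j; rewrite !mem_iota => i7 j7; exact: (hw_inj (hw_swap Hw)).
transitivity (size l); last by rewrite size_cat !size_map.
rewrite -(card_uniqP ul); apply: eq_card => x; rewrite [RHS]mem_cat; apply/esym.
by have [i i7 [->|->]] := hw_all Hw x; apply/orP; [left|right]; apply: map_f; rewrite mem_iota.
Qed.

End HeawoodFacts.

(** * Contracting a set with Heawood kernel preserves uncolourability *)

Section Uncolourable.
Variables (V : finType) (G : bicubic V) (Y : {set V}) (s : bool).
Hypothesis U : uncolourable G.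
Hypothesis dY : d G Y = 3.
Hypothesis outY : out G (~~ s) Y = 0.
Notation K := (kernel dY outY).
Notation G1 := (con dY outY).
Notation kin := (kin dY).
Notation krep := (crep (~: Y)).
Variables (t : bool) (p q : nat -> ctype (~: Y)).
Hypothesis Hw : heawood K t p q.

Lemma kside x : x \in Y -> si K (krep x) = si G x.
Proof. by move=> xY; have [] := crep_in dY xY; case: (krep x) => // z _ /= ->. Qed.

Lemma kadj x y : x \in Y -> y \in Y -> adj K (krep x) (krep y) = adj G x y.
Proof.
move=> xY yY; have [xN xE] := crep_in dY xY; have [yN yE] := crep_in dY yY.
by rewrite /adj kin_mu // xE yE.
Qed.

Lemma kadj_None x : x \in Y -> adj K None (krep x) = [exists w in ~: Y, adj G x w].
Proof.
move=> xY; have [xN xE] := crep_in dY xY; rewrite /adj kernel_None // xE.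
apply/idP/exists_inP => [/e_gt0P[w [z [wY]]]|[w wY a]].
  by rewrite inE => /eqP-> a; exists w => //; rewrite mu_sym.
by apply: (e_gt0 wY (set11 x)); rewrite adjC.
Qed.

Lemma kin_adj x z : x \in Y -> z != None -> adj K (krep x) z -> adj G x (kin z) /\ kin z \in Y.
Proof.
move=> xY zN a; have zY := kin_in dY zN; split=> //.
by rewrite -kadj // crepK.
Qed.

Lemma outer_unique b w w' : b \in Y -> w \notin Y -> w' \notin Y -> adj G b w -> adj G b w' -> w = w'.
Proof.
move=> bY wY wY' a a'; apply/eqP/negPn/negP => ww.
have [bN bE] := crep_in dY bY; have := hw_mu_le1 Hw None (krep b); rewrite kernel_None // bE eC.
apply/negP; rewrite -ltnNge; apply: (@leq_trans #|[set w; w']|); first by rewrite cards2 ww.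
apply: (@leq_trans (e G [set b] [set w; w'])).
  by apply: e1_ge => z; rewrite !inE => /orP[] /eqP->.
by apply: eS => //; apply/subsetP => z; rewrite !inE => /orP[] /eqP->.
Qed.

Lemma crep_Y x : x \in Y -> crep Y x = None.
Proof. by move=> xY; rewrite /crep insubN // negbK. Qed.

Lemma con_nbr b z : b \notin Y -> adj G1 (crep Y b) z ->
  exists2 x, adj G b x & crep Y x = z.
Proof.
move=> bY; have bE : crep Y b = Some (Sub b bY) by rewrite /crep insubT.
rewrite bE; case: z => [z|].
  by rewrite /adj con_mu_Some => a; exists (val z); rewrite // /crep valK.
rewrite adjC /adj con_mu_None => /e_gt0P[x [y [xY]]]; rewrite inE => /eqP-> a.
by exists x; [rewrite mu_sym|apply: crep_Y].
Qed.

Lemma con_nbr_None z : adj G1 None z -> exists2 w, w \notin Y & z = crep Y w /\ exists2 b, b \in Y & adj G b w.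
Proof.
case: z => [z|]; last by rewrite /adj mu_si.
rewrite /adj con_mu_None => /e_gt0P[x [y [xY]]]; rewrite inE => /eqP-> a.
by exists (val z); [exact: (valP z)|rewrite /crep valK; split=> //; exists x].
Qed.

(** Here [None] is a line of the Fano plane [K]. Its points take the colour of the contracted point
    and the remaining points of [Y] the opposite one. Every other line meets [None] in a point and
    has a point off it, so it sees both colours. *)
Lemma uncolourable_con_point : s -> uncolourable G1.
Proof.
move=> sT c1 good; have sN : si K None = false by rewrite /= sT.
pose c x := if x \in Y then (if adj K None (krep x) then c1 None else ~~ c1 None) else c1 (crep Y x).
apply: (U (c := c)) => b sb; case: (boolP (b \in Y)) => bY.
  have sb' : si K (krep b) = si K None by rewrite kside // sN (negPf sb).
  have bN : krep b != None by have [] := crep_in dY bY.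
  have [z /andP[az aN]] := hw_common Hw sb'; have [w /andP[aw nN]] := hw_private Hw sb' bN.
  have pt u : adj K (krep b) u -> u != None.
    by move/adj_si; rewrite kside // (negPf sb); apply: contra_eqN => /eqP->; rewrite sN.
  have [a1 zY] := kin_adj bY (pt _ az) az; have [a2 wY] := kin_adj bY (pt _ aw) aw.
  exists (kin z), (kin w); split=> //.
  by rewrite /c zY wY !crepK ?pt // aN (negPf nN); case: (c1 None).
have sb1 : ~~ si G1 (crep Y b) by rewrite /crep insubT.
have [z [z' [az az' cz]]] := good _ sb1.
have lift u : adj G1 (crep Y b) u -> exists2 x, adj G b x & c x = c1 u.
  move=> /(con_nbr bY)[x a <-]; exists x => //; rewrite /c; case: (boolP (x \in Y)) => // xY.
  rewrite kadj_None // crep_Y //; have -> // : [exists w in ~: Y, adj G x w].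
  by apply/exists_inP; exists b; [rewrite inE|rewrite adjC].
have [x ax cx] := lift z az; have [x' ax' cx'] := lift z' az'.
by exists x, x'; rewrite cx cx'.
Qed.

(** Here [None] is a point of the Fano plane [K]. A point of [Y] is joined to it by one line, and
    takes the colour opposite to the outer end of that line. A line missing [None] meets all three
    lines through it, whose outer ends carry both colours because the contracted block does. *)
Lemma uncolourable_con_block : ~~ s -> uncolourable G1.
Proof.
move=> sF c1 good; have sN : si K None = true by rewrite /= sF.
pose cand x := [pick w | (w \notin Y) && [exists b in Y, adj G b x && adj G b w]].
pose c x := if x \in Y then (if cand x is Some w then ~~ c1 (crep Y w) else true) else c1 (crep Y x).
have inner x y : x \in Y -> y \notin Y -> adj G x y -> ~~ si G x.
  move=> xY yY a; apply/negP => sx; have : 0 < out G (~~ s) Y; last by rewrite outY.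
  by apply: (e_gt0 (x := x) (y := y)) => //; rewrite ?in_sd ?xY ?sx ?sF // inE.
(* The line joining [x] to [None] and its outer end are unique, so the choice made by [pick] is
   forced. *)
have cE b w x : b \in Y -> w \notin Y -> x \in Y -> adj G b w -> adj G b x -> c x = ~~ c1 (crep Y w).
  move=> bY wY xY bw bx; rewrite /c xY /cand; case: pickP => [w' /andP[wY' /exists_inP[b' bY' /andP[bx' bw']]]|/(_ w)].
    suff -> : w' = w by [].
    have bb : b = b'.
      have [bN bE] := crep_in dY bY; have [bN' bE'] := crep_in dY bY'.
      rewrite -bE -bE'; congr kin; have [xN xE] := crep_in dY xY.
      have sx : si K None = si K (krep x).
        by rewrite sN kside // (adj_si bx) (inner b w).
      apply: (hw_unique Hw sx); rewrite ?kadj_None // ?kadj // 1?eq_sym // 1?adjC //.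
      - by apply/exists_inP; exists w; rewrite // inE.
      - by apply/exists_inP; exists w'; rewrite // inE.
    by subst b'; apply: (outer_unique bY).
  by rewrite wY => /negbT/negP[]; apply/exists_inP; exists b => //; rewrite bx bw.
apply: (U (c := c)) => b sb; case: (boolP (b \in Y)) => bY; last first.
  have sb1 : ~~ si G1 (crep Y b) by rewrite /crep insubT.
  have [z [z' [az az' cz]]] := good _ sb1.
  have lift u : adj G1 (crep Y b) u -> exists2 x, adj G b x & c x = c1 u.
    move=> /(con_nbr bY)[x a <-]; exists x => //; rewrite /c; case: (boolP (x \in Y)) => // xY.
    by rewrite adjC in a; have := inner x b xY bY a; rewrite -[~~ _](adj_si a) (negPf sb).
  have [x ax cx] := lift z az; have [x' ax' cx'] := lift z' az'.
  by exists x, x'; rewrite cx cx'.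
case: (boolP (adj K None (krep b))) => aN.
  have := aN; rewrite kadj_None // => /exists_inP[w]; rewrite inE => wY aw.
  have [b' [x [bb xY ax]]] : exists b' x, [/\ b' \in [set b], x \in Y & adj G b' x].
    apply: e_gt0P; have [bN bE] := crep_in dY bY; have := hw_mu_le1 Hw None (krep b); rewrite kernel_None // bE eC.
    have := e_split G [set b] Y; rewrite cards1; clear; lia.
  move: ax; rewrite (set1P bb) => ax; exists w, x; split=> //.
  by rewrite (cE b w x) // /c (negPf wY); case: (c1 _).
have sN1 : ~~ si G1 None by [].
have [z [z' [az az' cz]]] := good _ sN1.
have lift u : adj G1 None u -> exists2 x, adj G b x & c x = ~~ c1 u.
  case/con_nbr_None => w wY [-> [b1 bY1 bw1]].
  have sb1 : si K (krep b) = si K (krep b1).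
    by rewrite !kside // (negPf sb) (negPf (inner b1 w _ _ _)).
  have [y /andP[ay ay1]] := hw_common Hw sb1.
  have yN : y != None by apply: contraNneq aN => <-; rewrite adjC.
  have [ab yY] := kin_adj bY yN ay; have [ab1 _] := kin_adj bY1 yN ay1.
  by exists (kin y) => //; apply: (cE b1 w).
have [x ax cx] := lift z az; have [x' ax' cx'] := lift z' az'.
by exists x, x'; rewrite cx cx'; split=> //; rewrite (inj_eq negb_inj).
Qed.

Lemma uncolourable_con : uncolourable G1.
Proof.
have [h|h] : s \/ ~~ s by case: (s); auto.
- exact: uncolourable_con_point.
- exact: uncolourable_con_block.
Qed.

End Uncolourable.

(** * Disjoint Heawood pieces *)

Section Step.
Variables (V : finType) (G : bicubic V).
Notation mu := (mu G).
Notation si := (si G).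
Notation adj := (adj G).
Notation e := (e G).
Notation d := (d G).
Notation sd := (sd G).
Notation out := (out G).
Implicit Types (X Y Z : {set V}) (x y z : V).
Hypothesis conn : connected G.
Hypothesis U : uncolourable G.

Lemma heawood_kernel_exists Y0 : clean G Y0 -> 1 < #|Y0| -> #|Y0| <= 31 -> Y0 != setT -> d Y0 <= 3 ->
  exists Y s (dY : d Y = 3) (oY : out (~~ s) Y = 0),
    [/\ Y \subset Y0, #|Y| = 13 & exists t p q, heawood (kernel dY oY) t p q].
Proof.
move=> cl c1 c31 T0 d0; have [Y [YY0 Y2 dY minY]] := kernel_exists conn cl c1 T0 d0.
have [s [_ oY]] := cut3_side dY.
have Y31 : #|Y| <= 31 by apply: leq_trans (subset_leq_card YY0) c31.
have [t [p [q Hw]]] := kernel_heawood conn U Y2 dY oY minY Y31.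
exists Y, s, dY, oY; split=> //; last by exists t, p, q.
by have := hw_card Hw; rewrite card_ctype setCK => -[].
Qed.

Definition cleanb Y := [forall x in Y, forall y in Y, mu x y <= 1].

Lemma cleanP Y : reflect (clean G Y) (cleanb Y).
Proof.
apply: (iffP forall_inP) => [h x y xY yY|h x xY].
  by have /forall_inP := h x xY; apply.
by apply/forall_inP => y yY; apply: h.
Qed.

Lemma mu_add x y y' : y != y' -> mu x y + mu x y' <= 3.
Proof.
move=> yy; rewrite -!e11 -eUr; last by rewrite disjoints1 inE.
have := e_split G [set x] ([set y] :|: [set y']); rewrite cards1; clear; lia.
Qed.

(* The three vertices of the smaller side of the complement have all their neighbours
   among four vertices, so two of them without multiple edges lie on a 4-cycle. *)
Lemma seven_left_false z Y : clean G (~: [set z]) -> d Y = 3 -> #|Y| = 13 -> #|V| = 20 -> False.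
Proof.
move=> cl dY cY cV; set R := ~: Y.
have cR : #|R| = 7 by have := cardsC Y; rewrite -/R cY cV; clear; lia.
have dR : d R = 3 by rewrite dC.
have [s [o1 o2]] := cut3_side dR.
have [c4 c3] : #|sd R s| = 4 /\ #|sd R (~~ s)| = 3.
  have := cutE G s R; have := cutE G (~~ s) R; have := card_sd G s R; rewrite o1 o2 cR; clear; lia.
have multi x y : 1 < mu x y -> x = z \/ y = z.
  move=> h; case: (eqVneq x z) => [|xz]; first by left.
  case: (eqVneq y z) => [|yz]; first by right.
  by have := cl x y; rewrite !inE xz yz => /(_ isT isT); rewrite leqNgt h.
pose simple l := [forall y, mu l y <= 1].
have nonsimple l : ~~ simple l -> exists2 y, 1 < mu l y & l = z \/ y = z.
  by rewrite negb_forall => /existsP[y]; rewrite -ltnNge => h; exists y => //; apply: multi.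
(* All multiple edges meet [z], whose degree leaves room for only one, so at most one vertex of a
   given side is on a multiple edge. *)
have one l l' : l != l' -> si l = si l' -> simple l || simple l'.
  move=> ll sl; apply/negPn/negP; rewrite negb_or => /andP[/nonsimple[y m h] /nonsimple[y' m' h']].
  case: h => hz; case: h' => hz'; subst.
  - by rewrite eqxx in ll.
  - by move: m'; rewrite mu_si.
  - by move: m; rewrite mu_si.
  - by have := mu_add z ll; rewrite mu_sym (mu_sym G z l'); move: m m'; clear; lia.
have : 1 < #|[set l in sd R (~~ s) | simple l]|.
  rewrite ltnNge; apply/negP => le1.
  have : 1 < #|[set l in sd R (~~ s) | ~~ simple l]|.
    have := cardsID [set l | simple l] (sd R (~~ s)); rewrite c3.
    have -> : sd R (~~ s) :&: [set l | simple l] = [set l in sd R (~~ s) | simple l].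
      by apply/setP => l; rewrite !inE.
    have -> : sd R (~~ s) :\: [set l | simple l] = [set l in sd R (~~ s) | ~~ simple l].
      by apply/setP => l; rewrite !inE andbC.
    move: le1; clear; lia.
  case/card_gt1P => l [l' [+ + ll]]; rewrite !inE => /andP[/andP[_ /eqP sl] nl] /andP[/andP[_ /eqP sl'] nl'].
  by have := one l l' ll; rewrite sl sl' (negPf nl) (negPf nl') => /(_ erefl).
case/card_gt1P => l [l' [+ + ll]]; rewrite inE => /andP[lR sl]; rewrite inE => /andP[lR' sl'].
have nbc x : x \in sd R (~~ s) -> simple x -> #|[set y in sd R s | adj x y]| = 3.
  move=> xR /forallP sx.
  have e0 : e [set x] (~: R) = 0.
    by apply/eqP; rewrite -leqn0 -o2; apply: eS; rewrite // sub1set.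
  have := e_split G [set x] R; rewrite cards1 muln1 e0 addn0 => <-.
  have xE : [set x] = sd [set x] (~~ s).
    by apply/setP => y; rewrite in_sd inE; case: eqP => //= ->; move: xR; rewrite in_sd => /andP[_ ->].
  rewrite xE e_sd negbK -xE e1 -sum1_card big_mkcond [RHS]big_mkcond /=; apply: eq_bigr => y _.
  by rewrite inE /Cubic.adj; have := sx y; case: (y \in _); case: (mu x y) => [|[|]].
have := nbc _ lR sl; have := nbc _ lR' sl'.
set A := [set y in _ | _]; set B := [set y in _ | _] => cA cB.
have : 1 < #|B :&: A|.
  have := cardsUI B A; rewrite cA cB; have : #|B :|: A| <= 4; last by clear; lia.
  by rewrite -c4; apply: subset_leq_card; apply/subsetP => y; rewrite !inE => /orP[] /andP[].
case/card_gt1P => x [y [+ + xy]]; rewrite !inE => /andP[/andP[xR ax] /andP[_ ax']] /andP[/andP[yR ay] /andP[_ ay']].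
apply: (no_gcycle4 conn U (c := [:: l; x; l'; y])).
have ne u w : adj u w -> u != w by move=> a; apply: contraTneq a => ->; rewrite /Cubic.adj mu_si.
rewrite /gcycle /= !inE !negb_or ll xy ax (adjC G x) ax' ay' (adjC G y) ay.
by rewrite (ne l x) // (ne l y) // eq_sym (ne l' x) // (ne l' y).
Qed.

End Step.

(** * The Heawood graph with one edge removed *)

Section Flag.
Variables (V : finType) (G : bicubic V).

(** The maps [i -> i0 + m i] and [j -> j0 + m j] preserve the incidence if
    [i0 + j0 + m {0, 1, 3} = {0, 1, 3}] modulo 7. For [i0 + j0] equal to 0, 1, 3 this holds with [m]
    equal to 1, 2, 4. *)
Lemma heawood_flag t p q x y : heawood G t p q -> si G x = t -> adj G x y ->
  exists p' q', [/\ heawood G t p' q', p' 0 = x & q' 0 = y].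
Proof.
move=> Hw sx a; have [i0 i07 xE] := hw_label Hw sx.
have sy : si G y = ~~ t by rewrite (adj_si a) sx.
have [j0 j07 yE] := hw_label (hw_swap Hw) sy.
move: a; rewrite xE yE (hw_adj Hw) // => f0.
pose m i0 j0 := nth 1 [:: 1; 2; 1; 4] ((i0 + j0) %% 7).
pose mv m i0 i := (i0 + m * i) %% 7.
have lt m' i : mv m' i0 i < 7 by rewrite /mv ltn_mod.
have lt' m' i : mv m' j0 i < 7 by rewrite /mv ltn_mod.
have chk1 : all (fun i0 => all (fun j0 => fano i0 j0 ==> all (fun i => all (fun j =>
    fano (mv (m i0 j0) i0 i) (mv (m i0 j0) j0 j) == fano i j) (iota 0 7)) (iota 0 7)) (iota 0 7)) (iota 0 7).
  by vm_compute.
have chk2 : all (fun i0 => all (fun j0 => fano i0 j0 ==> all (fun k =>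
    has (fun i => k == mv (m i0 j0) i0 i) (iota 0 7) && has (fun j => k == mv (m i0 j0) j0 j) (iota 0 7))
    (iota 0 7)) (iota 0 7)) (iota 0 7).
  by vm_compute.
exists (fun i => p (mv (m i0 j0) i0 i)), (fun j => q (mv (m i0 j0) j0 j)); split.
- split.
  + by move=> i _; apply: (hw_p Hw).
  + by move=> i _; apply: (hw_q Hw).
  + move=> i j i7 j7; rewrite (hw_mu Hw) //; congr nat_of_bool; apply/eqP.
    have /implyP/(_ f0) h := all7P (all7P chk1 i07) j07.
    exact: (all7P (all7P h i7) j7).
  + move=> z; have [k k7 zE] := hw_all Hw z.
    have /implyP/(_ f0) h := all7P (all7P chk2 i07) j07.
    have /andP[/hasP[i] + ki /hasP[j] + kj] := all7P h k7; rewrite !mem_iota /= => i7 j7.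
    case: zE => ->; [exists i|exists j] => //; [left|right].
      by rewrite -(eqP ki).
    by rewrite -(eqP kj).
- by rewrite /mv muln0 addn0 modn_small.
- by rewrite /mv muln0 addn0 modn_small.
Qed.

End Flag.

Section Pieces.
Variables (V : finType) (G : bicubic V).

(** The edge taken out of the Heawood graph joins [P 0] and [Q 0]. *)
Record piece (P Q : nat -> V) : Prop := Piece {
  pc_P : forall i, i < 7 -> si G (P i);
  pc_Q : forall j, j < 7 -> ~~ si G (Q j);
  pc_mu : forall i j, i < 7 -> j < 7 -> mu G (P i) (Q j) = fano i j && (0 < i + j) }.

Section MakePiece.
Variables (Y : {set V}) (s : bool).
Hypothesis conn : connected G.
Hypothesis dY : d G Y = 3.
Hypothesis outY : out G (~~ s) Y = 0.
Notation K := (kernel dY outY).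
Notation kin := (kin dY).
Notation krep := (crep (~: Y)).

(** A vertex [w] that receives two of the three cut edges takes the place of [None] in the kernel;
    only the edge to [g], the inner end of the third cut edge, is lost. It cannot receive all three,
    for then no edge would leave [Y] together with [w]. *)
Lemma heawood_piece t p q w : heawood K t p q -> #|Y| + 1 < #|V| -> w \notin Y ->
  1 < e G Y [set w] -> exists P Q, piece P Q /\
    forall i, i < 7 -> P i \in w |: Y /\ Q i \in w |: Y.
Proof.
move=> Hw cV wY ew.
have ew2 : e G [set w] Y = 2.
  have : e G [set w] Y <= 3 by have := e_split G [set w] Y; rewrite cards1; clear; lia.
  have : e G [set w] Y != 3; last by rewrite eC; move: ew; clear; lia.
  apply/eqP => e3; have wYw : w \in w |: Y by rewrite setU11.
  have := d_remove G wYw; rewrite setU1K // dY.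
  have -> : e G [set w] (~: (w |: Y)) = 0.
    have := e_split G [set w] Y; rewrite cards1 e3.
    have : e G [set w] (~: (w |: Y)) <= e G [set w] (~: Y).
      by apply: eS => //; rewrite setCS subsetUr.
    clear; lia.
  have cwY := cardsU1 w Y; rewrite wY in cwY.
  have : 0 < d G (w |: Y).
    apply: conn; first by apply/set0Pn; exists w.
    by apply/eqP => T; move: cwY cV; rewrite T cardsT; clear; lia.
  clear; lia.
pose Z := ~: Y :\ w.
have wC : w \in ~: Y by rewrite inE.
have eZ y : e G (~: Y) [set y] = mu G w y + e G Z [set y].
  by rewrite -e11 -eU ?setD1K // disjoints1 !inE eqxx.
have eZY : e G Z Y = 1.
  have : e G (~: Y) Y = e G [set w] Y + e G Z Y by rewrite -eU ?setD1K // disjoints1 !inE eqxx.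
  by rewrite ew2 eC -/(d G Y) dY; clear; lia.
have [w' [g [wZ gY ag]]] : exists w' g, [/\ w' \in Z, g \in Y & adj G w' g] by apply: e_gt0P; rewrite eZY.
have kmu y : y \in Y -> mu K None (krep y) = mu G w y + e G Z [set y].
  by move=> yY; have [yN yE] := crep_in dY yY; rewrite kernel_None // yE eZ.
have gZ : 0 < e G Z [set g] by apply: (e_gt0 wZ (set11 g)).
have gw : mu G w g = 0 by have := hw_mu_le1 Hw None (krep g); rewrite kmu //; move: gZ; clear; lia.
have aNg : adj K None (krep g) by rewrite /adj kmu // gw.
have kmu' y : y \in Y -> y != g -> mu K None (krep y) = mu G w y.
  move=> yY yg; rewrite kmu //; suff -> : e G Z [set y] = 0 by rewrite addn0.
  have : e G Z [set g; y] <= 1.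
    by rewrite -eZY; apply: eS => //; apply/subsetP => u; rewrite !inE => /orP[] /eqP->.
  rewrite eUr; last by rewrite disjoints1 inE eq_sym.
  move: gZ; clear; lia.
pose lab x := if x is Some _ then kin x else w.
have labY x : x != None -> lab x = kin x by case: x.
have labN : lab None = w by [].
have labmu x y : si K x != si K y -> ~~ ((x == None) && (y == krep g)) -> ~~ ((y == None) && (x == krep g)) ->
    mu G (lab x) (lab y) = mu K x y.
  have one u : u != None -> u != krep g -> mu G w (kin u) = mu K None u.
    move=> uN ug; rewrite -{2}(crepK dY uN) kmu' //; first exact: kin_in.
    by apply: contraNneq ug => <-; rewrite crepK.
  case: (eqVneq x None) => [->|xN]; case: (eqVneq y None) => [->|yN] //.
  - by rewrite eqxx.
  - by move=> _ yg _; rewrite labN (labY y) // one.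
  - by move=> _ _ xg; rewrite labN (labY x) // mu_sym one // mu_sym.
  - by rewrite !labY // kin_mu.
have labg : mu G (lab None) (lab (krep g)) = 0.
  by have [gN gE] := crep_in dY gY; rewrite labN (labY (krep g)) // gE.
have gN : krep g != None by have [] := crep_in dY gY.
have labside x : si G (lab x) = si K x.
  case: x => [x|] //; have [y [u [yY]]] : exists y u, [/\ y \in Y, u \in [set w] & adj G y u].
    by apply: e_gt0P; apply: ltnW.
  rewrite inE => /eqP-> a; rewrite /= (adj_si a); congr (~~ _); apply/eqP/negPn/negP => sy.
  have : 0 < out G (~~ s) Y; last by rewrite outY.
  apply: (e_gt0 (x := y) (y := w)) => //; rewrite in_sd yY; by move: sy; case: (si G y); case: (s).
have {Hw t p q} [p [q Hw]] : exists p q, heawood K true p q.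
  by case: t Hw => Hw; [exists p, q|exists q, p; apply: (hw_swap Hw)].
(* By flag transitivity the lost edge gets the labels 0 and 0, whichever of its ends is the
   point. *)
have {p q Hw} [p [q [Hw flag]]] : exists p q, heawood K true p q /\
    ((p 0 = None /\ q 0 = krep g) \/ (p 0 = krep g /\ q 0 = None)).
  case: (boolP (si K None)) => sN.
    by have [p' [q' [Hw' h1 h2]]] := heawood_flag Hw sN aNg; exists p', q'; split=> //; left.
  have sg : si K (krep g) = true by rewrite (adj_si aNg) sN.
  have [|p' [q' [Hw' h1 h2]]] := heawood_flag Hw sg (y := None); first by rewrite adjC.
  by exists p', q'; split=> //; right.
exists (lab \o p), (lab \o q); split; last first.
  have labin x : lab x \in w |: Y.
    case: x => [x|]; last by rewrite setU11.
    by rewrite inE; apply/orP; right; exact: (@kin_in _ _ _ dY (Some x)).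
  by move=> i _; split; apply: labin.
split.
- by move=> i i7; rewrite /= labside (hw_p Hw).
- by move=> i i7; rewrite /= labside (hw_q Hw).
move=> i j i7 j7 /=; case: (posnP (i + j)) => [ij|ij].
  have [-> ->] : i = 0 /\ j = 0 by move: ij; clear; lia.
  rewrite andbF; case: flag => [[-> ->]|[-> ->]]; first exact: labg.
  by rewrite mu_sym; exact: labg.
rewrite andbT -(hw_mu Hw) // labmu //.
- by rewrite (hw_p Hw) // (hw_q Hw).
- apply/negP => /andP[/eqP pN /eqP qg]; case: flag => [[p0 q0]|[p0 q0]].
    have i0 : i = 0 by apply: (hw_inj Hw) => //; rewrite pN p0.
    have j0 : j = 0 by apply: (hw_inj (hw_swap Hw)) => //; rewrite qg q0.
    by rewrite i0 j0 in ij.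
  by have := hw_p Hw i7; have := hw_q Hw (isT : 0 < 7); rewrite pN q0 => /= ->.
- apply/negP => /andP[/eqP qN /eqP pg]; case: flag => [[p0 q0]|[p0 q0]].
    by have := hw_q Hw j7; have := hw_p Hw (isT : 0 < 7); rewrite qN p0 => /= ->.
  have i0 : i = 0 by apply: (hw_inj Hw) => //; rewrite pg p0.
  have j0 : j = 0 by apply: (hw_inj (hw_swap Hw)) => //; rewrite qN q0.
  by rewrite i0 j0 in ij.
Qed.

End MakePiece.
End Pieces.

Lemma multi_edge (V : finType) (G : bicubic V) (z u : V) : ~ clean G (~: [set z]) ->
  (forall x y, 1 < mu G x y -> [|| x == z, y == z, x == u | y == u]) ->
  exists w, [/\ w != z, w != u & 1 < mu G u w].
Proof.
move=> ncl h; have : ~~ cleanb G (~: [set z]) by apply/negP => /cleanP.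
rewrite negb_forall_in => /exists_inP[x]; rewrite !inE => xz.
rewrite negb_forall_in => /exists_inP[y]; rewrite !inE -ltnNge => yz m.
have := h x y m; rewrite (negPf xz) (negPf yz) /= => /orP[] /eqP e.
  exists y; split=> //; last by rewrite -e.
  by apply/eqP => yu; move: m; rewrite e yu mu_si.
exists x; split=> //; last by rewrite mu_sym -e.
by apply/eqP => xu; move: m; rewrite e xu mu_si.
Qed.

(** * Two contractions in a graph with 44 vertices *)

Section Chain.
Variables (V : finType) (G : bicubic V).
Notation mu := (mu G).
Notation d := (d G).
Implicit Types (X Y Z : {set V}) (x y z : V).
Hypothesis conn : connected G.
Hypothesis U : uncolourable G.
Hypothesis V44 : #|V| = 44.
Hypothesis simple : forall x y, mu x y <= 1.

(** Without such a cut the graph is a brace for every choice of [v]. Of the 36 vertices off the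
    cycle one lobe has at most 18, and [v] can be taken in the other lobe; so the graph would be the
    Heawood graph, which has only 14 vertices. *)
Lemma small_cut : (exists c, gcycle G 8 c) -> exists X, [/\ 1 < #|X|, #|X| <= 22 & d X <= 3].
Proof.
case=> c gc.
case: (boolP [exists X : {set V}, [&& 1 < #|X|, 1 < #|~: X| & d X <= 3]]).
  case/existsP => X /and3P[X1 X2 dX]; have := cardsC X; rewrite V44 => cX.
  have [Xl|Xg] := leqP #|X| 22; first by exists X.
  by exists (~: X); rewrite dC; split=> //; move: cX Xg; clear; lia.
rewrite negb_exists => /forallP nocut; exfalso.
have br v : brace G v.
  split.
  - by move=> X X1 X2; have := nocut X; rewrite X1 X2 -ltnNge.
  - by move=> c' gc' _; apply: (no_gcycle4 conn U gc').
  - by move=> c' gc' _ pmc; have [col] := cycle_colouring (k := 2) conn isT gc' pmc; apply: U.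
  - by rewrite V44.
have cc : #|[set x in c]| = 8 by rewrite cardsE; case/and3P: gc => /eqP <- /card_uniqP.
have [v0 v0c] : exists v, v \notin c.
  have /card_gt0P[v] : 0 < #|~: [set x in c]| by have := cardsC [set x in c]; rewrite V44 cc; clear; lia.
  by rewrite !inE; exists v.
have [P [hP hQ _]] := lobes (br_no8 (br v0)) gc v0c.
set Q := ~: ([set x in c] :|: P) in hQ.
have [dPC _ _] := hP; have := card_disjoint3 dPC; rewrite -/Q cc V44 => cPQ.
have fin s X X' v : lobe G s [set x in c] X -> #|X| <= 23 -> v \in X' -> [disjoint X' & [set x in c]] ->
    [disjoint X & X'] -> False.
  move=> hX X23 vX dXC' dXX.
  have vc : v \notin c by have := disjointFr dXC' vX; rewrite inE => ->.
  have vX' : v \notin X by rewrite (disjointFl dXX vX).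
  have [t [p [q Hw]]] := brace_heawood (br v) gc vc hX vX' X23.
  by have := hw_card Hw; rewrite V44.
have dQC : [disjoint Q & [set x in c]] by case: hQ.
have dPQ : [disjoint P & Q].
  by rewrite -setI_eq0; apply/eqP/setP => x; rewrite !inE negb_or; case: (x \in P); rewrite ?andbF.
have [Pl|Pg] := leqP #|P| 18.
  have /card_gt0P[v vQ] : 0 < #|Q| by move: cPQ Pl; clear; lia.
  by apply: (fin true P Q v); rewrite // (leq_trans Pl).
have /card_gt0P[v vP] : 0 < #|P| by move: Pg; clear; lia.
apply: (fin false Q P v); rewrite // 1?disjoint_sym //.
by move: cPQ Pg; clear; lia.
Qed.

Theorem two_disjoint_pieces : (exists c, gcycle G 8 c) -> exists P1 Q1 P2 Q2,
  [/\ piece G P1 Q1, piece G P2 Q2 & forall i j, i < 7 -> j < 7 -> P1 i <> P2 j].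
Proof.
move=> /small_cut[X [X1 X22 dX]].
have XT : X != setT by apply/eqP => XT; move: X22; rewrite XT cardsT V44.
have cl : clean G X by move=> x y _ _; apply: simple.
have X31 : #|X| <= 31 by apply: leq_trans X22 _.
have [Y1 [s1 [dY1 [oY1 [_ cY1 [t1 [p1 [q1 Hw1]]]]]]]] := heawood_kernel_exists conn U cl X1 X31 XT dX.
pose G1 := con dY1 oY1.
have conn1 : connected G1 by apply: con_connected.
have U1 : uncolourable G1 by apply: (uncolourable_con U Hw1).
have V1 : #|ctype Y1| = 32.
  by rewrite card_ctype; have := cardsC Y1; rewrite cY1 V44; clear; lia.
pose X2 : {set ctype Y1} := ~: [set None].
have cX2 : #|X2| = 31 by have := cardsC [set None : ctype Y1]; rewrite cards1 V1 -/X2; clear; lia.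
have cl2 : clean G1 X2.
  by move=> [x|] [y|]; rewrite !inE // => _ _; rewrite con_mu_Some.
have X2T : X2 != setT by apply/eqP => T; have := in_setT (None : ctype Y1); rewrite -T !inE.
have dX2 : Cubic.d G1 X2 <= 3 by rewrite dC d1.
have X21 : 1 < #|X2| by rewrite cX2.
have X231 : #|X2| <= 31 by rewrite cX2.
have [Y2 [s2 [dY2 [oY2 [YX2 cY2 [t2 [p2 [q2 Hw2]]]]]]]] := heawood_kernel_exists conn1 U1 cl2 X21 X231 X2T dX2.
pose G2 := con dY2 oY2.
have conn2 : connected G2 by apply: con_connected.
have U2 : uncolourable G2 by apply: (uncolourable_con U1 Hw2).
have V2 : #|ctype Y2| = 20.
  by rewrite card_ctype; have := cardsC Y2; rewrite cY2 V1; clear; lia.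
have NY2 : None \notin Y2 by apply/negP => /(subsetP YX2); rewrite !inE.
pose z2 : ctype Y2 := None; pose z1 : ctype Y2 := Some (Sub (None : ctype Y1) NY2).
(* [G] itself is simple, so a multiple edge of [G2] meets one of the two contracted vertices. *)
have multi (x y : ctype Y2) : 1 < Cubic.mu G2 x y -> [|| x == z1, y == z1, x == z2 | y == z2].
  case: x => [x|]; last by rewrite !eqxx ?orbT.
  case: y => [y|]; last by rewrite !eqxx ?orbT.
  rewrite con_mu_Some.
  case Ex: (val x) => [x'|]; last first.
    by move=> _; apply/orP; left; apply/eqP; congr Some; apply: val_inj.
  case Ey: (val y) => [y'|]; last first.
    by move=> _; apply/orP; right; apply/orP; left; apply/eqP; congr Some; apply: val_inj.
  by rewrite con_mu_Some ltnNge simple.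
(* Otherwise a third set of 13 vertices could be found among the 20, leaving seven. *)
have noclean (z : ctype Y2) : ~ clean G2 (~: [set z]).
  move=> clz; have cz : #|~: [set z]| = 19 by have := cardsC [set z]; rewrite cards1 V2; clear; lia.
  have zT : ~: [set z] != setT by apply/eqP => T; have := in_setT z; rewrite -T !inE eqxx.
  have dz : Cubic.d G2 (~: [set z]) <= 3 by rewrite dC d1.
  have cz1 : 1 < #|~: [set z]| by rewrite cz.
  have cz31 : #|~: [set z]| <= 31 by rewrite cz.
  have [Y3 [s3 [dY3 [_ [_ cY3 _]]]]] := heawood_kernel_exists conn2 U2 clz cz1 cz31 zT dz.
  exact: (seven_left_false conn2 U2 clz dY3 cY3 V2).
(* A multiple edge avoiding [z1] is at [z2], and one avoiding [z2] is at [z1]. *)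
have [w2 [w2z1 w2z2 m2]] := multi_edge (noclean z1) multi.
have [w1 [w1z2 w1z1 m1]] : exists w, [/\ w != z2, w != z1 & 1 < Cubic.mu G2 z1 w].
  by apply: (multi_edge (noclean z2)) => x y /multi; do 4!case: (_ == _).
(* A vertex of degree 3 cannot carry two double edges. *)
have w12 : w1 != w2.
  apply/eqP => ww; rewrite -ww in m2; have := mu_add G2 w1 (w2z1 : w2 != z1).
  have := mu_add G2 w1 (isT : z1 != z2); rewrite !(mu_sym G2 w1); move: m1 m2; clear; lia.
case: w2 w2z1 w2z2 m2 w12 => // w2 w2z1 _ m2; case: w1 w1z2 w1z1 m1 => // w1 _ w1z1 m1 w12.
have w2Y := valP w2; have w1Y := valP w1.
case E2: (val w2) w2Y => [w2'|] w2Y; last first.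
  by case/eqP: w2z1; congr Some; apply: val_inj.
case E1: (val w1) w1Y => [w1'|] w1Y; last first.
  by case/eqP: w1z1; congr Some; apply: val_inj.
have w12' : val w1' != val w2'.
  by apply: contraNneq w12 => /val_inj ww; apply/eqP; congr Some; apply: val_inj; rewrite E1 E2 ww.
have ew1 : 1 < e G Y1 [set val w1'] by move: m1; rewrite con_mu_Some E1 con_mu_None.
have ew2 : 1 < e G1 Y2 [set Some w2'] by move: m2; rewrite con_mu_None E2.
have cV1 : #|Y1| + 1 < #|V| by rewrite cY1 V44.
have cV2 : #|Y2| + 1 < #|ctype Y1| by rewrite cY2 V1.
have [P1 [Q1 [pc1 in1]]] := heawood_piece conn Hw1 cV1 (valP w1') ew1.
have [P2 [Q2 [pc2 in2]]] := heawood_piece conn1 Hw2 cV2 w2Y ew2.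
have N2 (x : ctype Y1) : x \in Some w2' |: Y2 -> x != None.
  by rewrite !inE => /orP[/eqP->//|xY]; apply: contraNneq (NY2) => <-.
(* The vertices of [G1] other than the contracted one are vertices of [G]; the value at [None] is a
   filler, since [N2] keeps the second piece away from it. *)
pose lo (x : ctype Y1) : V := if x is Some z then val z else val w2'.
exists P1, Q1, (lo \o P2), (lo \o Q2); split=> //.
  split.
  - move=> i i7 /=; have [/N2 + _] := in2 i i7; have := pc_P pc2 i7.
    by case: (P2 i).
  - move=> i i7 /=; have [_ /N2] := in2 i i7; have := pc_Q pc2 i7.
    by case: (Q2 i).
  - move=> i j i7 j7 /=; have [/N2 + _] := in2 i i7; have [_ /N2] := in2 j j7.
    have := pc_mu pc2 i7 j7; case: (P2 i) => // x; case: (Q2 j) => // y.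
    by rewrite con_mu_Some.
move=> i j i7 j7 /=; have [] := in1 i i7; rewrite !inE => P1i _.
have [+ _] := in2 j j7; case: (P2 j) => [z|] /=; last by rewrite !inE /= (negPf NY2).
move=> zin e12; rewrite e12 (negPf (valP z)) orbF in P1i.
move: zin; rewrite (val_inj (eqP P1i)) !inE (negPf w1Y) orbF => /eqP[ww].
by case/eqP: w12'; rewrite ww.
Qed.

End Chain.

(** * Incidence graphs of configurations *)

Section ConfigGraph.
Variables (T : finType) (B : {set {set T}}).
Hypothesis cfg : is_sym_config3 B.

Definition cvertex : finType := (T + {b : {set T} | b \in B})%type.
Definition incidence (x y : cvertex) : nat :=
  match x, y with
  | inl a, inr b => a \in val b
  | inr b, inl a => a \in val b
  | _, _ => 0
  end.
Definition is_point (x : cvertex) : bool := if x is inl _ then true else false.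

Lemma incidence_sym x y : incidence x y = incidence y x.
Proof. by case: x y => [a|b] [a'|b']. Qed.

Lemma incidence_side x y : is_point x = is_point y -> incidence x y = 0.
Proof. by case: x y => [a|b] [a'|b']. Qed.

Lemma block_card b : b \in B -> #|b| = 3. Proof. by case: cfg => _ h _ _; apply: h. Qed.
Lemma point_card x : #|[set b in B | x \in b]| = 3. Proof. by case: cfg. Qed.

Lemma block_lin b b' x y : b \in B -> b' \in B -> x != y ->
  x \in b -> y \in b -> x \in b' -> y \in b' -> b = b'.
Proof.
case: cfg => _ _ _ h bB bB' xy xb yb xb' yb'; apply/eqP/negPn/negP => bb.
have := h x y xy; rewrite leqNgt => /negP[]; apply/card_gt1P; exists b, b'.
by rewrite !inE bB bB' xb yb xb' yb'.
Qed.

Lemma incidence_deg x : \sum_y incidence x y = 3.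
Proof.
rewrite big_sumType /=; case: x => [a|b] /=.
  rewrite big1 // add0n -(point_card a) -sum1_card.
  rewrite (reindex_omap (fun b : {b : {set T} | b \in B} => val b) insub) /=; last first.
    by move=> b; rewrite inE => /andP[bB _]; rewrite insubT.
  rewrite [RHS]big_mkcond; apply: eq_bigr => b _.
  by rewrite inE (valP b) valK eqxx andbT; case: (a \in val b).
rewrite [X in _ + X]big1 // addn0 -(block_card (valP b)) -sum1_card big_mkcond [RHS]big_mkcond.
by apply: eq_bigr => a _; case: (a \in _).
Qed.

Definition incidence_graph : bicubic cvertex :=
  Bicubic incidence_sym incidence_side incidence_deg.
Notation G := incidence_graph.

Lemma incidence_le1 x y : mu G x y <= 1.
Proof. by case: x y => [a|b] [a'|b'] //=; case: (_ \in _). Qed.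

Lemma adj_block a b : adj G (inr b) (inl a) = (a \in val b).
Proof. by rewrite /adj /=; case: (a \in _). Qed.

Lemma adj_point a b : adj G (inl a) (inr b) = (a \in val b).
Proof. by rewrite adjC adj_block. Qed.

Lemma card_cvertex : #|cvertex| = 2 * #|T|.
Proof.
by rewrite card_sum card_sig; case: cfg => <- _ _ _; rewrite mul2n -addnn; congr (_ + _).
Qed.

Lemma block_point (b : {b : {set T} | b \in B}) : exists a, a \in val b.
Proof. by apply/card_gt0P; rewrite (block_card (valP b)). Qed.

Lemma incidence_connected : config_connected B -> connected G.
Proof.
move=> conn X X0 XT; pose P := [set a | inl a \in X].
have cross x y : x \in X -> y \notin X -> adj G x y -> 0 < d G X.
  by move=> xX yX a; apply: (e_gt0 xX _ a); rewrite inE.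
case: (eqVneq P set0) => [P0|P0].
  case/set0Pn: X0 => -[a aX|b bX]; first by have := in_set0 a; rewrite -P0 inE aX.
  have [a ab] := block_point b; apply: (cross (inr b) (inl a)) => //; last by rewrite adj_block.
  by have := in_set0 a; rewrite -P0 inE => ->.
case: (eqVneq P setT) => [PT|PT].
  have /set0Pn[[a|b]] : ~: X != set0 by apply: contra XT => /eqP h; rewrite -(setCK X) h setC0.
    by rewrite inE; have := in_setT a; rewrite -PT inE => ->.
  rewrite inE => bX; have [a ab] := block_point b.
  apply: (cross (inl a) (inr b)) => //; last by rewrite adj_point.
  by have := in_setT a; rewrite -PT inE.
have [b bB /andP[/subsetPn[a ab aP] /subsetPn[a' ab' aP']]] := conn P P0 PT.
rewrite !inE negbK in aP aP'; case: (boolP (inr (exist _ b bB) \in X)) => bX.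
  by apply: (cross (inr (exist _ b bB)) (inl a)); rewrite // adj_block.
by apply: (cross (inl a') (inr (exist _ b bB))); rewrite // adj_point.
Qed.

Lemma incidence_uncolourable : has_no_blocking_set B -> uncolourable G.
Proof.
move=> nb c good; apply: (nb [set a | c (inl a)]) => b bB.
have [[a|x] [[a'|y] [h1 h2 h3]]] := good (inr (exist _ b bB)) isT; try by [].
rewrite adj_block /= in h1; rewrite adj_block /= in h2.
have key u u' : u \in b -> u' \in b -> c (inl u) -> ~~ c (inl u') ->
    (b :&: [set a | c (inl a)] != set0) /\ (b :\: [set a | c (inl a)] != set0).
  move=> ub ub' cu cu'; split; apply/set0Pn; [exists u|exists u']; rewrite !inE.
    by rewrite ub cu.
  by rewrite ub' cu'.
case ca: (c (inl a)) h3; case ca': (c (inl a')) => // _.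
  by apply: (key a a') => //; rewrite ca'.
by apply: (key a' a) => //; rewrite ca.
Qed.

Lemma config_linear_space : config_connected B -> linear_space setT B.
Proof.
move=> conn; split.
- exact: block_card.
- by move=> b _; apply: subsetT.
- exact: block_lin.
move=> S _ S0 closed; apply/eqP/negPn/negP => ST.
have [b bB /andP[nb /subsetPn[x xb]]] := conn S S0 ST; rewrite inE negbK => xS.
by case/negP: nb; apply: (closed b x).
Qed.

Lemma no_octagon_quad_free : (forall c, ~~ gcycle G 8 c) -> quad_free B.
Proof.
move=> no b1 b2 b3 b4 x1 x2 x3 x4 B1 B2 B3 B4 ub ux h1 h2 h3 h4 h5 h6 h7 h8.
have /negP := no [:: inl x1; inr (exist _ b1 B1); inl x2; inr (exist _ b2 B2);
  inl x3; inr (exist _ b3 B3); inl x4; inr (exist _ b4 B4)]; apply.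
have /and5P[n1 n2 n3 n4 /and3P[n5 n6 _]] : [&& b1 != b2, b1 != b3, b1 != b4, b2 != b3, b2 != b4, b3 != b4 & true].
  by move: ub; rewrite /= !inE !negb_or -!andbA.
have /and5P[m1 m2 m3 m4 /and3P[m5 m6 _]] : [&& x1 != x2, x1 != x3, x1 != x4, x2 != x3, x2 != x4, x3 != x4 & true].
  by move: ux; rewrite /= !inE !negb_or -!andbA.
have pp a a' : ((inl a : cvertex) == inl a') = (a == a') by [].
have bb b b' : ((inr b : cvertex) == inr b') = (val b == val b') by [].
have pb a b : ((inl a : cvertex) == inr b) = false by [].
have bp a b : ((inr b : cvertex) == inl a) = false by [].
rewrite /gcycle /= !in_cons !in_nil !pp !bb !pb !bp /= !adj_block !adj_point /= h1 h2 h3 h4 h5 h6 h7 h8.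
by rewrite !orbF !negb_or m1 m2 m3 m4 m5 m6 n1 n2 n3 n4 n5 n6.
Qed.

(** The block [Q 0] keeps the points with labels 1 and 3 and has some third point [u] instead of
    label 0. This [u] is none of the seven points, because among them only 1 and 3 are incident with
    [Q 0]. *)
Lemma piece_points P Q : piece G P Q -> exists f u, [/\ forall i, i < 7 -> P i = inl (f i),
  forall i j, i < 7 -> j < 7 -> f i = f j -> i = j,
  forall t, t \in piece_blocks 0 -> bset f t \in B,
  [set f 1; f 3; u] \in B & forall i, i < 7 -> f i != u].
Proof.
move=> pc.
have [x0 _] : exists x : T, True by have := pc_P pc (isT : 0 < 7); case: (P 0) => // a _; exists a.
pose f i := if P i is inl a then a else x0.
have Pf i : i < 7 -> P i = inl (f i) by move=> i7; rewrite /f; have := pc_P pc i7; case: (P i).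
have Qf j : j < 7 -> exists b, Q j = inr b by move=> j7; have := pc_Q pc j7; case: (Q j) => // b; exists b.
have fin i j b : i < 7 -> j < 7 -> Q j = inr b -> (f i \in val b) = fano i j && (0 < i + j).
  move=> i7 j7 Qb; have := pc_mu pc i7 j7; rewrite (Pf i i7) Qb /=.
  by case: (f i \in val b); case: (fano i j && _).
have finj i j : i < 7 -> j < 7 -> f i = f j -> i = j.
  move=> i7 j7 fij.
  have chk : all (fun i => all (fun j => all (fun k => (fano i k && (0 < i + k)) == (fano j k && (0 < j + k))) (iota 0 7)
     ==> (i == j)) (iota 0 7)) (iota 0 7) by vm_compute.
  have /implyP h := all7P (all7P chk i7) j7; apply/eqP/h/allP => k; rewrite mem_iota => k7.
  by have [b Qb] := Qf k k7; rewrite -!(fin _ _ b) // fij.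
have card3 i j k : i < 7 -> j < 7 -> k < 7 -> uniq [:: i; j; k] -> #|[set f i; f j; f k]| = 3.
  move=> i7 j7 k7; rewrite /= !inE negb_or andbT => /andP[/andP[ij ik] jk].
  have ne a b : a < 7 -> b < 7 -> a != b -> f a != f b.
    by move=> a7 b7; apply: contraNneq => /finj->.
  by rewrite setUC cardsU1 cards2 !inE negb_or !(eq_sym (f k)) !ne.
have blk i j k l : i < 7 -> j < 7 -> k < 7 -> l < 7 -> uniq [:: i; j; k] -> 0 < l ->
    fano i l -> fano j l -> fano k l -> [set f i; f j; f k] \in B.
  move=> i7 j7 k7 l7 u l0 fi fj fk; have [b Qb] := Qf l l7.
  have -> : [set f i; f j; f k] = val b; last exact: (valP b).
  apply/eqP; rewrite eqEcard card3 // (block_card (valP b)) leqnn andbT.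
  by apply/subsetP => x; rewrite !inE => /orP[/orP[]|] /eqP->; rewrite (fin _ l) // ?fi ?fj ?fk addn_gt0 l0 orbT.
have [b0 Qb0] := Qf 0 isT.
have n13 : f 1 != f 3 by apply/eqP => /finj => /(_ isT isT).
have f1 : f 1 \in val b0 by rewrite (fin 1 0).
have f3 : f 3 \in val b0 by rewrite (fin 3 0).
have [u [uE n1 n3]] : exists u, [/\ val b0 = [set f 1; f 3; u], f 1 != u & f 3 != u].
  have : #|val b0 :\: [set f 1; f 3]| = 1.
    rewrite cardsD (setIidPr _) ?cards2 ?n13 ?(block_card (valP b0)) //.
    by apply/subsetP => x; rewrite !inE => /orP[] /eqP->.
  move/eqP/cards1P => [u uE]; exists u.
  have : u \in val b0 :\: [set f 1; f 3] by rewrite uE set11.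
  rewrite !inE negb_or => /andP[/andP[u1 u3] ub]; rewrite !(eq_sym _ u) u1 u3; split=> //.
  rewrite -uE; apply/setP => x; rewrite !inE; case: (eqVneq x (f 1)) => [->//|_] /=.
  by case: (eqVneq x (f 3)) => [->//|_].
exists f, u; split=> //.
- move=> t; rewrite !inE /= => ht.
  case/or4P: ht => [|||/or3P[]] /eqP->; rewrite /bset ?addn0;
  [apply: (blk 6 0 2 1)|apply: (blk 5 6 1 2)|apply: (blk 4 5 0 3)|apply: (blk 3 4 6 4)|apply: (blk 2 3 5 5)|apply: (blk 1 2 4 6)] => //.
- by rewrite -uE; apply: (valP b0).
move=> i i7; apply/eqP => iu; have : f i \in val b0 by rewrite uE iu !inE eqxx orbT.
rewrite (fin i 0) // addn0; move: iu n1 n3; case: i i7 => [|[|[|[|[|[|[|i]]]]]]] //= _ ->; by rewrite eqxx.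
Qed.

(** Without an 8-cycle in its incidence graph the configuration has no quadrilateral, hence has a
    blocking set by computation. With one, the two disjoint pieces provide the seed of the last
    search. *)
Lemma config_classification : #|T| = 22 -> config_connected B -> has_no_blocking_set B ->
  config_iso B C22.
Proof.
move=> T22 conn nb; have LS := config_linear_space conn.
have deg3 x : bdeg B x = 3 by apply: point_card.
have oct : exists c, gcycle G 8 c.
  case: (cycle8_or_none G setT) => [[c gc _]|no]; first by exists c.
  have [] : exists S, blocking_set B S; last by move=> S /nb.
  apply: (quad_free_blocking LS) => //; first by rewrite cardsT.
  apply: no_octagon_quad_free => c; apply/negP => gc; have := no c gc.
  by rewrite (eq_all (a2 := predT)) ?all_predT // => x; rewrite /= inE.
have V44 : #|cvertex| = 44 by rewrite card_cvertex T22.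
have [P1 [Q1 [P2 [Q2 [pc1 pc2 dis]]]]] := two_disjoint_pieces (incidence_connected conn)
  (incidence_uncolourable nb) V44 incidence_le1 oct.
have [f1 [u1 [Pf1 inj1 bl1 bu1 nu1]]] := piece_points pc1.
have [f2 [u2 [Pf2 inj2 bl2 bu2 nu2]]] := piece_points pc2.
pose phi i := if i < 7 then f1 i else f2 (i - 7).
have : (exists S, blocking_set B S) \/ config_iso B C22; last by case=> // -[S /nb].
have dis' i j : i < 7 -> j < 7 -> f1 i <> f2 j.
  by move=> i7 j7 e; apply: (dis i j) => //; rewrite Pf1 // Pf2 // e.
apply: (two_pieces LS deg3 T22 (phi := phi) (u1 := u1) (u2 := u2)) => //.
- move=> i j il jl; rewrite /phi; case: ltnP => i7; case: ltnP => j7.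
  + exact: inj1.
  + by move/dis' => []; rewrite ?ltn_subLR.
  + by move/esym/dis' => []; rewrite ?ltn_subLR.
  + move/inj2; rewrite !ltn_subLR // => /(_ il jl); move: i7 j7; clear; lia.
- move=> t; rewrite mem_cat => /orP[t0|].
    by have := bl1 t t0; move: t0; rewrite !inE => h; case/or4P: h => [|||/or3P[]] /eqP->.
  case/mapP => t0 tin ->; have := bl2 (t0.1.1 + 0, t0.1.2 + 0, t0.2 + 0).
  have phi7 i : phi (i + 7) = f2 i by rewrite /phi ltnNge leq_addl addnK.
  by rewrite map_f // => /(_ isT); rewrite /bset /= !addn0 !phi7.
- by move=> i i7; rewrite /phi i7; apply: nu1.
- by move=> i i7; rewrite /phi ltnNge leq_addr /= addKn; apply: nu2.
Qed.

End ConfigGraph.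

(** * The configuration C22 *)

Section Example.

Notation pt i := (inord i : 'I_22).

Lemma pt_inj i j : i < 22 -> j < 22 -> pt i = pt j -> i = j.
Proof. by move=> i22 j22 /(congr1 (@nat_of_ord 22)); rewrite !inordK. Qed.

Lemma C22_labels : labels_below 22 C22_blocks. Proof. by vm_compute. Qed.
Lemma C22_distinct : distinct_blocks 22 C22_blocks. Proof. by vm_compute. Qed.

Lemma mem_C22 b : (b \in C22) = (b \in [seq bset (fun i => pt i) t | t <- C22_blocks]).
Proof. by rewrite inE. Qed.

Lemma card_set_count (U : finType) (s : seq U) (A : {set U}) (p : pred U) :
  uniq s -> A =i s -> #|[set b in A | p b]| = count p s.
Proof.
move=> us As; rewrite -size_filter -(card_uniqP (filter_uniq p us)); apply: eq_card => b.
by rewrite in_set As mem_filter andbC.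
Qed.

(** Turns the cardinalities in the axioms into counts over the list of triples, which can be
    computed. *)
Lemma card_C22 (p : pred {set 'I_22}) (q : pred triple) :
  (forall t, t \in C22_blocks -> p (bset (fun i => pt i) t) = q t) ->
  #|[set b in C22 | p b]| = count q C22_blocks.
Proof.
move=> pq; rewrite (card_set_count p (uniq_bset pt_inj C22_labels C22_distinct) mem_C22).
by rewrite count_map; apply: eq_in_count.
Qed.

Lemma ord22 (x : 'I_22) : pt x = x. Proof. exact: inord_val. Qed.

Lemma all22P (p : pred nat) i : all p (iota 0 22) -> i < 22 -> p i.
Proof. by move=> /allP h i22; apply: h; rewrite mem_iota. Qed.

Lemma C22_config : is_sym_config3 C22.
Proof.
split.
- have -> : C22 = [set b in C22 | predT b] by apply/setP => b; rewrite !inE andbT.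
  by rewrite (card_C22 (q := predT)) // card_ord count_predT.
- move=> b; rewrite mem_C22 => /mapP[t tC ->].
  have : all (fun t => uniq [:: t.1.1; t.1.2; t.2]) C22_blocks by vm_compute.
  by move=> /allP/(_ _ tC); apply: (card_bset pt_inj C22_labels).
- move=> x; rewrite (card_C22 (q := tmem x)) => [|t tC]; last by rewrite -{1}(ord22 x) (mem_bset_inj pt_inj C22_labels).
  have chk : all (fun i => count (tmem i) C22_blocks == 3) (iota 0 22) by vm_compute.
  exact/eqP/(all22P chk).
move=> x y xy.
rewrite (card_C22 (q := fun t => tmem x t && tmem y t)) => [|t tC]; last first.
  by rewrite -{1}(ord22 x) -{1}(ord22 y) !(mem_bset_inj pt_inj C22_labels).
have chk : all (fun i => all (fun j => (i == j) ||
  (count (fun t => tmem i t && tmem j t) C22_blocks <= 1)) (iota 0 22)) (iota 0 22) by vm_compute.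
by have := all22P (all22P chk (ltn_ord x)) (ltn_ord y); rewrite val_eqE (negPf xy).
Qed.

Lemma C22_connected : config_connected C22.
Proof.
move=> P P0 PT; 
case: (boolP [exists b in C22, ~~ (b \subset P) && ~~ (b \subset ~: P)]) => [/exists_inP//|none].
have no b : b \in C22 -> ~~ (~~ (b \subset P) && ~~ (b \subset ~: P)).
  by move=> bC; apply: contra none => h; apply/exists_inP; exists b.
pose m i := pt i \in P.
have mono t : t \in C22_blocks -> m t.1.1 = m t.1.2 /\ m t.1.2 = m t.2.
  move=> tC; have := no (bset (fun i => pt i) t); rewrite mem_C22 map_f // => /(_ isT).
  case: t {tC} => [[x y] z] /=; rewrite negb_and !negbK /m => /orP[] /subsetP h.
    by rewrite !h // !inE eqxx ?orbT.
  have h' i : i \in [:: x; y; z] -> (pt i \in P) = false.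
    move=> hi; apply/negbTE; rewrite -in_setC; apply: h.
    by move: hi; rewrite !inE => /or3P[] /eqP->; rewrite eqxx ?orbT.
  by rewrite !h' // !inE eqxx ?orbT.
have mE i : i < 22 -> m i = m 0.
  (* These eleven blocks already connect all 22 points. *)
  have [? ?] := mono (0, 1, 2) isT; have [? ?] := mono (0, 3, 4) isT.
  have [? ?] := mono (0, 5, 6) isT; have [? ?] := mono (2, 4, 21) isT.
  have [? ?] := mono (5, 8, 15) isT; have [? ?] := mono (7, 11, 21) isT.
  have [? ?] := mono (7, 9, 12) isT; have [? ?] := mono (7, 10, 20) isT.
  have [? ?] := mono (13, 15, 19) isT; have [? ?] := mono (13, 14, 17) isT.
  have [? ?] := mono (13, 16, 18) isT; simpl in *.
  by do 22 (case: i => [|i]; first by congruence).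
have mP x : (x \in P) = m 0 by rewrite -(mE x) // /m ord22.
case m0: (m 0) mP => mP.
  by case/eqP: PT; apply/setP => x; rewrite mP inE.
by case/eqP: P0; apply/setP => x; rewrite mP inE.
Qed.

Definition monochromatic (col : seq bool) (t : triple) : bool :=
  let: (x, y, z) := t in
  [&& x < size col, y < size col, z < size col,
      nth false col x == nth false col y & nth false col y == nth false col z].

(** A tree of partial colourings, extended by one point at a time. With the blocks grouped by their
    largest point, a branch is closed by a block that has just become monochromatic. *)
Fixpoint refute (groups : seq (seq triple)) (col : seq bool) : bool :=
  if groups is g :: gs then
    all (fun c => let col' := rcons col c in if has (monochromatic col') g then true else refute gs col')
      [:: true; false]
  else false.

(** The colouring [m] selects one branch of the tree, and the block closing that branch is the one
    wanted. *)
Lemma refuteP (m : nat -> bool) groups k : refute groups (mkseq m k) ->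
  exists g x y z, [/\ g \in groups, (x, y, z) \in g, m x = m y & m y = m z].
Proof.
elim: groups k => //= g gs IH k; rewrite andbT => h.
have : has (monochromatic (mkseq m k.+1)) g || refute gs (mkseq m k.+1).
  by rewrite /mkseq -addn1 iotaD map_cat cats1 add0n; case: (m k) h => /andP[].
case/orP => [/hasP[[[x y] z] tg] | /IH[g' [x [y [z [g'in tin e1 e2]]]]]].
  rewrite /monochromatic size_mkseq => /and5P[xk yk zk]; rewrite !nth_mkseq // => /eqP e1 /eqP e2.
  by exists g, x, y, z; rewrite inE eqxx.
by exists g', x, y, z; rewrite inE g'in orbT.
Qed.

Definition C22_groups : seq (seq triple) :=
  [seq [seq t <- C22_blocks | maxn (maxn t.1.1 t.1.2) t.2 == k] | k <- iota 0 22].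

Lemma refute_C22 : refute C22_groups [::]. Proof. by vm_compute. Qed.

Lemma C22_no_blocking_set : has_no_blocking_set C22.
Proof.
move=> Q bl; pose m i := pt i \in Q.
have [g [x [y [z [/mapP[k _ ->]]]]]] := @refuteP m _ 0 refute_C22.
rewrite mem_filter => /andP[_ tC] xy yz.
have [|/set0Pn[u uQ] /set0Pn[v vQ]] := bl (bset (fun i => pt i) (x, y, z)).
  by rewrite mem_C22; apply: map_f tC.
have key w : w \in bset (fun i => pt i) (x, y, z) -> (w \in Q) = m x.
  by rewrite !inE => /orP[/orP[]|] /eqP->; rewrite -/(m _) ?yz ?xy ?yz.
move: uQ vQ; rewrite in_setI in_setD => /andP[ub uQ] /andP[vQ vb].
by move: vQ; rewrite (key v vb) -(key u ub) uQ.
Qed.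

End Example.

Theorem mainTheorem10 :
  (is_sym_config3 C22 /\ config_connected C22 /\ has_no_blocking_set C22) /\
  (forall (T : finType) (B : {set {set T}}),
      #|T| = 22 -> is_sym_config3 B -> config_connected B ->
      has_no_blocking_set B -> config_iso B C22).
Proof.
split; first by split; [exact: C22_config | split; [exact: C22_connected | exact: C22_no_blocking_set]].
by move=> T B T22 cfg conn nb; apply: config_classification.
Qed.
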